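(* Let $u_0\equiv0$ and $f(x,t)=q_0(x)+t\,q_1(x)$ with $q_0,q_1\in L^2(\Omega)$. Let $u_h$ be the solution of the space semidiscrete problem, let $W_h^n$ ($n\ge1$) be the solution of the averaging Crank–Nicolson (ACN) scheme, with $\widetilde\omega$ either of the two generating functions given in the context, and let $U_h^n:=W_h^n+u_h(0)$. Then there exist $\tau_0>0$ and a constant $C>0$, independent of $\tau$, $h$, $n$, $q_0$ and $q_1$, such that for all time steps $\tau=T/N\in(0,\tau_0)$ and all $1\le n\le N$, $$\|u_h(t_n)-U_h^n\|_{L^2(\Omega)}\le C\Big[\tau^2\big(t_n^{\alpha-2}\|q_0\|_{L^2(\Omega)}+t_n^{\alpha-1}\|q_1\|_{L^2(\Omega)}\big)+\tau^\alpha\|q_0\|_{L^2(\Omega)}\Big].$$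
   Context: Let $\alpha\in(0,1)$, $T>0$, and let $\Omega\subset\mathbb R^d$ be a polygonal domain. The continuous problem is $\partial_t^\alpha u-\Delta u=f$ in $\Omega\times(0,T]$, $u(\cdot,0)=u_0$, $u=0$ on $\partial\Omega$, where $\partial_t^\alpha\phi(t)=\frac1{\Gamma(1-\alpha)}\int_0^t\frac{\phi'(s)}{(t-s)^\alpha}\,ds$ is the Caputo derivative. Space discretization: $\mathcal T_h$ is a shape regular, quasi-uniform triangulation of $\Omega$ of mesh size $h$; $V_h\subset H_0^1(\Omega)$ is the space of continuous piecewise linear functions on $\mathcal T_h$ vanishing on $\partial\Omega$. $P_h:L^2(\Omega)\to V_h$ is the $L^2$-projection; $R_h:H_0^1(\Omega)\to V_h$ is the Ritz projection, $(\nabla R_h\phi,\nabla\chi_h)=(\nabla\phi,\nabla\chi_h)$ for all $\chi_h\in V_h$; $\Delta_h:V_h\to V_h$ is defined by $(\Delta_h\phi_h,\chi_h)=-(\nabla\phi_h,\nabla\chi_h)$ for all $\phi_h,\chi_h\in V_h$. The space semidiscrete solution $u_h(t)\in V_h$ satisfies $(\partial_t^\alpha u_h,\chi_h)+(\nabla u_h,\nabla\chi_h)=(f,\chi_h)$ for all $\chi_h\in V_h$, $t>0$, with $u_h(0)=v_h:=R_hu_0$. Put $f_h:=P_hf$ and $f_h^n=f_h(t_n)$. Time discretization: $t_n=n\tau$, $\tau=T/N$. The generating function $\widetilde\omega(\zeta)=\sum_{k\ge0}\widetilde\omega_k\zeta^k$ is one of: $\widetilde\omega(\zeta)=\left(\frac32-2\zeta+\frac12\zeta^2\right)^\alpha$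 (fractional BDF-2), or $\widetilde\omega(\zeta)=(1-\zeta)^\alpha\left[1+\frac\alpha2(1-\zeta)\right]$ (generalized second-order Newton–Gregory formula). Set $\omega_k=\frac12\widetilde\omega_k+\frac12\widetilde\omega_{k-1}$ (with $\widetilde\omega_{-1}=0$), so that $\omega(\zeta)=\sum_k\omega_k\zeta^k=\frac{1+\zeta}2\widetilde\omega(\zeta)$, and $D_\tau^\alpha\phi^{n-\frac12}:=\tau^{-\alpha}\sum_{k=0}^n\omega_{n-k}\phi^k$. ACN scheme: $W_h^0=0$ and, for $n\ge1$, $W_h^n\in V_h$ satisfies $$D_\tau^\alpha W_h^{n-\frac12}-\tfrac12(\Delta_hW_h^n+\Delta_hW_h^{n-1})=\tfrac12(f_h^n+f_h^{n-1})+\Delta_hv_h.$$ *)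

(* Defs.v *)
From HB Require Import structures.
From mathcomp Require Import all_boot all_order all_algebra.
From mathcomp Require Import all_classical all_reals all_analysis.
Set Implicit Arguments.
Unset Strict Implicit.
Unset Printing Implicit Defensive.
Import Order.TTheory GRing.Theory Num.Theory numFieldNormedType.Exports.
Local Open Scope classical_set_scope.
Local Open Scope ring_scope.

(* Points of R^d are row vectors 'rV[R]_d: MathComp-Analysis has their topology
   (sup norm), but neither their sigma-algebra nor the Lebesgue measure. *)

(* Product sigma-algebra on 'rV[T]_n, as the library does for n.-tuple T; for
   T = R it is the Borel sigma-algebra of R^n. *)
Definition measure_rV_display : measure_display -> measure_display.
Proof. exact. Qed.

Section measurable_rV.
Context {d} {T : measurableType d} (n : nat).

Definition rV_coord (i : 'I_n) (x : 'rV[T]_n) : T := x ord0 i.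

Let rV_set0 : g_sigma_preimage rV_coord set0.
Proof. exact: sigma_algebra0. Qed.

Let rV_setC A : g_sigma_preimage rV_coord A -> g_sigma_preimage rV_coord (~` A).
Proof. exact: sigma_algebraC. Qed.

Let rV_bigcup (F : (set 'rV[T]_n)^nat) :
  (forall i, g_sigma_preimage rV_coord (F i)) ->
  g_sigma_preimage rV_coord (\bigcup_i (F i)).
Proof. exact: sigma_algebra_bigcup. Qed.

HB.instance Definition _ := @isMeasurable.Build (measure_rV_display d)
  'rV[T]_n (g_sigma_preimage rV_coord) rV_set0 rV_setC rV_bigcup.

End measurable_rV.

Section measurable_fun_rV.
Context {d} {T : measurableType d}.

Lemma measurable_rV_coord n (i : 'I_n) :
  measurable_fun setT (fun x : 'rV[T]_n => x ord0 i).
Proof.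
move=> _ Y mY; rewrite setTI; apply: sub_sigma_algebra => /=.
rewrite -bigcup_seq/=; exists i => /=; first by rewrite mem_index_enum.
by exists Y => //; rewrite setTI.
Qed.

Lemma measurable_fun_rV {d'} {S : measurableType d'} n (f : S -> 'rV[T]_n) :
  (forall i, measurable_fun setT (fun x => f x ord0 i)) -> measurable_fun setT f.
Proof.
move=> mf _ Y; rewrite setTI; apply: (@smallest_sub _ _ _
    [set A : set 'rV[T]_n | measurable (f @^-1` A)]); last first.
  rewrite -bigcup_seq/= => A [i _ [B mB <-]]; rewrite setTI /=.
  by rewrite -[X in measurable X]setTI; exact: (mf i).
split => /=.
- by rewrite preimage_set0.
- by move=> A mA; rewrite setTD -preimage_setC; exact: measurableC.
- by move=> F mF; rewrite preimage_bigcup; exact: bigcupT_measurable.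
Qed.

End measurable_fun_rV.

Lemma product_measure_sigma_finite d1 d2 (T1 : measurableType d1)
    (T2 : measurableType d2) (R : realType)
    (m1 : {sigma_finite_measure set T1 -> \bar R})
    (m2 : {sigma_finite_measure set T2 -> \bar R}) :
  sigma_finite setT (m1 \x m2)%E.
Proof.
have /sigma_finiteP[F [TF ndF Foo]] := sigma_finiteT m1.
have /sigma_finiteP[G [TG ndG Goo]] := sigma_finiteT m2.
exists (fun n => F n `*` G n).
  rewrite -setXTT TF TG predeqE => -[x y]; split.
    move=> [/= [n _ Fnx] [k _ Gky]]; exists (maxn n k) => //; split.
    - by move: x Fnx; exact/subsetPset/ndF/leq_maxl.
    - by move: y Gky; exact/subsetPset/ndG/leq_maxr.
  by move=> [n _ []/= ? ?]; split; exists n.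
move=> k; have [? ?] := Foo k; have [? ?] := Goo k.
split; first exact: measurableX.
by rewrite product_measure1E// lte_mul_pinfty// ge0_fin_numE.
Qed.

Section lebesgue_measure_rV.
Context {R : realType}.

Definition rV_cons n (p : measurableTypeR R * 'rV[R]_n) : 'rV[R]_n.+1 := row_mx p.1%:M p.2.

Lemma measurable_rV_cons n : measurable_fun setT (@rV_cons n).
Proof.
apply: measurable_fun_rV => i; rewrite /rV_cons.
case: (@split_ordP 1 n i) => j ->.
- rewrite (_ : (fun _ => _) = fst); first exact: measurable_fst.
  apply/funext => -[a x]; rewrite (@row_mxEl R 1 1 n) (ord1 j).
  by rewrite (@mxE R 1 1) eqxx mulr1n.
- rewrite (_ : (fun _ => _) = (fun x : 'rV[R]_n => x ord0 j) \o snd).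
    by apply: measurableT_comp; [exact: measurable_rV_coord|exact: measurable_snd].
  by apply/funext => -[a x]; rewrite (@row_mxEr R 1 1 n).
Qed.


Section step.
Variables (n : nat) (mu : {sigma_finite_measure set 'rV[R]_n -> \bar R}).

Let prod : {measure set (measurableTypeR R * 'rV[R]_n) -> \bar R} :=
  (@lebesgue_measure R \x mu)%E.

Definition lebesgue_rV_step : set 'rV[R]_n.+1 -> \bar R :=
  pushforward prod (@rV_cons n).

Let step0 : lebesgue_rV_step set0 = 0%E.
Proof. rewrite /lebesgue_rV_step /pushforward preimage_set0; exact: measure0. Qed.

Let step_ge0 A : (0 <= lebesgue_rV_step A)%E.
Proof. by rewrite /lebesgue_rV_step /pushforward; exact: (measure_ge0 prod). Qed.

Let step_sigma_additive : semi_sigma_additive lebesgue_rV_step.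
Proof.
move=> F mF tF mUF; rewrite /lebesgue_rV_step /pushforward preimage_bigcup.
have mpre A : measurable A -> measurable (@rV_cons n @^-1` A).
  by move=> mA; rewrite -[X in measurable X]setTI; exact: measurable_rV_cons.
apply: (@measure_semi_sigma_additive _ _ _ prod); first by move=> k; exact: mpre.
- apply/trivIsetP => i j _ _ ij; rewrite -preimage_setI.
  by move/trivIsetP : tF => /(_ _ _ _ _ ij) ->//; rewrite preimage_set0.
- by rewrite -preimage_bigcup; exact: mpre.
Qed.

HB.instance Definition _ := isMeasure.Build _ _ _ lebesgue_rV_step
  step0 step_ge0 step_sigma_additive.

Let step_sigma_finite : sigma_finite setT lebesgue_rV_step.
Proof.
have [F FT mF] := product_measure_sigma_finite (@lebesgue_measure R) mu.
pose uncons (x : 'rV[R]_n.+1) : measurableTypeR R * 'rV[R]_n :=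
  (x ord0 ord0, \row_i x ord0 (lift ord0 i)).
have muncons : measurable_fun setT uncons.
  apply/measurable_fun_pairP; split; first exact: measurable_rV_coord.
  apply: measurable_fun_rV => i.
  under eq_fun do rewrite /= mxE.
  exact: measurable_rV_coord.
have unconsK : cancel (@rV_cons n) uncons.
  move=> [a x]; rewrite /uncons /rV_cons/=; congr (_, _).
    rewrite (_ : ord0 = lshift n (ord0 : 'I_1)); last exact: val_inj.
    by rewrite (@row_mxEl R 1 1 n) mxE.
  apply/rowP => i; rewrite mxE.
  rewrite (_ : lift ord0 i = rshift 1 i); last exact: val_inj.
  by rewrite (@row_mxEr R 1 1 n).
exists (fun k => uncons @^-1` F k).
  by rewrite -preimage_bigcup -FT preimage_setT.
move=> k; have [mFk Fkoo] := mF k; split.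
  by rewrite -[X in measurable X]setTI; exact: muncons.
rewrite /lebesgue_rV_step /pushforward -comp_preimage.
by rewrite (_ : uncons \o _ = id)// funeqE => p /=; exact: unconsK.
Qed.

HB.instance Definition _ := @Measure_isSigmaFinite.Build _ _ _
  lebesgue_rV_step step_sigma_finite.

End step.

(* Lebesgue measure of R^n, as the n-fold product of the one of R. *)
Fixpoint lebesgue_rV_rec n : {sigma_finite_measure set 'rV[R]_n -> \bar R} :=
  if n is m.+1 then lebesgue_rV_step (lebesgue_rV_rec m)
  else dirac (0 : 'rV[R]_0).

Definition lebesgue_measure_rV n : set 'rV[R]_n -> \bar R := lebesgue_rV_rec n.

HB.instance Definition _ n := SigmaFiniteMeasure.on (@lebesgue_measure_rV n).

End lebesgue_measure_rV.

Section functions_on_domain.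
Context {R : realType} (d : nat).
Local Notation point := 'rV[R]_d.
Implicit Types (Omega : set point) (f g : point -> R) (F G : point -> point).

Definition square_integrable Omega f :=
  measurable_fun Omega f /\
  (@lebesgue_measure_rV R d).-integrable Omega (fun x => (f x ^+ 2)%:E).

Definition L2_inner Omega f g : R :=
  \int[@lebesgue_measure_rV R d]_(x in Omega) (f x * g x).

Definition L2_norm Omega f : R := Num.sqrt (L2_inner Omega f f).

Definition L2_inner_vec Omega F G : R :=
  \int[@lebesgue_measure_rV R d]_(x in Omega) \sum_(i < d) F x 0 i * G x 0 i.

Definition partial (i : 'I_d) f : point -> R := fun x => 'D_(delta_mx 0 i) f x.

(* All iterated partial derivatives are (Frechet) differentiable everywhere. *)
Definition smooth f :=
  forall (s : seq 'I_d) x, differentiable (foldr partial f s) x.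

Definition test_function Omega f :=
  smooth f /\
  exists K, [/\ compact K, K `<=` Omega & forall x, ~ K x -> f x = 0].

(* phi is in H^1_0(Omega), the H^1-closure of C_c^oo(Omega), with weak gradient
   G. *)
Definition H10_gradient Omega (phi : point -> R) G :=
  [/\ square_integrable Omega phi,
      forall i, square_integrable Omega (fun x => G x 0 i) &
      exists psi : nat -> point -> R,
      [/\ forall k, test_function Omega (psi k),
          (fun k => L2_norm Omega (psi k \- phi)) @ \oo --> (0 : R) &
          forall i, (fun k => L2_norm Omega
            (partial i (psi k) \- (fun x => G x 0 i))) @ \oo --> (0 : R)]].

End functions_on_domain.

Section finite_elements.
Context {R : realType} (d : nat).
Local Notation point := 'rV[R]_d.
Implicit Types (Omega : set point) (K : 'M[R]_(d.+1, d)).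

(* A d-simplex is given by its d+1 vertices, the rows of K. *)
Definition nondegenerate K := row_free (row_mx (const_mx 1 : 'cV[R]_d.+1) K).

(* Closed convex hull of the vertices with index in I (empty if I is). *)
Definition face K (I : {set 'I_d.+1}) : set point :=
  [set x | exists l : 'rV[R]_d.+1,
    [/\ forall i, 0 <= l 0 i, forall i, i \notin I -> l 0 i = 0,
        \sum_i l 0 i = 1 & x = l *m K]].

Definition simplex K : set point := face K [set: 'I_d.+1]%SET.

Definition euclidean_norm (x : point) : R := Num.sqrt (\sum_(i < d) x 0 i ^+ 2).

Definition diameter (A : set point) : R :=
  sup [set r | exists x y, [/\ A x, A y & r = euclidean_norm (x - y)]].

Definition inradius (A : set point) : R :=
  sup [set r | 0 <= r /\
    exists c, forall x, euclidean_norm (x - c) <= r -> A x].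

Definition polygonal_domain Omega :=
  [/\ Omega !=set0, connected Omega &
      exists P : seq 'M[R]_(d.+1, d),
        (forall K, K \in P -> nondegenerate K) /\
        Omega = (\bigcup_(K in [set` P]) simplex K)°].

(* Conforming: two distinct elements meet in a common proper face, possibly
   empty. *)
Definition triangulation Omega (Th : seq 'M[R]_(d.+1, d)) :=
  [/\ uniq Th,
      forall K, K \in Th -> nondegenerate K,
      closure Omega = \bigcup_(K in [set` Th]) simplex K &
      forall K K', K \in Th -> K' \in Th -> K != K' ->
        exists I J : {set 'I_d.+1},
          [/\ (#|I| <= d)%N, simplex K `&` simplex K' = face K I &
              simplex K `&` simplex K' = face K' J]].

Definition mesh_size (Th : seq 'M[R]_(d.+1, d)) : R :=
  \big[Num.max/0]_(K <- Th) diameter (simplex K).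

Definition shape_regular (Ths : set (seq 'M[R]_(d.+1, d))) :=
  exists2 sigma : R, 0 < sigma &
  forall Th, Ths Th -> forall K, K \in Th ->
    diameter (simplex K) <= sigma * inradius (simplex K).

Definition quasi_uniform (Ths : set (seq 'M[R]_(d.+1, d))) :=
  exists2 kappa : R, 0 < kappa &
  forall Th, Ths Th -> forall K, K \in Th ->
    mesh_size Th <= kappa * diameter (simplex K).

(* Continuous piecewise linear functions vanishing on the boundary, extended by
   zero to R^d, so that equality in V_h is equality of functions. *)
Definition fe_space Omega (Th : seq 'M[R]_(d.+1, d)) : set (point -> R) :=
  [set v | [/\ continuous v, forall x, ~ Omega x -> v x = 0 &
    forall K, K \in Th -> exists (a : R) (b : point),
      forall x, simplex K x -> v x = a + \sum_(i < d) b 0 i * x 0 i]].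

(* Gradient of v in V_h: the classical one in the interior of the elements, 0
   on the mesh skeleton, which is Lebesgue-negligible. *)
Definition fe_gradient (Th : seq 'M[R]_(d.+1, d)) (v : point -> R) :
    point -> point :=
  fun x => if `[< exists2 K, K \in Th & (simplex K)° x >]
           then \row_i partial i v x else 0.

Definition dirichlet_form Omega Th (v w : point -> R) : R :=
  L2_inner_vec Omega (fe_gradient Th v) (fe_gradient Th w).

Definition is_L2_projection Omega Th (Ph : (point -> R) -> point -> R) :=
  forall q, square_integrable Omega q ->
    fe_space Omega Th (Ph q) /\
    forall chi, fe_space Omega Th chi ->
      L2_inner Omega (Ph q) chi = L2_inner Omega q chi.

Definition is_ritz_projection Omega Th (Rh : (point -> R) -> point -> R) :=
  forall phi G, H10_gradient Omega phi G ->
    fe_space Omega Th (Rh phi) /\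
    forall chi, fe_space Omega Th chi ->
      dirichlet_form Omega Th (Rh phi) chi =
      L2_inner_vec Omega G (fe_gradient Th chi).

Definition is_discrete_laplacian Omega Th (Dh : (point -> R) -> point -> R) :=
  forall phi, fe_space Omega Th phi ->
    fe_space Omega Th (Dh phi) /\
    forall chi, fe_space Omega Th chi ->
      L2_inner Omega (Dh phi) chi = - dirichlet_form Omega Th phi chi.

End finite_elements.

Section fractional_calculus.
Context {R : realType}.
Local Notation mu := (@lebesgue_measure R).

Definition Gamma (x : R) : R :=
  \int[mu]_(t in `]0, +oo[%classic) (t `^ (x - 1) * expR (- t)).

Definition caputo_integrand (alpha : R) (phi : R -> R) (t s : R) : R :=
  derive1 phi s / (t - s) `^ alpha.

Definition caputo (alpha : R) (phi : R -> R) (t : R) : R :=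
  (Gamma (1 - alpha))^-1 *
  \int[mu]_(s in `]0, t[%classic) caputo_integrand alpha phi t s.

(* phi is in W^{1,1}(0, T); derive1 phi exists and equals g almost everywhere,
   which is all that the Caputo integral uses. *)
Definition absolutely_continuous (T : R) (phi : R -> R) :=
  exists2 g : R -> R, mu.-integrable `[0, T] (EFin \o g) &
  forall t, 0 <= t <= T ->
    phi t = phi 0 + \int[mu]_(s in `[0, t]%classic) g s.

End fractional_calculus.

Section schemes.
Context {R : realType} (d : nat).
Local Notation point := 'rV[R]_d.
Implicit Types (Omega : set point) (Th : seq 'M[R]_(d.+1, d)).

(* u t is the function u_h(t).  V_h being finite-dimensional, absolute
   continuity in time and the Caputo derivative can be taken at every x. *)
Definition semidiscrete_solution (alpha T : R) Omega Th (f : R -> point -> R)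
    (vh : point -> R) (u : R -> point -> R) :=
  [/\ forall t, 0 <= t <= T -> fe_space Omega Th (u t),
      forall x, absolutely_continuous T (u^~ x),
      forall x t, 0 < t <= T -> (@lebesgue_measure R).-integrable `]0, t[
        (EFin \o caputo_integrand alpha (u^~ x) t),
      u 0 = vh &
      forall t, 0 < t <= T -> forall chi, fe_space Omega Th chi ->
        L2_inner Omega (fun x => caputo alpha (u^~ x) t) chi +
        dirichlet_form Omega Th (u t) chi = L2_inner Omega (f t) chi].

Inductive generating_formula := BDF2 | NewtonGregory2.

Definition generating_function (alpha : R) (c : generating_formula) (z : R)
    : R :=
  match c with
  | BDF2 => (3 / 2 - 2 * z + z ^+ 2 / 2) `^ alpha
  | NewtonGregory2 => (1 - z) `^ alpha * (1 + alpha / 2 * (1 - z))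
  end.

(* The bases of the powers are positive for |z| < 1, and the coefficients of a
   power series are determined by its sum on this real interval. *)
Definition has_power_series (F : R -> R) (w : nat -> R) :=
  forall z, `|z| < 1 -> pseries w z @ \oo --> F z.

Definition averaged_weights (wt : nat -> R) (k : nat) : R :=
  2^-1 * wt k + 2^-1 * (if k is j.+1 then wt j else 0).

(* D_tau^alpha phi^(n - 1/2) *)
Definition discrete_derivative (alpha tau : R) (wt : nat -> R)
    (phi : nat -> R) (n : nat) : R :=
  tau `^ (- alpha) *
  \sum_(k < n.+1) averaged_weights wt (n - k) * phi k.

Definition acn_solution (alpha tau : R) (N : nat) (wt : nat -> R) Omega Th
    (Dh : (point -> R) -> point -> R) (fh : R -> point -> R)
    (vh : point -> R) (W : nat -> point -> R) :=
  W 0%N = (fun=> 0) /\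
  forall n, (1 <= n <= N)%N ->
    fe_space Omega Th (W n) /\
    forall x,
      discrete_derivative alpha tau wt (fun k => W k x) n
      - 2^-1 * (Dh (W n) x + Dh (W n.-1) x) =
      2^-1 * (fh (n%:R * tau) x + fh (n.-1%:R * tau) x) + Dh vh x.

End schemes.

(* Main.v *)
Require Import Defs.
From mathcomp Require Import all_boot all_order all_algebra.
From mathcomp Require Import all_classical all_reals all_analysis.
From HB Require Import structures.
From mathcomp Require spectral complex.
From mathcomp Require Import ring lra zify measurable_realfun.
Set Implicit Arguments.
Unset Strict Implicit.
Unset Printing Implicit Defensive.
Import Order.TTheory GRing.Theory Num.Theory numFieldNormedType.Exports.
Local Open Scope classical_set_scope.
Local Open Scope ring_scope.
(** The error is bounded eigenvalue by eigenvalue, with constants uniform in the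
    eigenvalue.

    The finite element space V_h is spanned by finitely many functions, and the
    Dirichlet form has a frame of eigenvectors on it that satisfies Parseval's
    identity on V_h and Bessel's inequality on L^2 (eigenframe). Tested with an
    eigenvector, the semidiscrete problem and the scheme become a scalar
    fractional equation with parameter lam >= 0 and datum a + b t, and its
    discretization. It remains to bound the error of the latter by
    K (|a| tau^al + |b| tau^2 t^(al - 1)) with K independent of lam
    (scalar_error), and to sum the squares.

    In terms of generating functions, and after division by the averaging factor
    (1 + z) / 2, the scheme has the resolvent A = (w + lam tau^al)^(-1), where
    w = (1 - z)^al p(z), applied to the series of the datum and to an
    oscillating term a / (1 + z), which is the price of the first step.
    The numerical solution is not compared with the exact one, but with the
    numerical solution of half the step, written in the same variable through
    z -> z^2 (half_step_bound). By the resolvent identity their difference is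
    a coefficient of a product of two resolvents and a series q, where q is
    absolutely summable because the scheme is of second order (wl1_q). Such
    coefficients are bounded uniformly in lam as follows. The Toeplitz form of w
    is nonnegative, so multiplication by w A is a contraction for truncated
    square-summable sequences (accretive_contraction). The derivative of the
    product is theta^2 times a bounded multiplier, with
    theta = (1 - z)^(-(1 + al) / 2) up to a dilation, and by the Cauchy-Schwarz
    inequality n times the n-th coefficient is at most a constant times the sum
    of the squares of the first n coefficients of theta, which grows like n^al
    (resolvent_bound, difference_bound). The half-step errors decrease
    geometrically under refinement, so the numerical solution is within a
    constant times the first of them from the limit of its refinements
    (refinement_bound).

    That this limit is the exact solution is only needed for each fixed lam
    (numerical_converges). The equation, integrated in time, is a Volterra
    equation with a continuous kernel (volterra_identity), and the weights of
    the integrated scheme approximate this kernel by Gautschi's inequality for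
    quotients of Gamma values (coef_sg_Gamma). The partial sums of the error
    therefore tend to zero, and averaging over short blocks of time steps gives
    pointwise convergence.

    Both generating functions satisfy the requirements on p: nonnegativity of
    the Toeplitz form follows from the signs of the weights
    (toeplitz_accretive). *)

(** * Formal power series *)

(** Sequences, wrapped so that they carry the Cauchy product instead of the
    pointwise one: discrete convolutions then become products in a commutative
    ring, open to the ring tactic. *)
Record powerseries (R : realType) := Series { coef : nat -> R }.

Section series_ring.
Variable R : realType.
Local Notation fps := (powerseries R).
Implicit Types a b : fps.

Lemma seriesP a b : (forall n, coef a n = coef b n) -> a = b.
Proof. by case: a b => a [b] /= h; congr Series; apply/funext. Qed.

HB.instance Definition _ := gen_eqMixin fps.
HB.instance Definition _ := gen_choiceMixin fps.

Definition series_zero : fps := Series (fun=> 0).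
Definition series_opp a : fps := Series (fun n => - coef a n).
Definition series_add a b : fps := Series (fun n => coef a n + coef b n).
Definition series_one : fps := Series (fun n => (n == 0)%:R).
Definition series_mul a b : fps :=
  Series (fun n => \sum_(i < n.+1) coef a i * coef b (n - i)%N).

Let addA : associative series_add.
Proof. by move=> a b c; apply/seriesP => n /=; rewrite addrA. Qed.
Let addC : commutative series_add.
Proof. by move=> a b; apply/seriesP => n /=; rewrite addrC. Qed.
Let add0 : left_id series_zero series_add.
Proof. by move=> a; apply/seriesP => n /=; rewrite add0r. Qed.
Let addN : left_inverse series_zero series_opp series_add.
Proof. by move=> a; apply/seriesP => n /=; rewrite addNr. Qed.

HB.instance Definition _ := GRing.isZmodule.Build fps addA addC add0 addN.

Let mulC : commutative series_mul.
Proof.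
move=> a b; apply/seriesP => n /=; rewrite (reindex_inj rev_ord_inj) /=.
by apply: eq_bigr => i _; rewrite subSS subKn 1?mulrC// -ltnS.
Qed.

Let mul1 : left_id series_one series_mul.
Proof.
move=> a; apply/seriesP => n /=; rewrite big_ord_recl /= subn0 mul1r.
by rewrite big1 ?addr0// => i _; rewrite mul0r.
Qed.

Let mulDl : left_distributive series_mul series_add.
Proof.
move=> a b c; apply/seriesP => n /=; rewrite -big_split /=.
by apply: eq_bigr => i _; rewrite mulrDl.
Qed.

(* Both products only involve the coefficients up to n, so associativity is
   inherited from polynomials by truncation. *)
Let mulA : associative series_mul.
Proof.
have mulE a b n : coef (series_mul a b) n =
  \sum_(i < n.+1) coef a i * coef b (n - i)%N by [].
move=> a b c; apply/seriesP => n.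
pose tr x : {poly R} := \poly_(i < n.+1) coef x i.
have trE x i : (i <= n)%N -> coef x i = (tr x)`_i by move=> h; rewrite coef_poly ltnS h.
have trM x y i : (i <= n)%N -> coef (series_mul x y) i = (tr x * tr y)`_i.
  move=> ilen; rewrite mulE coefM; apply: eq_bigr => j _.
  by have := ltn_ord j; rewrite ltnS => ji; rewrite !trE//; lia.
transitivity (tr a * (tr b * tr c))`_n; last rewrite mulrA.
  rewrite mulE coefM; apply: eq_bigr => i _.
  by have := ltn_ord i; rewrite ltnS => ni; rewrite trE// trM// leq_subr.
rewrite mulE coefM; apply: eq_bigr => i _.
by have := ltn_ord i; rewrite ltnS => ni; rewrite (trE c)// ?trM// leq_subr.
Qed.

Let one_neq0 : series_one != 0.
Proof.
apply/eqP => /(congr1 (fun a => coef a 0)) /= /eqP.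
by rewrite oner_eq0.
Qed.

HB.instance Definition _ :=
  GRing.Zmodule_isComNzRing.Build fps mulA mulC mul1 mulDl one_neq0.

Arguments coef : simpl never.

Lemma coef0 n : coef (0 : fps) n = 0. Proof. by []. Qed.
Lemma coef1 n : coef (1 : fps) n = (n == 0)%:R. Proof. by []. Qed.
Lemma coefD a b n : coef (a + b) n = coef a n + coef b n. Proof. by []. Qed.
Lemma coefN a n : coef (- a) n = - coef a n. Proof. by []. Qed.
Lemma coefB a b n : coef (a - b) n = coef a n - coef b n. Proof. by []. Qed.
Lemma coefM a b n :
  coef (a * b) n = \sum_(i < n.+1) coef a i * coef b (n - i)%N.
Proof. by []. Qed.
Lemma coefMr a b n :
  coef (a * b) n = \sum_(i < n.+1) coef a (n - i)%N * coef b i.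
Proof. by rewrite mulrC coefM; apply: eq_bigr => i _; rewrite mulrC. Qed.

Lemma coef_sum (I : Type) (r : seq I) (F : I -> fps) n :
  coef (\sum_(i <- r) F i) n = \sum_(i <- r) coef (F i) n.
Proof. by elim/big_rec2: _ => // i x y _ <-. Qed.

Lemma coefM_eq n a b (c : fps) : (forall k, (k <= n)%N -> coef a k = coef b k) ->
  coef (a * c) n = coef (b * c) n.
Proof.
move=> ab; rewrite !coefM; apply: eq_bigr => i _; congr (_ * _).
by apply: ab; rewrite -ltnS.
Qed.

Lemma coefM_low n a b : (forall k, (k <= n)%N -> coef a k = 0) ->
  coef (a * b) n = 0.
Proof. by move=> a0; rewrite (@coefM_eq n a 0)// mul0r. Qed.

(** Identities between coefficients of order at most n can be borrowed from
    polynomials. *)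
Definition truncation n a : {poly R} := \poly_(i < n.+1) coef a i.

Lemma coef_truncation n a i : (i <= n)%N -> (truncation n a)`_i = coef a i.
Proof. by move=> h; rewrite coef_poly ltnS h. Qed.

Lemma coefM_truncation n a b i : (i <= n)%N ->
  coef (a * b) i = (truncation n a * truncation n b)`_i.
Proof.
move=> ilen; rewrite coefM poly.coefM; apply: eq_bigr => j _.
by have := ltn_ord j; rewrite ltnS => ji; rewrite !coef_truncation//; lia.
Qed.

Definition series_cst (c : R) : fps := Series (fun n => if n == 0 then c else 0).

Lemma coef_cst c n : coef (series_cst c) n = if n == 0 then c else 0.
Proof. by []. Qed.

Lemma coef_cstM c a n : coef (series_cst c * a) n = c * coef a n.
Proof.
rewrite coefM big_ord_recl /= subn0 big1 ?addr0// => i _.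
by rewrite coef_cst mul0r.
Qed.

Let cst_zmod : zmod_morphism series_cst.
Proof. by move=> c d; apply/seriesP => -[|n]; rewrite coefB !coef_cst//= subr0. Qed.
HB.instance Definition _ := GRing.isZmodMorphism.Build R fps series_cst cst_zmod.

Let cst_monoid : monoid_morphism series_cst.
Proof.
split; first by apply/seriesP => -[|n].
by move=> c d; apply/seriesP => n; rewrite coef_cstM !coef_cst; case: n => [|n]//=; rewrite mulr0.
Qed.
HB.instance Definition _ := GRing.isMonoidMorphism.Build R fps series_cst cst_monoid.

Definition series_X : fps := Series (fun n => (n == 1)%:R).

Lemma coef_X n : coef series_X n = (n == 1)%:R. Proof. by []. Qed.

Lemma coef_XM a n : coef (series_X * a) n = if n is m.+1 then coef a m else 0.
Proof.
rewrite coefM; case: n => [|n]; first by rewrite big_ord_recl big_ord0 coef_X mul0r addr0.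
rewrite 2!big_ord_recl !coef_X /= mul0r add0r subSS subn0 mul1r big1 ?addr0// => i _.
by rewrite coef_X mul0r.
Qed.

Definition series_deriv a : fps := Series (fun n => n.+1%:R * coef a n.+1).

Lemma coef_sderiv a n : coef (series_deriv a) n = n.+1%:R * coef a n.+1.
Proof. by []. Qed.

Lemma series_derivD a b : series_deriv (a + b) = series_deriv a + series_deriv b.
Proof. by apply/seriesP => n; rewrite coefD !coef_sderiv coefD mulrDr. Qed.

Lemma series_derivN a : series_deriv (- a) = - series_deriv a.
Proof. by apply/seriesP => n; rewrite coefN !coef_sderiv coefN mulrN. Qed.

Lemma series_derivB a b : series_deriv (a - b) = series_deriv a - series_deriv b.
Proof. by rewrite series_derivD series_derivN. Qed.

Lemma series_derivM a b :
  series_deriv (a * b) = series_deriv a * b + a * series_deriv b.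
Proof.
apply/seriesP => n; rewrite coefD coef_sderiv.
have E x : truncation n (series_deriv x) = poly.deriv (truncation n.+1 x).
  apply/polyP => i; rewrite poly.coef_deriv !coef_poly !ltnS coef_sderiv.
  by case: ifP => // _; rewrite ?mul0rn ?mulr_natl.
have E' x i : (i <= n)%N -> (truncation n x)`_i = (truncation n.+1 x)`_i.
  by move=> h; rewrite !coef_truncation//; lia.
rewrite (@coefM_truncation n.+1 a b)// mulr_natl -poly.coef_deriv derivM poly.coefD.
rewrite !(@coefM_truncation n _ _ n)// !E !poly.coefM; congr (_ + _);
  by apply: eq_bigr => i _; rewrite E'//; have := ltn_ord i; lia.
Qed.

Lemma series_deriv_cst c : series_deriv (series_cst c) = 0.
Proof. by apply/seriesP => n; rewrite coef_sderiv coef_cst mulr0. Qed.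

Lemma series_deriv1 : series_deriv 1 = 0.
Proof. by rewrite -(rmorph1 series_cst) series_deriv_cst. Qed.

Lemma series_derivX : series_deriv series_X = 1.
Proof. by apply/seriesP => -[|n]; rewrite coef_sderiv coef_X coef1 ?mulr1// mulr0. Qed.

(** The equation gives (n + 1) a_(n+1) in terms of the coefficients of a up to
    order n. *)
Lemma series_ode_unique h a b : series_deriv a = h * a -> series_deriv b = h * b ->
  coef a 0 = coef b 0 -> a = b.
Proof.
move=> Da Db ab0; apply/seriesP => n; elim/ltn_ind: n => -[|n] // IH.
have : coef (series_deriv a) n = coef (series_deriv b) n.
  by rewrite Da Db ![h * _]mulrC; apply: coefM_eq => k kn; apply: IH.
by rewrite !coef_sderiv; apply: mulfI; rewrite pnatr_eq0.
Qed.

Definition series_scale (c : R) a : fps := Series (fun n => c ^+ n * coef a n).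

Lemma coef_scale c a n : coef (series_scale c a) n = c ^+ n * coef a n.
Proof. by []. Qed.

Lemma series_scaleD c : {morph series_scale c : a b / a + b}.
Proof. by move=> a b; apply/seriesP => n; rewrite coefD !coef_scale coefD mulrDr. Qed.
Lemma series_scaleM c : {morph series_scale c : a b / a * b}.
Proof.
move=> a b; apply/seriesP => n; rewrite coefM coef_scale coefM mulr_sumr.
apply: eq_bigr => i _; rewrite !coef_scale [RHS]mulrACA -exprD subnKC//.
by rewrite -ltnS ltn_ord.
Qed.
Lemma series_scale1 c : series_scale c 1 = 1.
Proof. by apply/seriesP => -[|n]; rewrite coef_scale coef1 ?expr0 ?mulr1// mulr0. Qed.
Lemma series_deriv_scale c a :
  series_deriv (series_scale c a) = series_cst c * series_scale c (series_deriv a).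
Proof.
by apply/seriesP => n; rewrite coef_cstM coef_scale !coef_sderiv coef_scale exprS; ring.
Qed.

(** Substitution of X^d for X: a sequence on a coarse grid, seen on the grid
    refined d times. *)
Definition series_dilate (d : nat) a : fps :=
  Series (fun n => if (d %| n)%N then coef a (n %/ d) else 0).

Lemma coef_dilate d a n :
  coef (series_dilate d a) n = if (d %| n)%N then coef a (n %/ d) else 0.
Proof. by []. Qed.

Lemma series_dilateD d : {morph series_dilate d : a b / a + b}.
Proof. by move=> a b; apply/seriesP => n; rewrite coefD !coef_dilate; case: ifP; rewrite ?addr0. Qed.

Lemma series_dilateM d : (0 < d)%N -> {morph series_dilate d : a b / a * b}.
Proof.
move=> d0 a b; apply/seriesP => n.
pose P x := truncation n x \Po 'X^d.
have PE x i : (i <= n)%N -> (P x)`_i = coef (series_dilate d x) i.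
  move=> ilen; rewrite /P coef_comp_poly_Xn// coef_dilate; case: ifP => // _.
  by rewrite coef_truncation// (leq_trans (leq_div _ _)).
transitivity ((P a * P b)`_n); last first.
  rewrite coefM poly.coefM; apply: eq_bigr => i _.
  by have := ltn_ord i; rewrite ltnS => ni; rewrite !PE ?leq_subr.
rewrite /P -comp_polyM coef_comp_poly_Xn// coef_dilate; case: ifP => // _.
by rewrite (@coefM_truncation n)// leq_div.
Qed.

Lemma series_dilate1 d : (0 < d)%N -> series_dilate d 1 = 1.
Proof.
move=> d0; apply/seriesP => n; rewrite coef_dilate; case: n => [|n]; first by rewrite dvdn0 div0n.
case: ifP => // dn; case E : (n.+1 %/ d)%N => [|k]//.
by have := divnK dn; rewrite E.
Qed.

Lemma series_deriv_dilate2 a :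
  series_deriv (series_dilate 2 a) =
  series_cst 2 * series_X * series_dilate 2 (series_deriv a).
Proof.
apply/seriesP => n; rewrite -mulrA coef_cstM coef_XM coef_sderiv coef_dilate.
case: n => [|n]; first by rewrite dvdn2 !mulr0.
rewrite coef_dilate.
rewrite -[n.+2]addn2 dvdn_addl ?dvdnn//; case: ifP => d2n; last by rewrite !mulr0.
rewrite divnDr// divnn/= addn1 coef_sderiv mulrA; congr (_ * _).
by rewrite -natrM; congr (_%:R); have := divnK d2n; lia.
Qed.

Lemma series_dilate_cst d c : (0 < d)%N -> series_dilate d (series_cst c) = series_cst c.
Proof.
move=> d0; apply/seriesP => n; rewrite coef_dilate; case: n => [|n]; first by rewrite dvdn0 div0n.
case: ifP => // dn; case E : (n.+1 %/ d)%N => [|k]//.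
by have := divnK dn; rewrite E.
Qed.

(** With u = 1 - a / a(0), which has no constant coefficient, the inverse is
    the geometric series in u, of which only finitely many terms contribute to
    each coefficient. *)
Lemma series_inverse a : coef a 0 != 0 -> {b | a * b = 1}.
Proof.
move=> a0; pose u := 1 - series_cst (coef a 0)^-1 * a.
have u0 : coef u 0 = 0 by rewrite coefB coef_cstM coef1 eqxx mulVf ?subrr.
have uX k n : (n < k)%N -> coef (u ^+ k) n = 0.
  elim: k n => // k IH n nk; rewrite exprS coefM big1// => -[[|i] /= ilt] _.
    by rewrite u0 mul0r.
  by rewrite IH ?mulr0//; lia.
pose g := Series (fun n => coef (\sum_(k < n.+1) u ^+ k) n).
have gE n k : (k <= n)%N -> coef g k = coef (\sum_(k < n.+1) u ^+ k) k.
  move=> kn; transitivity (\sum_(0 <= i < k.+1) coef (u ^+ i) k).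
    by rewrite big_mkord -coef_sum.
  rewrite coef_sum -(big_mkord xpredT (fun i => coef (u ^+ i) k)).
  rewrite [RHS](big_cat_nat (n := k.+1))//= [X in _ = _ + X]big_nat_cond.
  by rewrite [X in _ = _ + X]big1 ?addr0// => j; rewrite andbT => /andP[? _]; apply: uX.
have ug : (1 - u) * g = 1.
  apply/seriesP => n; rewrite mulrC (coefM_eq _ (gE n)) mulrC.
  by rewrite -[1 - u]opprB mulNr -subrX1 opprB coefB uX// subr0.
exists (series_cst (coef a 0)^-1 * g); rewrite mulrCA mulrA -[RHS]ug.
by congr (_ * _); rewrite /u opprB addrCA subrr addr0.
Qed.

End series_ring.

Arguments coef : simpl never.

(** * Binomial series *)

Section binomial_series.
Variable R : realType.
Local Notation fps := (powerseries R).
Local Notation X := (series_X R).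

Fixpoint binomial_coef (g : R) (n : nat) : R :=
  if n is m.+1 then binomial_coef g m * ((m%:R - g) / m.+1%:R) else 1.

(** The series of (1 - z)^g for a real exponent g. *)
Definition sg (g : R) : fps := Series (binomial_coef g).

(** The series of (1 + z)^g. *)
Definition rh (g : R) : fps := series_scale (-1) (sg g).

Lemma coef_sg0 g : coef (sg g) 0 = 1.
Proof. by []. Qed.

Lemma coef_sgS g n : coef (sg g) n.+1 = coef (sg g) n * ((n%:R - g) / n.+1%:R).
Proof. by []. Qed.

Lemma sg0 : sg 0 = 1.
Proof.
apply/seriesP; elim => // n IH; rewrite coef_sgS IH !coef1 subr0.
by case: n {IH} => [|n]; rewrite ?mul0r// mulr0.
Qed.

Lemma sg1 : sg 1 = 1 - X.
Proof.
apply/seriesP => n; rewrite coefB; elim: n => [|n IH]; first by rewrite coef_X subr0.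
rewrite coef_sgS IH !coef1 !coef_X; case: n {IH} => [|[|n]] /=.
- by rewrite !sub0r subr0 divr1 mul1r.
- by rewrite subrr mul0r mulr0 subrr.
- by rewrite subrr mul0r.
Qed.

Lemma coef_sgN1 n : coef (sg (-1)) n = 1.
Proof.
by elim: n => // n IH; rewrite coef_sgS IH mul1r opprK natr1 divff// pnatr_eq0.
Qed.

Lemma X1_deriv_sg g : (1 - X) * series_deriv (sg g) = - (series_cst g * sg g).
Proof.
apply/seriesP => n; rewrite mulrBl mul1r coefB coefN coef_cstM coef_XM.
have E m : coef (series_deriv (sg g)) m = (m%:R - g) * coef (sg g) m.
  by rewrite coef_sderiv coef_sgS mulrCA [_.+1%:R * _]mulrC divfK ?pnatr_eq0// mulrC.
rewrite E; case: n => [|n]; first by rewrite subr0 sub0r mulNr.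
by rewrite coef_sderiv mulrBl addrAC subrr add0r.
Qed.

Lemma sgN1K : (1 - X) * sg (-1) = 1.
Proof.
apply/seriesP => n; rewrite mulrBl mul1r coefB coef_XM coef_sgN1 coef1.
by case: n => [|n]; rewrite ?subr0// coef_sgN1 subrr.
Qed.

Lemma deriv_sg g : series_deriv (sg g) = - (series_cst g * sg (-1)) * sg g.
Proof.
rewrite -[LHS]mul1r -sgN1K mulrAC X1_deriv_sg; ring.
Qed.

(** Both sides satisfy the differential equation of (1 - z)^(g + h). *)
Lemma sgD g h : sg (g + h) = sg g * sg h.
Proof.
apply: (@series_ode_unique _ (- (series_cst (g + h) * sg (-1)))).
- exact: deriv_sg.
- by rewrite series_derivM !deriv_sg; ring.
- by rewrite coefM big_ord_recl big_ord0 !coef_sg0 mulr1 addr0.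
Qed.

Lemma sgNK g : sg g * sg (- g) = 1.
Proof. by rewrite -sgD subrr sg0. Qed.

Lemma rh0 : rh 0 = 1. Proof. by rewrite /rh sg0 series_scale1. Qed.
Lemma rhD g h : rh (g + h) = rh g * rh h.
Proof. by rewrite /rh sgD series_scaleM. Qed.
Lemma rhNK g : rh g * rh (- g) = 1.
Proof. by rewrite -rhD subrr rh0. Qed.
Lemma rh1 : rh 1 = 1 + X.
Proof.
apply/seriesP => n; rewrite coef_scale sg1 coefB coefD coef1 coef_X.
by case: n => [|[|n]] /=; ring.
Qed.

Lemma deriv_rh g : series_deriv (rh g) = series_cst g * rh (-1) * rh g.
Proof.
rewrite /rh series_deriv_scale deriv_sg !series_scaleM.
have -> : series_scale (-1) (- (series_cst g * sg (-1))) =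
   - (series_cst g * series_scale (-1) (sg (-1))).
  by apply/seriesP => n; rewrite coefN coef_scale coefN !coef_cstM coef_scale; ring.
rewrite rmorphN1; ring.
Qed.

(** (1 - z^2)^g = (1 - z)^g (1 + z)^g, again by comparing differential
    equations. This factorization is what lets a step be compared with its
    half. *)
Lemma dilate_sg g : series_dilate 2 (sg g) = sg g * rh g.
Proof.
apply: (@series_ode_unique _ (- series_cst 2 * series_cst g * X * series_dilate 2 (sg (-1)))).
- rewrite series_deriv_dilate2 deriv_sg series_dilateM//.
  have -> : series_dilate 2 (- (series_cst g * sg (-1))) =
     - (series_cst g * series_dilate 2 (sg (-1))).
    apply/seriesP => n; rewrite coefN coef_cstM !coef_dilate.
    by case: ifP => _; rewrite ?mulr0 ?oppr0// coefN coef_cstM.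
  ring.
- rewrite series_derivM deriv_sg deriv_rh.
  have -> : series_dilate 2 (sg (-1)) = sg (-1) * rh (-1).
    apply/seriesP => n; rewrite coefM coef_dilate coef_sgN1.
    under eq_bigr => i _ do rewrite coef_scale !coef_sgN1 mul1r mulr1.
    rewrite (reindex_inj rev_ord_inj)/=.
    under eq_bigr => i _ do rewrite subKn ?leq_ord//.
    elim: n => [|n IH]; first by rewrite big_ord_recl big_ord0 addr0.
    rewrite big_ord_recr /= -IH dvdn2 /= -signr_odd /=.
    by rewrite !dvdn2/=; case: (odd n) => /=; rewrite ?expr1 ?expr0 ?add0r// subrr.
  have E1 : sg (-1) * (1 - X) = 1 by rewrite mulrC sgN1K.
  have E2 : rh (-1) * (1 + X) = 1 by rewrite -rh1 mulrC rhNK.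
  have : sg (-1) - rh (-1) = series_cst 2 * X * (sg (-1) * rh (-1)).
    transitivity (sg (-1) * (rh (-1) * (1 + X)) - rh (-1) * (sg (-1) * (1 - X))).
      by rewrite E1 E2 !mulr1.
    rewrite rmorph_nat; ring.
  move=> E; transitivity (- series_cst g * (sg (-1) - rh (-1)) * (sg g * rh g)); first ring.
  rewrite E; ring.
- by rewrite coefM big_ord_recl big_ord0 coef_dilate coef_scale !coef_sg0 expr0 !mulr1 addr0.
Qed.

End binomial_series.

(** * Weighted absolute summability *)

Section finite_sums.
Variable R : realType.

Lemma cauchy_schwarz_sum n (x y : nat -> R) :
  (\sum_(i < n) x i * y i) ^+ 2 <=
  (\sum_(i < n) x i ^+ 2) * (\sum_(i < n) y i ^+ 2).
Proof.
set A := \sum_(i < n) x i ^+ 2; set B := \sum_(i < n) y i ^+ 2.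
set P := \sum_(i < n) x i * y i.
have A0 : 0 <= A by apply: sumr_ge0 => i _; apply: sqr_ge0.
have : 0 <= \sum_(i < n) (A * y i - P * x i) ^+ 2.
  by apply: sumr_ge0 => i _; apply: sqr_ge0.
have -> : \sum_(i < n) (A * y i - P * x i) ^+ 2 = A * (A * B - P ^+ 2).
  transitivity (A ^+ 2 * B - 2 * A * P * P + P ^+ 2 * A); last ring.
  have -> : A ^+ 2 * B = \sum_(i < n) A ^+ 2 * y i ^+ 2 by rewrite mulr_sumr.
  have -> : 2 * A * P * P = \sum_(i < n) 2 * A * P * (x i * y i) by rewrite -mulr_sumr.
  have -> : P ^+ 2 * A = \sum_(i < n) P ^+ 2 * x i ^+ 2 by rewrite mulr_sumr.
  by rewrite -sumrB -big_split /=; apply: eq_bigr => i _; ring.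
move: A0; rewrite le_eqVlt => /orP[/eqP A0 _|A0]; last by rewrite pmulr_rge0// subr_ge0.
have x0 i : (i < n)%N -> x i = 0.
  move=> ilt; apply/eqP; rewrite -sqrf_eq0; apply/eqP.
  have /eqP := esym A0; rewrite psumr_eq0 => [/allP/(_ (Ordinal ilt))|j _]; last exact: sqr_ge0.
  by rewrite mem_index_enum => /(_ isT)/eqP.
have -> : P = 0 by rewrite /P big1// => i _; rewrite x0 ?mul0r.
by rewrite expr0n /= -A0 mul0r.
Qed.

Lemma sum_lt_const (c : R) m k : 0 <= c -> \sum_(i < m | (i < k)%N) c <= k%:R * c.
Proof.
move=> c0; rewrite -(big_mkord (fun i => i < k)%N (fun=> c)) mulr_natl.
case: (leqP k m) => h.
  by rewrite -(big_nat_widen _ _ _ xpredT (fun=> c))// sumr_const_nat subn0.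
apply: (@le_trans _ _ (\sum_(0 <= i < m) c)).
  by rewrite [leLHS]big_mkcond; apply: ler_sum => i _; case: ifP.
by rewrite sumr_const_nat subn0 -[leLHS]mulr_natl -[leRHS]mulr_natl ler_wpM2r// ler_nat ltnW.
Qed.

Definition null (u : nat -> R) :=
  forall e : R, 0 < e -> exists N, forall n, (N <= n)%N -> `|u n| <= e.

Lemma nullD u v : null u -> null v -> null (fun n => u n + v n).
Proof.
move=> hu hv e e0; have e20 : 0 < e / 2 by lra.
have [N hN] := hu _ e20; have [M hM] := hv _ e20.
exists (maxn N M) => n; rewrite geq_max => /andP[/hN h1 /hM h2].
by rewrite (le_trans (ler_normD _ _))// [leRHS](splitr e) lerD.
Qed.

Lemma nullM u (k : R) : null u -> null (fun n => k * u n).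
Proof.
move=> hu e e0; have k1 : 0 < `|k| + 1 by rewrite ltr_wpDl.
have [N hN] := hu _ (divr_gt0 e0 k1); exists N => n /hN.
rewrite ler_pdivlMr// normrM; apply: le_trans.
by rewrite mulrC ler_wpM2l// lerDl.
Qed.

Lemma null_bounded u : null u -> exists2 M : R, 0 <= M & forall n, `|u n| <= M.
Proof.
move=> /(_ 1 ltr01)[N hN]; exists (1 + \sum_(i < N) `|u i|).
  by rewrite addr_ge0// sumr_ge0.
move=> n; case: (leqP N n) => [/hN/le_trans->//|nN].
  by rewrite lerDl sumr_ge0.
rewrite (bigD1 (Ordinal nN))//= addrCA lerDl addr_ge0// sumr_ge0//.
Qed.

End finite_sums.

Section weighted_l1.
Variable R : realType.
Local Notation fps := (powerseries R).
Local Notation X := (series_X R).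
Implicit Types a b : fps.

(** Multiplication by (1 - z)^(-1) forms partial sums; they are written as
    coefficients of sg (-1) * a below, so that they obey the ring laws. *)
Lemma coef_psum a n : coef (sg (-1) * a) n = \sum_(k < n.+1) coef a k.
Proof. by rewrite coefMr; apply: eq_bigr => i _; rewrite coef_sgN1 mul1r. Qed.

Definition wabs j a : fps := Series (fun k => k.+1%:R ^+ j * `|coef a k|).

Lemma coef_wabs j a k : coef (wabs j a) k = k.+1%:R ^+ j * `|coef a k|.
Proof. by []. Qed.

Lemma coef_wabs_ge0 j a k : 0 <= coef (wabs j a) k.
Proof. by rewrite coef_wabs mulr_ge0// exprn_ge0. Qed.

(** Weighted Wiener algebras: weight j absorbs j formal derivatives
    (wl1_deriv) or j divisions by 1 - z (wl1_div1X). *)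
Definition wl1 j a := exists M : R, forall n, \sum_(k < n.+1) coef (wabs j a) k <= M.

Lemma wl1_bound j a : wl1 j a ->
  exists2 M : R, 0 <= M & forall n, \sum_(k < n.+1) coef (wabs j a) k <= M.
Proof.
case=> M h; exists M => //; apply: le_trans (h 0); apply: sumr_ge0 => i _; exact: coef_wabs_ge0.
Qed.

Lemma wl1_le j a b (c : R) : 0 <= c -> (forall k, `|coef a k| <= c * `|coef b k|) -> wl1 j b -> wl1 j a.
Proof.
move=> c0 ab [M h]; exists (c * M) => n; apply: le_trans (ler_wpM2l c0 (h n)).
rewrite mulr_sumr; apply: ler_sum => i _; rewrite !coef_wabs mulrCA.
by rewrite ler_wpM2l// exprn_ge0.
Qed.

Lemma wl1D j a b : wl1 j a -> wl1 j b -> wl1 j (a + b).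
Proof.
move=> [M hM] [N hN]; exists (M + N) => n; apply: le_trans (lerD (hM n) (hN n)).
rewrite -big_split; apply: ler_sum => i _ /=; rewrite !coef_wabs -mulrDr coefD.
by rewrite ler_wpM2l ?ler_normD// exprn_ge0.
Qed.

Lemma wl1N j a : wl1 j a -> wl1 j (- a).
Proof. by apply: (@wl1_le _ _ _ 1) => // k; rewrite coefN normrN mul1r. Qed.

Lemma wl1B j a b : wl1 j a -> wl1 j b -> wl1 j (a - b).
Proof. by move=> ha hb; apply/wl1D/wl1N. Qed.

Lemma wl1M j a b : wl1 j a -> wl1 j b -> wl1 j (a * b).
Proof.
move=> [M hM] [N hN]; exists (M * N) => n.
apply: (@le_trans _ _ (\sum_(k < n.+1) coef (wabs j a * wabs j b) k)).
  apply: ler_sum => k _; rewrite coef_wabs !coefM.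
  apply: (@le_trans _ _ (k.+1%:R ^+ j * \sum_(i < k.+1) `|coef a i * coef b (k - i)%N|)).
    by rewrite ler_wpM2l ?exprn_ge0// ler_norm_sum.
  rewrite mulr_sumr; apply: ler_sum => i _; rewrite !coef_wabs mulrACA normrM.
  rewrite ler_wpM2r ?mulr_ge0// -exprMn lerXn2r ?nnegrE// -natrM ler_nat.
  by have := ltn_ord i; nia.
rewrite -coef_psum mulrCA coefM.
have N0 : 0 <= N by apply: le_trans (hN 0); apply: sumr_ge0 => i _; apply: coef_wabs_ge0.
apply: (@le_trans _ _ ((\sum_(k < n.+1) coef (wabs j a) k) * N)); last by rewrite ler_wpM2r.
rewrite mulr_suml; apply: ler_sum => i _; rewrite ler_wpM2l ?coef_wabs_ge0//.
by rewrite coef_psum.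
Qed.

Lemma wl1_mono i j a : (i <= j)%N -> wl1 j a -> wl1 i a.
Proof.
move=> ij [M h]; exists M => n; apply: le_trans (h n); apply: ler_sum => k _.
by rewrite !coef_wabs ler_wpM2r// ler_weXn2l// ler1n.
Qed.

Lemma wl1_fin j a N : (forall k, (N <= k)%N -> coef a k = 0) -> wl1 j a.
Proof.
move=> a0; exists (\sum_(k < N) coef (wabs j a) k) => n.
rewrite -!(big_mkord xpredT (fun k => coef (wabs j a) k)).
case: (leqP N n.+1) => h.
  rewrite (big_cat_nat (n := N))//= [X in _ + X]big_nat_cond [X in _ + X]big1 ?addr0// => i.
  by rewrite andbT => /andP[/a0 + _]; rewrite coef_wabs => ->; rewrite normr0 mulr0.
rewrite [leRHS](big_cat_nat (n := n.+1))//=; last exact: ltnW.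
by rewrite lerDl; apply: sumr_ge0 => k _; exact: coef_wabs_ge0.
Qed.

Lemma wl1_cst j (c : R) : wl1 j (series_cst c).
Proof. by apply: (@wl1_fin _ _ 1) => -[|k]. Qed.

Lemma wl1_1 j : wl1 j 1.
Proof. by apply: (@wl1_fin _ _ 1) => -[|k]. Qed.

Lemma wl1_X j : wl1 j X.
Proof. by apply: (@wl1_fin _ _ 2) => -[|[|k]]. Qed.

Lemma wl1_deriv j a : wl1 j.+1 a -> wl1 j (series_deriv a).
Proof.
move=> [M h]; exists M => n; apply: le_trans (h n.+1).
rewrite [leRHS]big_ord_recl ler_wpDl ?coef_wabs_ge0//; apply: ler_sum => k _.
rewrite !coef_wabs coef_sderiv lift0 normrM normr_nat mulrA ler_wpM2r// exprSr.
by rewrite ler_pM ?exprn_ge0// ?lerXn2r ?nnegrE// ler_nat.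
Qed.

Lemma wl1_of_deriv j a : wl1 j (series_deriv a) -> wl1 j.+1 a.
Proof.
move=> /wl1_bound[M M0 h]; exists (`|coef a 0| + 2 ^+ j.+1 * M) => n.
rewrite big_ord_recl; apply: lerD; first by rewrite coef_wabs expr1n mul1r.
case: n => [|n]; first by rewrite big_ord0 mulr_ge0// exprn_ge0.
have e0 : (0 : R) <= 2 ^+ j.+1 by apply: exprn_ge0.
apply: le_trans (ler_wpM2l e0 (h n)); rewrite mulr_sumr; apply: ler_sum => k _.
rewrite !coef_wabs coef_sderiv lift0 normrM normr_nat !mulrA ler_wpM2r// -mulrA -exprSr -exprMn.
by rewrite lerXn2r ?nnegrE ?mulr_ge0// -natrM ler_nat; lia.
Qed.

Lemma wl1_scale j (c : R) a : `|c| <= 1 -> wl1 j a -> wl1 j (series_scale c a).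
Proof.
move=> c1; apply: (@wl1_le _ _ _ 1) => // k.
by rewrite coef_scale normrM ler_wpM2r// normrX exprn_ile1.
Qed.

Lemma wl1_dilate2 j a : wl1 j a -> wl1 j (series_dilate 2 a).
Proof.
move=> /wl1_bound[M M0 h]; exists (2 ^+ j * M) => n.
have e0 : (0 : R) <= 2 ^+ j by apply: exprn_ge0.
apply: le_trans (ler_wpM2l e0 (h n)).
suff: forall m, \sum_(k < m.*2.+1) coef (wabs j (series_dilate 2 a)) k <=
      2 ^+ j * \sum_(k < m.+1) coef (wabs j a) k.
  move/(_ n); apply: le_trans.
  rewrite -!(big_mkord xpredT (fun k => coef (wabs j (series_dilate 2 a)) k)).
  rewrite [leRHS](big_cat_nat (n := n.+1))//=; last by rewrite -addnn; lia.
  by rewrite lerDl; apply: sumr_ge0 => k _; exact: coef_wabs_ge0.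
have E m : coef (wabs j (series_dilate 2 a)) m.*2 <= 2 ^+ j * coef (wabs j a) m.
  rewrite !coef_wabs coef_dilate dvdn2 odd_double /= -muln2 mulnK// mulrA ler_wpM2r//.
  by rewrite -exprMn lerXn2r ?nnegrE ?mulr_ge0// -natrM ler_nat; lia.
elim=> [|m IH]; first by rewrite !big_ord_recl !big_ord0 !addr0; exact: (E 0).
rewrite doubleS 2!big_ord_recr /= [in leRHS]big_ord_recr /= mulrDr.
rewrite [coef _ m.*2.+1]coef_wabs coef_dilate dvdn2 /= odd_double normr0 mulr0 addr0.
by rewrite lerD// -doubleS E.
Qed.

Lemma wl1_null a : wl1 0 a -> null (coef a).
Proof.
move=> [M h]; pose s n := \sum_(k < n) coef (wabs 0 a) k.
have s_nd : nondecreasing_seq s.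
  by apply/nondecreasing_seqP => n; rewrite /s big_ord_recr lerDl /= coef_wabs_ge0.
have cs : cvgn s.
  apply: nondecreasing_is_cvgn => //; exists M => _ [n _ <-].
  exact: le_trans (s_nd _ _ (leqnSn n)) (h n).
move=> e e0; have /cvgrPdist_lt/(_ _ (divr_gt0 e0 (ltr0n R 2)))[N _ hN] := cs.
exists N => n nN; have h1 := hN n nN; have h2 := hN n.+1 (leqW nN).
have : `|coef a n| = s n.+1 - s n.
  by rewrite /s big_ord_recr /= addrAC subrr add0r coef_wabs expr0 mul1r.
move: h1 h2; rewrite /= ltr_norml ltr_norml => /andP[? ?] /andP[? ?] ->.
lra.
Qed.

Lemma wl1_tail a : wl1 0 a -> forall e : R, 0 < e -> exists N, forall m n, (N <= m)%N -> (m <= n)%N ->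
  \sum_(m <= k < n) `|coef a k| <= e.
Proof.
move=> [M h]; pose s n := \sum_(0 <= k < n) `|coef a k|.
have s_nd : nondecreasing_seq s.
  by apply/nondecreasing_seqP => n; rewrite /s big_nat_recr//= lerDl.
have cs : cvgn s.
  apply: nondecreasing_is_cvgn => //; exists M => _ [n _ <-].
  apply: le_trans (s_nd _ _ (leqnSn n)) _; apply: le_trans (h n).
  rewrite /s big_mkord; apply: ler_sum => i _.
  by rewrite coef_wabs expr0 mul1r.
move=> e e0; have /cvgrPdist_lt/(_ _ (divr_gt0 e0 (ltr0n R 2)))[N _ hN] := cs.
exists N => m n Nm mn; have h1 := hN m Nm; have h2 := hN n (leq_trans Nm mn).
have -> : \sum_(m <= k < n) `|coef a k| = s n - s m.
  by rewrite /s [X in _ = X - _](big_cat_nat (n := m))//= addrAC subrr add0r.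
move: h1 h2; rewrite /= ltr_norml ltr_norml => /andP[? ?] /andP[? ?].
lra.
Qed.

(** The convolution is split into the terms with a late index in a, which is
    small there, and the terms with a late index in b, which form a tail. *)
Lemma null_conv a b : null (coef a) -> wl1 0 b -> null (coef (a * b)).
Proof.
move=> na lb e e0; have [U U0 hU] := null_bounded na.
have [M M0 hM] := wl1_bound lb.
have M1 : 0 < M + 1 by rewrite ltr_wpDl.
have U1 : 0 < U + 1 by rewrite ltr_wpDl.
have e2 : 0 < e / 2 by rewrite divr_gt0.
have [N hN] := na _ (divr_gt0 e2 M1).
have [N' hN'] := wl1_tail lb (divr_gt0 e2 U1).
exists (N + N').+1 => n nN; rewrite coefMr.
rewrite -(big_mkord xpredT (fun i => coef a (n - i)%N * coef b i)).
rewrite (big_cat_nat (n := n - N))//=; last by lia.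
rewrite (le_trans (ler_normD _ _))// [leRHS](splitr e) lerD//.
- rewrite (le_trans (ler_norm_sum _ _ _))//.
  apply: (@le_trans _ _ (e / 2 / (M + 1) * M)); last first.
    by rewrite -mulrA ger_pMr// mulrC ler_pdivrMr// mul1r lerDl.
  apply: (@le_trans _ _ (\sum_(0 <= i < n - N) e / 2 / (M + 1) * `|coef b i|)).
    rewrite big_nat_cond [leRHS]big_nat_cond; apply: ler_sum => i.
    by rewrite andbT => /andP[_ hi]; rewrite normrM ler_wpM2r// hN//; lia.
  rewrite -mulr_sumr ler_wpM2l//; first by rewrite ltW// divr_gt0.
  apply: le_trans (hM n).
  rewrite -(big_mkord xpredT (fun k => coef (wabs 0 b) k)).
  rewrite [leRHS](big_cat_nat (n := n - N))//=; last by lia.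
  rewrite ler_wpDr ?sumr_ge0//; first by move=> k _; exact: coef_wabs_ge0.
  by apply: ler_sum => k _; rewrite coef_wabs expr0 mul1r.
- rewrite (le_trans (ler_norm_sum _ _ _))//.
  apply: (@le_trans _ _ (U * (e / 2 / (U + 1)))); last first.
    by rewrite mulrCA ger_pMr// ler_pdivrMr// mul1r lerDl.
  apply: (@le_trans _ _ (U * \sum_(n - N <= i < n.+1) `|coef b i|)).
    by rewrite mulr_sumr; apply: ler_sum => i _; rewrite normrM ler_wpM2r.
  by rewrite ler_wpM2l// hN'//; lia.
Qed.

(** The value at z = 1 of an absolutely summable series. *)
Definition sums a (c : R) := wl1 0 a /\ null (fun n => coef (sg (-1) * a) n - c).

Lemma sumsE a c : sums a c <-> wl1 0 a /\ null (coef (sg (-1) * (a - series_cst c))).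
Proof.
have E : coef (sg (-1) * (a - series_cst c)) = (fun n => coef (sg (-1) * a) n - c).
  apply/funext => n; rewrite mulrBr coefB [sg _ * series_cst c]mulrC coef_cstM.
  by rewrite coef_sgN1 mulr1.
by rewrite /sums E.
Qed.

Lemma sumsD a b c d : sums a c -> sums b d -> sums (a + b) (c + d).
Proof.
move=> [la na] [lb nb]; split; first exact: wl1D.
move=> e e0; have [N hN] := nullD na nb e0; exists N => n /hN.
by rewrite mulrDr coefD; congr (`|_| <= _); ring.
Qed.

Lemma sumsM a b c d : sums a c -> sums b d -> sums (a * b) (c * d).
Proof.
move=> /sumsE[la na] /sumsE[lb nb]; apply/sumsE; split; first exact: wl1M.
have -> : sg (-1) * (a * b - series_cst (c * d)) =
   (sg (-1) * (a - series_cst c)) * b +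
   (sg (-1) * (b - series_cst d)) * series_cst c by rewrite rmorphM; ring.
by apply: nullD; apply: null_conv => //; exact: wl1_cst.
Qed.

Lemma sums_cst (c : R) : sums (series_cst c) c.
Proof.
apply/sumsE; split; first exact: wl1_cst.
by rewrite subrr mulr0 => e e0; exists 0%N => n _; rewrite coef0 normr0 ltW.
Qed.

Lemma sums1 : sums 1 1.
Proof. by have := sums_cst 1; rewrite rmorph1. Qed.

Lemma sumsN a c : sums a c -> sums (- a) (- c).
Proof.
move=> h; have := sumsM (sums_cst (-1)) h.
by rewrite rmorphN rmorph1 !mulN1r.
Qed.

Lemma sumsB a b c d : sums a c -> sums b d -> sums (a - b) (c - d).
Proof. by move=> h /sumsN; exact: sumsD. Qed.

Lemma sumsX : sums X 1.
Proof.
split; first exact: wl1_X.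
move=> e e0; exists 1%N => -[|n] // _; rewrite mulrC coef_XM coef_sgN1 subrr normr0.
exact: ltW.
Qed.

Lemma sums_unique a c d : sums a c -> sums a d -> c = d.
Proof.
move=> [_ h1] [_ h2]; apply/eqP; rewrite -subr_eq0; apply/eqP/normr0_eq0/eqP.
rewrite eq_le normr_ge0 andbT; apply/ler_addgt0Pr => e e0; rewrite add0r.
have [N hN] := nullD h2 (nullM (-1) h1) e0.
have := hN N (leqnn N); congr (`|_| <= _); ring.
Qed.

(** Division by 1 - z of a series vanishing at 1 costs one power of the
    weight: the quotient has the tails of the series as coefficients. *)
Lemma wl1_div1X j a : wl1 j.+1 a -> sums a 0 -> wl1 j (sg (-1) * a).
Proof.
move=> /wl1_bound[M M0 hM] [_ h0]; exists M => m.
apply/ler_addgt0Pr => e e0.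
pose cm := \sum_(n < m.+1) (n.+1%:R ^+ j : R).
have cm0 : 0 <= cm by apply: sumr_ge0 => i _; apply: exprn_ge0.
have cm1 : 0 < cm + 1 by rewrite ltr_wpDl.
have [N hN] := h0 _ (divr_gt0 e0 cm1); pose K := (N + m)%N.
have sK : `|coef (sg (-1) * a) K| <= e / (cm + 1).
  by have := hN K (leq_addr _ _); rewrite subr0.
apply: (@le_trans _ _ (\sum_(n < m.+1) \sum_(k < K.+1 | (n < k)%N) n.+1%:R ^+ j * `|coef a k|
    + cm * (e / (cm + 1)))); last first.
  apply: lerD; last by rewrite mulrCA ger_pMr// ler_pdivrMr// mul1r lerDl.
  apply: le_trans (hM K); rewrite (exchange_big_dep xpredT)//=.
  apply: ler_sum => k _; rewrite -mulr_suml coef_wabs ler_wpM2r//.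
  apply: (@le_trans _ _ (\sum_(n < m.+1 | (n < k)%N) k.+1%:R ^+ j)).
    by apply: ler_sum => i ik; rewrite lerXn2r ?nnegrE// ler_nat; lia.
  apply: (le_trans (sum_lt_const _ _ _)); first exact: exprn_ge0.
  by rewrite exprS ler_wpM2r ?exprn_ge0// ler_nat.
rewrite /cm mulr_suml -big_split; apply: ler_sum => n _ /=.
rewrite -mulr_sumr -mulrDr coef_wabs ler_wpM2l ?exprn_ge0//.
have -> : coef (sg (-1) * a) n = coef (sg (-1) * a) K - \sum_(k < K.+1 | (n < k)%N) coef a k.
  rewrite !coef_psum -!(big_mkord xpredT) -(big_mkord (fun k => n < k)%N).
  rewrite [X in _ = X - _](big_cat_nat (n := n.+1))//=; last by have := ltn_ord n; rewrite /K; lia.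
  rewrite [X in _ = _ - X](big_cat_nat (n := n.+1))//=; last by have := ltn_ord n; rewrite /K; lia.
  rewrite [X in _ = _ - (X + _)]big_nat_cond [X in _ = _ - (X + _)]big1 ?add0r; last by move=> i; lia.
  rewrite [X in _ = _ - X]big_nat_cond [X in _ = _ + X - _]big_nat_cond.
  rewrite -addrA [X in _ + (X - _)](eq_bigl (fun i => (n.+1 <= i < K.+1) && (n < i))%N) ?subrr ?addr0//.
  by move=> i; lia.
by apply: le_trans (ler_normB _ _) _; rewrite addrC; apply: lerD => //; exact: ler_norm_sum.
Qed.

End weighted_l1.

(** * Multipliers on truncated square-summable sequences *)

Section multipliers.
Variable R : realType.
Local Notation fps := (powerseries R).
Local Notation X := (series_X R).
Implicit Types a b v : fps.

Definition sqn n v : R := \sum_(k < n.+1) coef v k ^+ 2.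

Lemma sqn_ge0 n v : 0 <= sqn n v.
Proof. by apply: sumr_ge0 => i _; exact: sqr_ge0. Qed.

(** Convolution operators on square-summable sequences, tested on all
    truncations, hence without any integrability assumption on the sequence. *)
Definition multiplier (K : R) a := 0 <= K /\ forall n v, sqn n (a * v) <= K * sqn n v.

Lemma multiplierM K L a b : multiplier K a -> multiplier L b -> multiplier (K * L) (a * b).
Proof.
move=> [K0 hK] [L0 hL]; split=> [|n v]; first exact: mulr_ge0.
by rewrite -!mulrA; apply: le_trans (hK _ _) _; rewrite ler_wpM2l.
Qed.

Lemma multiplierD K L a b : multiplier K a -> multiplier L b -> multiplier (2 * (K + L)) (a + b).
Proof.
move=> [K0 hK] [L0 hL]; split=> [|n v]; first by rewrite mulr_ge0// addr_ge0.
rewrite -mulrA; apply: (@le_trans _ _ (2 * (sqn n (a * v) + sqn n (b * v)))).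
  rewrite /sqn -big_split mulr_sumr; apply: ler_sum => i _ /=.
  rewrite mulrDl coefD; have := sqr_ge0 (coef (a * v) i - coef (b * v) i); lra.
by rewrite ler_wpM2l// [leRHS]mulrDl lerD.
Qed.

Lemma multiplierN K a : multiplier K a -> multiplier K (- a).
Proof.
move=> [K0 hK]; split=> // n v; apply: le_trans (hK n v).
by rewrite mulNr; apply: ler_sum => i _; rewrite coefN sqrrN.
Qed.

Lemma psum_mul_le a b n : (forall k, 0 <= coef a k) -> (forall k, 0 <= coef b k) ->
  \sum_(k < n.+1) coef (a * b) k <=
  (\sum_(k < n.+1) coef a k) * (\sum_(k < n.+1) coef b k).
Proof.
move=> a0 b0; rewrite -coef_psum mulrCA coefM mulr_suml; apply: ler_sum => i _.
rewrite ler_wpM2l// coef_psum -!(big_mkord xpredT).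
by rewrite [leRHS](big_cat_nat (n := (n - i).+1))//= ?lerDl ?sumr_ge0//; lia.
Qed.

Lemma cauchy_schwarz_weighted n (w y : nat -> R) : (forall i, 0 <= w i) ->
  (\sum_(i < n) w i * y i) ^+ 2 <= (\sum_(i < n) w i) * (\sum_(i < n) w i * y i ^+ 2).
Proof.
move=> w0; pose s i := Num.sqrt (w i).
have s2 i : s i * s i = w i by rewrite -expr2 sqr_sqrtr.
have := cauchy_schwarz_sum n s (fun i => s i * y i).
congr (_ ^+ 2 <= _ * _); apply: eq_bigr => i _; rewrite ?exprMn ?expr2 ?mulrA s2//.
Qed.

(** Young's inequality for convolutions. *)
Lemma wl1_multiplier a : wl1 0 a -> exists K, multiplier K a.
Proof.
move=> /wl1_bound[M M0 hM]; exists (M * M); split=> [|n v]; first exact: mulr_ge0.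
have aE k : coef (wabs 0 a) k = `|coef a k| by rewrite coef_wabs expr0 mul1r.
pose v2 : fps := Series (fun k => coef v k ^+ 2).
apply: (@le_trans _ _ (M * \sum_(k < n.+1) coef (wabs 0 a * v2) k)).
  rewrite mulr_sumr; apply: ler_sum => k _; rewrite !coefM.
  pose w i := `|coef a i|; pose y i := `|coef v (k - i)%N|.
  apply: (@le_trans _ _ ((\sum_(i < k.+1) w i * y i) ^+ 2)).
    rewrite -real_normK ?num_real// lerXn2r ?nnegrE// ?sumr_ge0//.
      by move=> i _; rewrite mulr_ge0 /w /y.
    by apply: le_trans (ler_norm_sum _ _ _) _; apply: ler_sum => i _; rewrite normrM.
  apply: le_trans (cauchy_schwarz_weighted _ _ _) _; first by move=> i; rewrite /w.
  apply: ler_pM; first by apply: sumr_ge0 => i _; rewrite /w.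
  - by apply: sumr_ge0 => i _; rewrite /w mulr_ge0// sqr_ge0.
  - by apply: le_trans (hM k); apply: ler_sum => i _; rewrite aE.
  - by apply: ler_sum => i _; rewrite aE /y real_normK ?num_real.
rewrite -mulrA ler_wpM2l//; apply: le_trans (psum_mul_le _ _ _) _.
- exact: coef_wabs_ge0.
- by move=> k; exact: sqr_ge0.
by rewrite ler_wpM2r ?sqn_ge0.
Qed.

(** By the Cauchy-Schwarz inequality applied to the product of t and t * a.
    This is how pointwise bounds come out of the multiplier estimates. *)
Lemma coef_theta_multiplier K t a n : multiplier K a ->
  coef (t * t * a) n ^+ 2 <= K * sqn n t ^+ 2.
Proof.
move=> [K0 hK]; rewrite -mulrA coefM.
pose x i := coef t i; pose y i := coef (t * a) (n - i)%N.
apply: le_trans (cauchy_schwarz_sum n.+1 x y) _.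
have -> : \sum_(i < n.+1) y i ^+ 2 = sqn n (t * a).
  rewrite /sqn (reindex_inj rev_ord_inj) /=; apply: eq_bigr => i _.
  by rewrite /y subSS subKn// -ltnS.
have := hK n t; rewrite [a * t]mulrC => h.
rewrite expr2 mulrCA; apply: ler_pM => //; exact: sqn_ge0.
Qed.

(** Nonnegativity of the Toeplitz form of c. For a series that converges in the
    disc this says that c(z) has nonnegative real part, i.e. that the time
    discretization with weights c is A-stable. *)
Definition accretive (c : fps) := forall n p, 0 <= \sum_(k < n.+1) coef p k * coef (c * p) k.

(** With p = A v one has v = c p + x p, and the cross term of |c p + x p|^2 is
    nonnegative by accretivity, so |c p| <= |v|. The constant 1 does not depend
    on x: this is the source of all bounds uniform in the eigenvalue. *)
Lemma accretive_contraction c A x : accretive c -> 0 <= x ->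
  A * (c + series_cst x) = 1 -> multiplier 1 (c * A).
Proof.
move=> hc x0 AE; split=> // n v; rewrite mul1r -mulrA; set p := A * v.
have {1}-> : v = c * p + series_cst x * p by rewrite -mulrDl /p mulrA [_ * A]mulrC AE mul1r.
have -> : sqn n (c * p + series_cst x * p) = sqn n (c * p) +
    2 * x * (\sum_(k < n.+1) coef p k * coef (c * p) k) + x ^+ 2 * sqn n p.
  rewrite /sqn !mulr_sumr -!big_split; apply: eq_bigr => i _ /=.
  rewrite coefD coef_cstM; ring.
by rewrite -addrA lerDl addr_ge0// mulr_ge0 ?sqr_ge0 ?sqn_ge0// mulr_ge0.
Qed.

End multipliers.

Section toeplitz.
Variable R : realType.
Local Notation fps := (powerseries R).

Let shift i (F : nat -> R) k := if (i <= k)%N then F (k - i)%N else 0.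

Let sum_shift i F M : (forall k, 0 <= F k) -> \sum_(k < M) shift i F k <= \sum_(k < M) F k.
Proof.
move=> F0; rewrite -!(big_mkord xpredT) /shift.
case: (leqP i M) => h; last first.
  rewrite big_nat_cond big1 ?sumr_ge0// => k; rewrite andbT => /andP[_ hk].
  by rewrite ifF//; apply/negbTE; rewrite -ltnNge; lia.
rewrite (big_cat_nat (n := i))//= big_nat_cond big1 ?add0r; last first.
  by move=> k; rewrite andbT => /andP[_ hk]; rewrite ifF//; apply/negbTE; rewrite -ltnNge.
rewrite -{1}[i]add0n big_addn [leRHS](big_cat_nat (n := M - i))/= ?leq_subr//.
rewrite ler_wpDr ?sumr_ge0//; apply: ler_sum => k _.
by rewrite leq_addl addnK.
Qed.

Let sum_shift_eq i (F : nat -> R) n M : (forall k, (n < k)%N -> F k = 0) -> (n + i < M)%N ->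
  \sum_(k < M) shift i F k = \sum_(k < n.+1) F k.
Proof.
move=> F0 h; rewrite -!(big_mkord xpredT) /shift.
rewrite (big_cat_nat (n := i))//=; last by lia.
rewrite big_nat_cond big1 ?add0r; last first.
  by move=> k; rewrite andbT => /andP[_ hk]; rewrite ifF//; apply/negbTE; rewrite -ltnNge.
rewrite -{1}[i]add0n big_addn (big_cat_nat (n := n.+1))//=; last by lia.
rewrite [X in _ + X]big_nat_cond [X in _ + X]big1 ?addr0; last first.
  by move=> k; rewrite andbT => /andP[hk _]; rewrite leq_addl addnK F0.
by apply: eq_bigr => k _; rewrite leq_addl addnK.
Qed.

Lemma psum_dilate d (c : fps) n : (0 < d)%N ->
  \sum_(j < n.+1) coef (series_dilate d c) j = \sum_(m < (n %/ d).+1) coef c m.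
Proof.
move=> d0; elim: n => [|n IH].
  by rewrite div0n !big_ord_recl !big_ord0 coef_dilate dvdn0 div0n.
rewrite big_ord_recr /= IH coef_dilate divnS//; case: ifP => h.
  by rewrite h; have -> : (true + n %/ d = (n %/ d).+1)%N by []; rewrite [RHS]big_ord_recr.
by rewrite addr0.
Qed.

(** With S the shift by d, the form is the sum of the coefficients times |p|^2,
    minus half the sum of the c_j |p - S^j p|^2. Only positive coefficients can
    make it negative, and for j = 2 and 3 they are paid for by - c_1, since
    |p - S^j p| <= j |p - S p| has squares 4 and 9. *)
Lemma toeplitz_accretive d (c : fps) : (0 < d)%N ->
  (forall n, (3 <= n)%N -> 0 <= \sum_(k < n.+1) coef c k) ->
  (forall k, (4 <= k)%N -> coef c k <= 0) ->
  4 * Num.max (coef c 2) 0 + 9 * Num.max (coef c 3) 0 <= - coef c 1 ->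
  accretive (series_dilate d c).
Proof.
move=> d0 hs h4 h3 n p.
(* The form only sees p up to order n, so p may be cut off there. *)
pose P k := if (k <= n)%N then coef p k else 0.
have P0 k : (n < k)%N -> P k = 0 by move=> h; rewrite /P leqNgt h.
pose L i := \sum_(k < n.+1) P k * shift i P k.
pose M := (n + 3 * d).+1.
pose Q i k := P k - shift i P k.
have QEM i M' : (n + i < M')%N -> \sum_(k < M') Q i k ^+ 2 = 2 * (L 0 - L i).
  move=> hi.
  have E0 : \sum_(k < M') P k ^+ 2 = L 0.
    rewrite -[RHS](@sum_shift_eq 0 (fun k => P k * shift 0 P k) n M').
    - by apply: eq_bigr => k _; rewrite /shift !leq0n !subn0 expr2.
    - by move=> k nk; rewrite P0// mul0r.
    - by lia.
  have E1 : \sum_(k < M') shift i P k ^+ 2 = L 0.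
    rewrite -[RHS](@sum_shift_eq i (fun k => P k * shift 0 P k) n M').
    - by apply: eq_bigr => k _; rewrite /shift leq0n subn0; case: ifP; rewrite ?expr2// mul0r.
    - by move=> k nk; rewrite P0// mul0r.
    - by lia.
  have E2 : \sum_(k < M') P k * shift i P k = L i.
    rewrite -[RHS](@sum_shift_eq 0 (fun k => P k * shift i P k) n M').
    - by apply: eq_bigr => k _; rewrite /shift leq0n subn0.
    - by move=> k nk; rewrite P0// mul0r.
    - by lia.
  transitivity (\sum_(k < M') P k ^+ 2 - 2 * (\sum_(k < M') P k * shift i P k) + \sum_(k < M') shift i P k ^+ 2).
    rewrite mulr_sumr -sumrB -big_split; apply: eq_bigr => k _; rewrite /Q /=; ring.
  by rewrite E0 E1 E2; ring.
have QE i : (i <= 3 * d)%N -> \sum_(k < M) Q i k ^+ 2 = 2 * (L 0 - L i).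
  by move=> hi; apply: QEM; rewrite /M; lia.
have Q2 k : Q (2 * d)%N k = Q d k + shift d (Q d) k.
  rewrite /Q /shift; case: (leqP d k) => h1; last by rewrite ifF ?subr0 ?addr0//; apply/negbTE; lia.
  have -> : (2 * d <= k)%N = (d <= k - d)%N by lia.
  by case: ifP => h2; [have -> : (k - 2 * d = k - d - d)%N by lia|]; ring.
have Q3 k : Q (3 * d)%N k = Q d k + shift d (Q d) k + shift (2 * d) (Q d) k.
  rewrite -Q2 /Q /shift; case: (leqP (2 * d) k) => h1; last by rewrite ifF ?subr0 ?addr0//; apply/negbTE; lia.
  have -> : (3 * d <= k)%N = (d <= k - 2 * d)%N by lia.
  by case: ifP => h2; [have -> : (k - 3 * d = k - 2 * d - d)%N by lia|]; ring.
pose X i := L 0 - L i.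
have sq_shift i (F : nat -> R) : \sum_(k < M) shift i F k ^+ 2 <= \sum_(k < M) F k ^+ 2.
  apply: le_trans (@sum_shift i (fun k => F k ^+ 2) M _); last by move=> k; exact: sqr_ge0.
  by apply: ler_sum => k _; rewrite /shift; case: ifP; rewrite ?expr0n.
have X2 : X (2 * d)%N <= 4 * X d.
  rewrite -(@ler_pM2l _ 2)// -QE; last by lia.
  apply: (@le_trans _ _ (2 * (\sum_(k < M) Q d k ^+ 2 + \sum_(k < M) shift d (Q d) k ^+ 2))).
    rewrite -big_split mulr_sumr; apply: ler_sum => k _; rewrite Q2 /=.
    have := sqr_ge0 (Q d k - shift d (Q d) k); lra.
  have := sq_shift d (Q d); rewrite QE /X; last by lia.
  lra.
have X3 : X (3 * d)%N <= 9 * X d.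
  rewrite -(@ler_pM2l _ 2)// -QE; last by lia.
  apply: (@le_trans _ _ (3 * (\sum_(k < M) Q d k ^+ 2 + \sum_(k < M) shift d (Q d) k ^+ 2
      + \sum_(k < M) shift (2 * d) (Q d) k ^+ 2))).
    rewrite -!big_split mulr_sumr; apply: ler_sum => k _; rewrite Q3 /=.
    have := sqr_ge0 (Q d k - shift d (Q d) k).
    have := sqr_ge0 (Q d k - shift (2 * d) (Q d) k).
    have := sqr_ge0 (shift d (Q d) k - shift (2 * d) (Q d) k).
    lra.
  have := sq_shift d (Q d); have := sq_shift (2 * d)%N (Q d); rewrite QE /X; last by lia.
  lra.
have XN i : 0 <= X i.
  have : 0 <= \sum_(k < (n + i).+1) Q i k ^+ 2 by apply: sumr_ge0 => k _; exact: sqr_ge0.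
  by rewrite QEM// pmulr_rge0.
pose e := series_dilate d c.
pose N := (n + 3 * d)%N.
have -> : \sum_(k < n.+1) coef p k * coef (e * p) k = \sum_(j < N.+1) coef e j * L j.
  under [RHS]eq_bigr => j _ do rewrite /L mulr_sumr.
  rewrite [RHS]exchange_big /=; apply: eq_bigr => k _.
  rewrite coefM mulr_sumr.
  rewrite -(big_mkord xpredT (fun j => coef p k * (coef e j * coef p (k - j)%N))).
  rewrite -[RHS](big_mkord xpredT (fun j => coef e j * (P k * shift j P k))).
  have kn : (k <= n)%N by rewrite -ltnS.
  rewrite [RHS](big_cat_nat (n := k.+1))//=; last by rewrite /N; lia.
  rewrite [X in _ = _ + X]big_nat_cond [X in _ = _ + X]big1 ?addr0; last first.
    move=> j; rewrite andbT => /andP[kj _].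
    by rewrite /shift ifF ?mulr0//; apply/negbTE; rewrite -ltnNge.
  rewrite big_nat_cond [RHS]big_nat_cond; apply: eq_bigr => j; rewrite andbT => /andP[_ jk].
  by rewrite /shift /P kn ifT// ifT; [rewrite mulrCA|lia].
have -> : \sum_(j < N.+1) coef e j * L j =
   (\sum_(j < N.+1) coef e j) * L 0 - \sum_(j < N.+1) coef e j * X j.
  rewrite mulr_suml -sumrB; apply: eq_bigr => j _; rewrite /X; ring.
rewrite subr_ge0; apply: (@le_trans _ _ 0); last first.
  apply: mulr_ge0; last first.
    apply: sumr_ge0 => k _; rewrite /shift leq0n subn0 -expr2; exact: sqr_ge0.
  by rewrite psum_dilate//; apply: hs; rewrite /N leq_divRL// leq_addl.
pose z1 := coef c 1 * X d.
pose z2 := Num.max (coef c 2) 0 * X (2 * d)%N.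
pose z3 := Num.max (coef c 3) 0 * X (3 * d)%N.
have Xd := XN d.
have m2 : 0 <= Num.max (coef c 2) 0 by rewrite le_max lexx orbT.
have m3 : 0 <= Num.max (coef c 3) 0 by rewrite le_max lexx orbT.
apply: (@le_trans _ _ (\sum_(j < N.+1) ((if j == d :> nat then z1 else 0) +
    (if j == (2 * d)%N :> nat then z2 else 0) + (if j == (3 * d)%N :> nat then z3 else 0)))).
  apply: ler_sum => j _; rewrite /e coef_dilate.
  case: ifP => [/dvdnP[m ->]|dj]; last first.
    by rewrite mul0r; do 3 ?[case: eqP => [E|_]; first by rewrite E ?dvdnn ?dvdn_mull in dj]; rewrite !addr0.
  have eqd : (m * d == d)%N = (m == 1)%N by rewrite -{2}[d]mul1n eqn_pmul2r.
  rewrite mulnK// eqd !eqn_pmul2r//.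
  case: m {eqd} => [|[|[|[|m]]]] /=; rewrite ?addr0 ?add0r ?mul1n//.
  - by rewrite /X subrr mulr0.
  - by rewrite ler_wpM2r// le_max lexx.
  - by rewrite ler_wpM2r// le_max lexx.
  - by rewrite mulr_le0_ge0// h4.
have pick m (z : R) (h : (m < N.+1)%N) : \sum_(j < N.+1) (if j == m :> nat then z else 0) = z.
  by rewrite -big_mkcond (big_pred1 (Ordinal h)).
rewrite !big_split /= !pick; try by rewrite /N; lia.
apply: (@le_trans _ _ (z1 + Num.max (coef c 2) 0 * (4 * X d) + Num.max (coef c 3) 0 * (9 * X d))).
  by rewrite -!addrA lerD2l lerD// ler_wpM2l.
have : 0 <= (- coef c 1 - (4 * Num.max (coef c 2) 0 + 9 * Num.max (coef c 3) 0)) * X d.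
  by rewrite mulr_ge0// subr_ge0.
rewrite /z1; lra.
Qed.

End toeplitz.

(** * Bounds on binomial coefficients *)

Section binomial_bounds.
Variable R : realType.
Local Notation X := (series_X R).
Implicit Types (s g al x y : R).

(** Concavity of powers: the graph lies below its tangent at 1. *)
Lemma powR_le_tangent s x : 0 < s < 1 -> 0 <= x -> x `^ s <= 1 + s * (x - 1).
Proof.
move=> /andP[s0 s1] x0.
have e1 : 0 < 1 - s by lra.
have := @conjugate_powR R (x `^ s) 1 s^-1 (1 - s)^-1 (powR_ge0 _ _) ler01.
rewrite !invr_gt0 !invrK => /(_ s0 e1); rewrite subrKC => /(_ erefl).
rewrite mulr1 -powRrM divff ?gt_eqF// powRr1// powR1; lra.
Qed.

Lemma powR_le_tangent_at s x y : 0 < s < 1 -> 0 <= x -> 0 < y ->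
  x `^ s <= y `^ s + s * y `^ (s - 1) * (x - y).
Proof.
move=> s01 x0 y0; have y0' : y != 0 by rewrite gt_eqF.
have xy0 : 0 <= x / y by rewrite divr_ge0// ltW.
have := ler_wpM2l (powR_ge0 y s) (powR_le_tangent s01 xy0).
rewrite -powRM ?(ltW y0)// mulrC divfK//.
have -> : y `^ (s - 1) = y `^ s / y by rewrite powRB ?y0' ?implybT// powRr1// ltW.
by move/le_trans; apply; rewrite le_eqVlt; apply/orP; left; apply/eqP; field.
Qed.

Lemma coef_sg_ge0 g n : g <= 0 -> 0 <= coef (sg g) n.
Proof.
move=> g0; elim: n => [|n IH]; first by rewrite coef_sg0.
by rewrite coef_sgS mulr_ge0// divr_ge0// subr_ge0 (le_trans g0).
Qed.

Lemma coef_sg_le0 g n : 0 <= g <= 1 -> coef (sg g) n.+1 <= 0.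
Proof.
move=> /andP[g0 g1]; elim: n => [|n IH].
  by rewrite coef_sgS coef_sg0 mul1r sub0r divr1 oppr_le0.
by rewrite coef_sgS mulr_le0_ge0// divr_ge0// subr_ge0 (le_trans g1)// ler1n.
Qed.

Lemma wl1_sg al : 0 <= al <= 1 -> wl1 0 (sg al).
Proof.
move=> h; exists 2 => n.
have -> : \sum_(k < n.+1) coef (wabs 0 (sg al)) k = 2 - coef (sg (-1) * sg al) n.
  rewrite coef_psum !big_ord_recl coef_wabs coef_sg0 expr0 normr1 mulr1.
  rewrite opprD -sumrN addrA; congr (_ + _); first by lra.
  apply: eq_bigr => i _; rewrite lift0 coef_wabs expr0 mul1r ler0_norm//.
  exact: coef_sg_le0.
rewrite -sgD gerBl coef_sg_ge0//; lra.
Qed.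

Lemma wl1_sgS j g : wl1 j (sg g) -> wl1 j.+1 (sg (1 + g)).
Proof.
move=> h; apply: wl1_of_deriv; rewrite deriv_sg sgD.
have -> : - (series_cst (1 + g) * sg (-1)) * (sg 1 * sg g) = - (series_cst (1 + g) * sg g).
  have E : sg (-1) * sg 1 = 1 :> powerseries R by rewrite -sgD addNr sg0.
  transitivity (- (series_cst (1 + g) * ((sg (-1) * sg 1) * sg g))); first ring.
  by rewrite E mul1r.
by apply/wl1N/wl1M => //; exact: wl1_cst.
Qed.

Lemma wl1_rh j g : wl1 j (sg g) -> wl1 j (rh g).
Proof. by apply: wl1_scale; rewrite normrN1. Qed.

(** The ratio of consecutive coefficients is 1 - s / (n + 1), and
    (1 - x)(1 + x) <= 1 with x = s / (n + 1), where 1 + x bounds the ratio of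
    the powers by concavity. *)
Lemma coef_sg_bound s n : 0 < s < 1 -> coef (sg (s - 1)) n <= n.+1%:R `^ (- s).
Proof.
move=> s01; have /andP[s0 s1] := s01.
elim: n => [|n IH]; first by rewrite coef_sg0 powR1.
have n1 : (0 : R) < n.+1%:R by rewrite ltr0n.
have n2 : (0 : R) < n.+2%:R by rewrite ltr0n.
rewrite coef_sgS; have -> : (n%:R - (s - 1)) / n.+1%:R = 1 - s / n.+1%:R.
  by rewrite -natr1; field; rewrite natr1 pnatr_eq0.
have k0 : 0 <= 1 - s / n.+1%:R.
  by rewrite subr_ge0 ler_pdivrMr// mul1r (le_trans (ltW s1))// ler1n.
apply: le_trans (ler_wpM2r k0 IH) _.
rewrite !powRN mulrC ler_pdivrMr ?powR_gt0// ler_pdivlMl ?powR_gt0//.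
have := powR_le_tangent s01 (divr_ge0 (ltW n2) (ltW n1)).
have -> : (n.+2%:R / n.+1%:R) `^ s = n.+2%:R `^ s / n.+1%:R `^ s :> R.
  rewrite powRM ?invr_ge0 ?ltW//; congr (_ * _).
  by rewrite -powR_inv1 ?ltW// -powRrM mulN1r powRN.
have -> : 1 + s * (n.+2%:R / n.+1%:R - 1) = 1 + s / n.+1%:R :> R.
  have E (m : R) : 0 < m -> 1 + s * ((m + 1) / m - 1) = 1 + s / m.
    by move=> m0; field; rewrite gt_eqF.
  by rewrite -[n.+2%:R]natr1 E.
rewrite ler_pdivrMr ?powR_gt0// => h.
apply: le_trans (ler_wpM2r k0 h) _.
rewrite mulrAC -[leRHS]mul1r ler_wpM2r ?powR_ge0//.
by rewrite mulrC -subr_sqr expr1n gerBl sqr_ge0.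
Qed.

Lemma sum_powR_bound al n : 0 < al < 1 ->
  \sum_(k < n.+1) (k.+1%:R : R) `^ (al - 1) <= al^-1 * n.+1%:R `^ al.
Proof.
move=> al01; have /andP[a0 a1] := al01; elim: n => [|n IH].
  by rewrite big_ord_recl big_ord0 !powR1 addr0 mulr1 invf_ge1 ?ltW.
rewrite big_ord_recr /=; apply: le_trans (lerD IH (lexx _)) _.
have n2 : (0 : R) < n.+2%:R by rewrite ltr0n.
have := powR_le_tangent_at al01 (ler0n R n.+1) n2.
rewrite -[n.+2%:R]natr1; set y := _ `^ (al - 1); set u := _ `^ al; set v := _ `^ al => h.
have -> : al^-1 * u + y = al^-1 * (u + al * y) by field; rewrite gt_eqF.
by rewrite ler_pM2l ?invr_gt0//; lra.
Qed.

(** The exponent is half of that in the derivative of the resolvent, whose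
    leading part is (1 - z)^(-(1 + al)). *)
Lemma sqn_sg_bound al n : 0 < al < 1 ->
  sqn n (sg (- ((1 + al) / 2))) <= al^-1 * n.+1%:R `^ al.
Proof.
move=> al01; have /andP[a0 a1] := al01; apply: le_trans (sum_powR_bound n al01).
apply: ler_sum => k _.
have -> : - ((1 + al) / 2) = (1 - al) / 2 - 1 by field.
have h : 0 < (1 - al) / 2 < 1 by apply/andP; split; lra.
have c0 : 0 <= coef (sg ((1 - al) / 2 - 1)) k by apply: coef_sg_ge0; lra.
apply: (@le_trans _ _ ((k.+1%:R `^ (- ((1 - al) / 2))) ^+ 2)).
  by rewrite lerXn2r ?nnegrE ?powR_ge0// coef_sg_bound.
rewrite -powR_mulrn ?powR_ge0// -powRrM le_eqVlt; apply/orP; left; apply/eqP.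
by congr (_ `^ _); field.
Qed.

Lemma sqn_dilate2 n (v : powerseries R) : sqn n (series_dilate 2 v) <= sqn n v.
Proof.
suff h m : sqn m.*2.+1 (series_dilate 2 v) = sqn m v.
  apply: (@le_trans _ _ (sqn n.*2.+1 (series_dilate 2 v))); last by rewrite h.
  rewrite /sqn -!(big_mkord xpredT (fun k => coef (series_dilate 2 v) k ^+ 2)).
  rewrite [leRHS](big_cat_nat (n := n.+1))//= ?lerDl ?sumr_ge0//; last by rewrite -addnn; lia.
  by move=> i _; exact: sqr_ge0.
elim: m => [|m IH].
  by rewrite /sqn !big_ord_recl !big_ord0 !coef_dilate /= expr0n /= !addr0.
rewrite doubleS [LHS]/sqn 2!big_ord_recr /= -/(sqn _ _) IH [RHS]/sqn big_ord_recr /=.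
rewrite !coef_dilate !dvdn2 /= odd_double /= expr0n addr0.
by rewrite -doubleS -muln2 mulnK.
Qed.

End binomial_bounds.

(** * Second-order schemes *)

Lemma sums_dilate2 (R : realType) (a : powerseries R) c :
  sums a c -> sums (series_dilate 2 a) c.
Proof.
move=> [la ha]; split; first exact: wl1_dilate2.
move=> e e0; have [N hN] := ha e e0; exists N.*2 => n nN.
rewrite coef_psum psum_dilate// -coef_psum hN//.
by rewrite -[N](@mulnK _ 2)// muln2 leq_div2r.
Qed.

Lemma dilate2X (R : realType) : series_dilate 2 (series_X R) = series_X R * series_X R.
Proof.
apply/seriesP => n; rewrite coef_dilate coef_XM coef_X.
case: n => [|[|[|n]]] //=; rewrite coef_X.
case: ifP => // h; case: n h => [|n] // h.
by have -> : (n.+4 %/ 2 == 1)%N = false by lia.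
Qed.

Section scheme.
Variables (R : realType) (al : R).
Local Notation fps := (powerseries R).
Local Notation X := (series_X R).
Local Notation C := (@series_cst R).
Local Notation D := (@series_deriv R).
Local Notation dil := (@series_dilate R 2).

(** A scheme with generating function w(z) = (1 - z)^al p(z). The values
    p(1) = 1 and p'(1) = - al / 2 are the conditions of second order consistency
    of w(z) (1 + z) / 2 at the midpoints of the grid.
    Accretivity of w is A-stability; it is also required of the dilation
    w(z^2), which is the same scheme read on the grid of the half step. *)
Record scheme := Scheme {
  sc_p : fps;
  sc_pV : fps;
  sc_pVE : sc_p * sc_pV = 1;
  sc_p_gt0 : 0 < coef sc_p 0;
  sc_wl1 : wl1 2 sc_p;
  sc_wl1V : wl1 0 sc_pV;
  sc_p1 : sums sc_p 1;
  sc_dp1 : sums (D sc_p) (- (al / 2));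
  sc_accretive1 : accretive (sg al * sc_p);
  sc_accretive2 : accretive (dil (sg al * sc_p)) }.

Variable sc : scheme.
Hypothesis al01 : 0 < al < 1.
Hypothesis sums_rh : sums (rh al) (2 `^ al).

Local Notation p := (sc_p sc).
Local Notation P := (sc_pV sc).
Local Notation pp := (dil (sc_p sc)).
Local Notation PP := (dil (sc_pV sc)).
Local Notation c := (2 `^ al : R).

Definition sc_w : fps := sg al * p.

Let al0 : 0 <= al <= 1. Proof. by case/andP: al01 => *; apply/andP; split; lra. Qed.

Let ppE : pp * PP = 1.
Proof. by rewrite -series_dilateM// sc_pVE series_dilate1. Qed.

(** The defect between the scheme with the half step, whose symbol in the
    variable of the refined grid is 2^al w(z), and the one with the full step,
    whose symbol is w(z^2): their difference is (1 - z)^al sc_f. *)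
Definition sc_f : fps := C c * p - rh al * pp.
(** Second order consistency makes sc_f vanish twice at z = 1. *)
Definition sc_q : fps := sg (-2) * sc_f.
Local Notation f := sc_f.
Local Notation q := sc_q.

(** The factor (1 + z)^2 compensates the singularity that (1 + z)^al has at
    z = -1, so that h is smooth enough to be divided twice by 1 - z. *)
Let h : fps := rh 2 * f.

Let rh2 : rh 2 = (1 + X) * (1 + X) :> fps.
Proof. by rewrite (_ : 2 = 1 + 1)// rhD rh1. Qed.

Let hE : h = C c * rh 2 * p - rh (2 + al) * pp.
Proof. by rewrite /h /f (rhD 2 al); ring. Qed.

Let Dpp : D pp = C 2 * X * dil (D p).
Proof. exact: series_deriv_dilate2. Qed.

Let wl1_pp : wl1 2 pp. Proof. exact/wl1_dilate2/sc_wl1. Qed.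

Let wl1_rhal : wl1 0 (rh al). Proof. by apply/wl1_rh/wl1_sg. Qed.

Let wl1_rh1al : wl1 1 (rh (1 + al)). Proof. by apply/wl1_rh/wl1_sgS/wl1_sg. Qed.

Let wl1_rh2al : wl1 2 (rh (2 + al)).
Proof. by rewrite (_ : 2 + al = 1 + (1 + al)); [apply/wl1_rh/wl1_sgS/wl1_sgS/wl1_sg|rewrite addrA]. Qed.

Let wl1_1X j : wl1 j (1 + X). Proof. by apply: wl1D; [exact: wl1_1|exact: wl1_X]. Qed.
Let wl1_1mX j : wl1 j (1 - X). Proof. by apply: wl1B; [exact: wl1_1|exact: wl1_X]. Qed.

Let wl1_f : wl1 0 f.
Proof.
apply: wl1B; apply: wl1M => //; first exact: wl1_cst.
- exact: wl1_mono (sc_wl1 sc).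
- exact: wl1_mono wl1_pp.
Qed.

Let sums_pp : sums pp 1. Proof. exact/sums_dilate2/sc_p1. Qed.

Let sums_1X : sums (1 + X) 2.
Proof. by rewrite (_ : 2 = 1 + 1)//; apply: sumsD; [exact: sums1|exact: sumsX]. Qed.

Let sums_f : sums f 0.
Proof.
rewrite (_ : 0 = c * 1 - c * 1); last by rewrite subrr.
apply: sumsB; first by apply: sumsM; [exact: sums_cst|exact: sc_p1].
exact: sumsM sums_rh sums_pp.
Qed.

Let sums_h : sums h 0.
Proof.
rewrite (_ : 0 = 2 * 2 * 0); last by rewrite mulr0.
rewrite /h rh2; apply: sumsM; last exact: sums_f.
exact: sumsM sums_1X sums_1X.
Qed.

Let wl1_h : wl1 2 h.
Proof.
rewrite hE; apply: wl1B; apply: wl1M => //; last exact: sc_wl1.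
by apply: wl1M; [exact: wl1_cst|rewrite rh2; apply: wl1M].
Qed.

Let DrhE g : D (rh (1 + g)) = C (1 + g) * rh g.
Proof.
rewrite deriv_rh; transitivity (C (1 + g) * (rh (-1) * rh (1 + g))); first ring.
by rewrite -rhD addKr.
Qed.

Let sums_Dh : sums (D h) 0.
Proof.
have -> : D h = C c * (C 2 * rh 1 * p + rh 2 * D p)
   - (C (2 + al) * (rh 1 * rh al) * pp + (rh 2 * rh al) * D pp).
  rewrite hE series_derivB !series_derivM series_deriv_cst.
  rewrite (_ : rh 2 = rh (1 + 1))//.
  rewrite (_ : rh (2 + al) = rh (1 + (1 + al))); last by rewrite addrA.
  rewrite !DrhE (_ : 1 + 1 = 2 :> R)// (_ : 1 + (1 + al) = 2 + al); last by rewrite addrA.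
  rewrite !rhD; ring.
have s1 : sums (rh 1) (2 : R) by rewrite rh1.
have s2 : sums (rh 2) (2 * 2 : R) by rewrite rh2; apply: sumsM.
have sD : sums (D pp) (2 * 1 * (- (al / 2))).
  rewrite Dpp; apply: sumsM; first by apply: sumsM; [exact: sums_cst|exact: sumsX].
  exact/sums_dilate2/sc_dp1.
have -> : 0 = c * (2 * 2 * 1 + 2 * 2 * (- (al / 2)))
   - ((2 + al) * (2 * c) * 1 + (2 * 2 * c) * (2 * 1 * (- (al / 2)))) by field.
apply: sumsB.
  apply: sumsM; first exact: sums_cst.
  apply: sumsD; last by apply: sumsM => //; exact: sc_dp1.
  by apply: sumsM; [apply: sumsM => //; exact: sums_cst|exact: sc_p1].
apply: sumsD; last by apply: sumsM => //; apply: sumsM.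
apply: sumsM => //; apply: sumsM; first exact: sums_cst.
exact: sumsM s1 sums_rh.
Qed.

Let sgK (a : fps) : sg (-1) * ((1 - X) * a) = a.
Proof. by rewrite mulrA [sg _ * _]mulrC sgN1K mul1r. Qed.

Let sums_mul1X (a : fps) : wl1 0 a -> sums ((1 - X) * a) 0.
Proof.
move=> la; split; first exact: wl1M.
rewrite sgK => e e0; have [N hN] := wl1_null la e0.
by exists N => n /hN; rewrite subr0.
Qed.

(** L'Hospital's rule: the value at 1 of h / (1 - z) is - h'(1). *)
Let sums_quotient : sums (sg (-1) * h) 0.
Proof.
pose s1 := sg (-1) * h.
have l1 : wl1 1 s1 by apply: wl1_div1X; [exact: wl1_h|exact: sums_h].
have hs : h = (1 - X) * s1 by rewrite /s1 mulrA sgN1K mul1r.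
have -> : sg (-1) * h = (1 - X) * D s1 - D h.
  have -> : D h = D ((1 - X) * s1) by rewrite -hs.
  rewrite (series_derivM (1 - X) s1) series_derivB series_deriv1 series_derivX -/s1; ring.
rewrite -[X in sums _ X](subrr 0); apply: sumsB => //.
by apply: sums_mul1X; apply: wl1_deriv.
Qed.

Let C2 : C 2 = 1 + 1 :> fps. Proof. by rewrite rmorphD rmorph1. Qed.

Let sg2 : sg (-2) = sg (-1) * sg (-1) :> fps.
Proof. by rewrite -sgD; congr sg; ring. Qed.

Let h2E : rh 2 * q = sg (-1) * (sg (-1) * h).
Proof. rewrite /q /h sg2; ring. Qed.

Let wl1_rh2q : wl1 0 (rh 2 * q).
Proof.
by rewrite h2E; apply: wl1_div1X; [apply: wl1_div1X; [exact: wl1_h|exact: sums_h]|exact: sums_quotient].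
Qed.

Let fE : f = (1 - X) * (1 - X) * q.
Proof.
rewrite /q sg2; transitivity ((1 - X) * sg (-1) * ((1 - X) * sg (-1)) * f); last ring.
by rewrite !sgN1K !mul1r.
Qed.

(** (1+z)^2 (2-z) + (1-z)^2 (2+z) = 4 splits q into a part regular at z = -1
    and a part regular at z = 1. *)
Lemma wl1_q : wl1 0 q.
Proof.
have -> : q = C (1 / 4) * ((C 2 - X) * (rh 2 * q) + (C 2 + X) * f).
  rewrite [X in _ + _ * X]fE rh2.
  transitivity (C (1 / 4) * C 4 * q); first by rewrite -rmorphM mul1r mulVf ?rmorph1 ?mul1r// pnatr_eq0.
  rewrite !rmorph_nat; ring.
apply: wl1M; first exact: wl1_cst.
apply: wl1D; apply: wl1M => //; [apply: wl1B|apply: wl1D]; try exact: wl1_cst; exact: wl1_X.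
Qed.

(** The derivative of sc_q has singularities of one order more at both points
    1 and -1, which the two factors remove. *)
Lemma wl1_Dq : wl1 0 ((1 - X) * (1 + X) * D q).
Proof.
pose k := (1 + X) * D f.
have rhK : rh (-1) * (1 + X) = 1 :> fps by rewrite -rh1 -rhD addNr rh0.
have kE : k = C c * (1 + X) * D p - C al * rh al * pp - (1 + X) * rh al * D pp.
  rewrite /k /f series_derivB !series_derivM series_deriv_cst deriv_rh.
  transitivity (C c * (1 + X) * D p - C al * rh al * pp * (rh (-1) * (1 + X)) - (1 + X) * rh al * D pp); first ring.
  by rewrite rhK mulr1.
have lp j : (j <= 2)%N -> wl1 j p by move=> hj; exact: wl1_mono (sc_wl1 sc).
have lpp j : (j <= 2)%N -> wl1 j pp by move=> hj; exact: wl1_mono wl1_pp.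
have lDp : wl1 0 (D p) by apply/wl1_deriv/lp.
have lDpp : wl1 0 (D pp) by apply/wl1_deriv/lpp.
have lk : wl1 0 k.
  rewrite kE; apply: wl1B; [apply: wl1B|]; apply: wl1M => //; try exact: lpp; apply: wl1M => //; exact: wl1_cst.
have k2E : (1 + X) * k = D h - C 2 * (1 + X) * f.
  have E (g : fps) : (1 + X) * ((1 + X) * D g) = D ((1 + X) * (1 + X) * g) - (1 + 1) * (1 + X) * g.
    rewrite !series_derivM series_derivD series_deriv1 series_derivX; ring.
  by rewrite /h rh2 /k E C2.
have lf1 : wl1 1 ((1 + X) * f).
  have -> : (1 + X) * f = C c * (1 + X) * p - rh (1 + al) * pp by rewrite /f rhD rh1; ring.
  apply: wl1B; apply: wl1M => //; try exact: lpp; try exact: lp.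
  by apply: wl1M => //; exact: wl1_cst.
have lk2 : wl1 1 ((1 + X) * k).
  rewrite k2E; apply: wl1B; first exact: wl1_deriv.
  by rewrite -mulrA; apply: wl1M => //; exact: wl1_cst.
have sk2 : sums ((1 + X) * k) 0.
  rewrite k2E (_ : 0 = 0 - 2 * 2 * 0); last by rewrite mulr0 subrr.
  apply: sumsB => //; apply: sumsM => //; apply: sumsM => //; exact: sums_cst.
have lsk : wl1 0 (sg (-1) * k).
  have -> : sg (-1) * k = C (1 / 2) * (sg (-1) * ((1 + X) * k) + k).
    transitivity (C (1 / 2) * (sg (-1) * ((1 + X) * k) + sg (-1) * ((1 - X) * k))); last by rewrite sgK.
    transitivity (C (1 / 2) * C 2 * (sg (-1) * k)); last by rewrite C2; ring.
    by rewrite -rmorphM mul1r mulVf ?rmorph1 ?mul1r// pnatr_eq0.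
  by apply: wl1M; [exact: wl1_cst|apply: wl1D => //; apply: wl1_div1X].
have -> : (1 - X) * (1 + X) * D q = C 2 * (1 + X) * q + sg (-1) * k.
  rewrite /q series_derivM deriv_sg.
  transitivity ((1 - X) * sg (-1) * (C 2 * (1 + X) * (sg (-2) * f)) + ((1 - X) * sg (-2)) * k).
    rewrite /k rmorphN !rmorph_nat; ring.
  rewrite sgN1K mul1r; congr (_ + _).
  by rewrite sg2 [(1 - X) * _]mulrA sgN1K mul1r.
apply: wl1D => //; apply: wl1M; last exact: wl1_q.
by apply: wl1M => //; exact: wl1_cst.
Qed.

(** ** Resolvents *)

(** The logarithmic derivative of the symbol w is G / (1 - z), and that of its
    dilation is Gd / (1 - z^2), with absolutely summable G and Gd. Hence the
    derivative of a resolvent A = 1 / (w + x) is, up to bounded factors such as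
    w A, the series (1 - z)^(-1-al) = theta^2. *)
Let G : fps := - C al + (1 - X) * D p * P.

Let wl1_G : wl1 0 G.
Proof.
apply: wl1D; first by apply/wl1N/wl1_cst.
by apply: wl1M; [apply: wl1M => //; apply: wl1_deriv; exact: wl1_mono (sc_wl1 sc)|exact: sc_wl1V].
Qed.

Let Dw : D sc_w = sg (-1) * G * sc_w.
Proof.
rewrite /sc_w series_derivM deriv_sg /G.
transitivity (- (C al * sg (-1)) * sg al * p + (1 - X) * sg (-1) * (p * P) * (sg al * D p)); last ring.
by rewrite sgN1K sc_pVE !mul1r.
Qed.

Let Gd : fps := - C al * (1 + X) + C al * (1 - X) + (1 - X) * (1 + X) * D pp * PP.

Let wl1_Gd : wl1 0 Gd.
Proof.
apply: wl1D.
  by apply: wl1D; apply: wl1M => //; [apply: wl1N|]; exact: wl1_cst.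
apply: wl1M; last by apply: wl1_dilate2; exact: sc_wl1V.
by apply: wl1M; [exact: wl1M|apply: wl1_deriv; exact: wl1_mono wl1_pp].
Qed.

Let dilw : dil sc_w = sg al * rh al * pp.
Proof. by rewrite series_dilateM// dilate_sg. Qed.

Let rhN1K : rh (-1) * (1 + X) = 1 :> fps.
Proof. by rewrite -rh1 -rhD addNr rh0. Qed.

Let Ddw : D (dil sc_w) = sg (-1) * rh (-1) * Gd * dil sc_w.
Proof.
rewrite dilw !series_derivM deriv_sg deriv_rh /Gd.
transitivity (- (C al * sg (-1)) * (rh (-1) * (1 + X)) * (sg al * rh al * pp)
  + (C al * rh (-1)) * ((1 - X) * sg (-1)) * (sg al * rh al * pp)
  + ((1 - X) * sg (-1)) * (rh (-1) * (1 + X)) * (pp * PP) * (sg al * rh al * D pp)); last ring.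
rewrite sgN1K rhN1K ppE; ring.
Qed.

Let D_resolvent (a A : fps) (x : R) : A * (a + C x) = 1 -> D A = - (A * A * D a).
Proof.
move=> AE; have := congr1 D AE.
rewrite series_deriv1 series_derivM series_derivD series_deriv_cst addr0 => E.
have : (D A * (a + C x) + A * D a) * A = 0 by rewrite E mul0r.
have -> : (D A * (a + C x) + A * D a) * A = D A * (A * (a + C x)) + A * A * D a by ring.
by rewrite AE mulr1 => /eqP; rewrite addr_eq0 => /eqP.
Qed.

Definition theta : fps := sg (- ((1 + al) / 2)).

Let theta2 : theta * theta = sg (-1) * sg (- al).
Proof. by rewrite /theta -!sgD; congr sg; field. Qed.

(** Bounding n F_n by a coefficient of the derivative D F = t^2 M splits the
    singularity evenly over two square-summable truncations. *)
Let coef_from_deriv (K : R) (t F M : fps) n B : multiplier K M -> D F = t * t * M ->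
  0 <= B -> sqn n t <= B -> `|n.+1%:R * coef F n.+1| <= Num.sqrt K * B.
Proof.
move=> hM DF B0 tB; have [K0 _] := hM.
have := @coef_theta_multiplier _ K t M n hM; rewrite -DF coef_sderiv => h1.
rewrite -[Num.sqrt K * B]ger0_norm ?mulr_ge0// -ler_sqr ?nnegrE// !real_normK ?num_real//.
rewrite [leRHS]exprMn sqr_sqrtr//; apply: le_trans h1 _.
by rewrite ler_wpM2l// lerXn2r ?nnegrE ?sqn_ge0.
Qed.

Let growth K (F : fps) : 0 <= K ->
  (forall n, `|n.+1%:R * coef F n.+1| <= K * (al^-1 * n.+1%:R `^ al)) ->
  forall n, (0 < n)%N -> `|coef F n| <= K * al^-1 * n%:R `^ (al - 1).
Proof.
move=> K0 hF [|n] // _; have n1 : (0 : R) < n.+1%:R by rewrite ltr0n.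
have := hF n; rewrite normrM (ger0_norm (ltW n1)) -ler_pdivlMl// => /le_trans; apply.
rewrite powRB ?(gt_eqF n1) ?implybT// powRr1 ?(ltW n1)//.
by rewrite le_eqVlt; apply/orP; left; apply/eqP; ring.
Qed.

Let a0 : 0 < al. Proof. by case/andP: al01. Qed.

Lemma resolvent_bound : exists K : R, forall (x : R) (A : fps), 0 <= x ->
  A * (sc_w + C x) = 1 -> forall n, (0 < n)%N -> `|coef A n| <= K * n%:R `^ (al - 1).
Proof.
have [KG hG] := wl1_multiplier wl1_G.
have [KP hP] := wl1_multiplier (sc_wl1V sc).
pose K := KG * KP; exists (Num.sqrt K * al^-1) => x A x0 AE.
have hA := accretive_contraction (sc_accretive1 sc) x0 AE.
apply: growth => // n; apply: (@coef_from_deriv _ theta A (- (G * P * (sc_w * A) * (sc_w * A)))).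
- by apply: multiplierN; rewrite -[K]mulr1 -[K * 1]mulr1; do 2 apply: multiplierM => //; exact: multiplierM.
- rewrite (D_resolvent AE) Dw theta2.
  have e : sg (- al) * (P * sc_w) = 1.
    rewrite /sc_w; transitivity ((sg al * sg (- al)) * (p * P)); first ring.
    by rewrite sgNK sc_pVE mulr1.
  transitivity (- (sg (-1) * G * (sg (- al) * (P * sc_w)) * A * A * sc_w)); last ring.
  rewrite e; ring.
- by rewrite mulr_ge0 ?powR_ge0// invr_ge0 ltW.
- exact: sqn_sg_bound.
Qed.

Lemma resolvent0 (x : R) (A : fps) : 0 <= x ->
  A * (sc_w + C x) = 1 -> `|coef A 0| <= (coef p 0)^-1.
Proof.
move=> x0 /(congr1 (fun a => coef a 0)).
rewrite coefM big_ord_recl big_ord0 addr0 coefD coef_cst coef1 eqxx /sc_w.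
rewrite coefM big_ord_recl big_ord0 addr0 subnn coef_sg0 mul1r => E.
have p0 := sc_p_gt0 sc.
have px : 0 < coef p 0 + x by rewrite ltr_wpDr.
have -> : coef A 0 = (coef p 0 + x)^-1 by rewrite -[LHS]mulr1 -(divff (lt0r_neq0 px)) mulrA E mul1r.
by rewrite ger0_norm ?invr_ge0 ?(ltW px)// lef_pV2 ?posrE// lerDl.
Qed.

(** Here the derivative carries the square of 1 / (1 - z^2), so the bound loses
    the decay of the resolvent. *)
Lemma oscillation_bound : exists K : R, forall (x : R) (A : fps), 0 <= x ->
  A * (sc_w + C x) = 1 -> forall n, (0 < n)%N -> `|coef (rh (-1) * A) n| <= K.
Proof.
have [KG hG] := wl1_multiplier wl1_G.
have [KP hP] := wl1_multiplier (sc_wl1V sc).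
have [K1 h1] : exists K : R, multiplier K (sg (1 - al)).
  by apply: wl1_multiplier; apply: wl1_sg; case/andP: al01 => *; apply/andP; split; lra.
have [K2 h2] : exists K : R, multiplier K (1 - X) by exact: wl1_multiplier.
have [K3 h3] : exists K : R, multiplier K (1 + X) by exact: wl1_multiplier.
pose L := K1 * KP * 1; pose K := L * (2 * (K2 + K3 * 1 * KG)).
exists (Num.sqrt K) => x A x0 AE [|n] // _.
have hA := accretive_contraction (sc_accretive1 sc) x0 AE.
pose t : fps := dil (sg (-1)).
pose N := sg (1 - al) * P * (sc_w * A).
have NE : (1 - X) * A = N.
  rewrite /N /sc_w; transitivity (sg (1 - al) * sg al * (p * P) * A); last ring.
  by rewrite -sgD subrK sg1 sc_pVE mulr1.
have hM : multiplier K (- (N * ((1 - X) + (1 + X) * (sc_w * A) * G))).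
  apply: multiplierN; apply: multiplierM.
    by apply: multiplierM => //; apply: multiplierM.
  by apply: multiplierD => //; do 2 apply: multiplierM => //.
have DF : D (rh (-1) * A) = t * t * - (N * ((1 - X) + (1 + X) * (sc_w * A) * G)).
  rewrite series_derivM (D_resolvent AE) Dw deriv_rh rmorphN1 /t dilate_sg -NE.
  transitivity (- (((1 - X) * sg (-1)) * ((1 - X) * sg (-1)) * (rh (-1) * rh (-1) * A)
     + ((1 - X) * sg (-1)) * (rh (-1) * (1 + X)) * (rh (-1) * sg (-1) * A * (sc_w * A) * G))); last ring.
  rewrite sgN1K rhN1K; ring.
have tn : sqn n t <= n.+1%:R.
  apply: le_trans (sqn_dilate2 _ _) _; rewrite /sqn.
  under eq_bigr do rewrite coef_sgN1 expr1n.
  by rewrite sumr_const card_ord.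
have := coef_from_deriv hM DF (ler0n _ _) tn.
by rewrite normrM normr_nat mulrC ler_pM2r// ltr0n.
Qed.

(** By the resolvent identity, the resolvents A for the step and B for the half
    step, both in the variable of the half step, differ by (1 - z)^2 times this
    product. *)
Lemma difference_bound : exists K : R, forall (x : R) (A B : fps), 0 <= x ->
  A * (dil sc_w + C x) = 1 -> B * (C c * sc_w + C x) = 1 ->
  forall n, (0 < n)%N -> `|coef (sg al * q * A * B) n| <= K * n%:R `^ (al - 1).
Proof.
have [KG hG] := wl1_multiplier wl1_G.
have [KGd hGd] := wl1_multiplier wl1_Gd.
have [KP hP] := wl1_multiplier (sc_wl1V sc).
have [KPP hPP] : exists K : R, multiplier K PP.
  by apply/wl1_multiplier/wl1_dilate2; exact: sc_wl1V.
have [Kq hq] := wl1_multiplier wl1_q.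
have [K3 h3] : exists K : R, multiplier K (C al * (1 + X)).
  by apply: wl1_multiplier; apply: wl1M => //; exact: wl1_cst.
have [K4 h4] : exists K : R, multiplier K (1 + X) by exact: wl1_multiplier.
have [KD hD] := wl1_multiplier wl1_Dq.
have [Kc hc] : exists K : R, multiplier K (C c^-1) by apply: wl1_multiplier; exact: wl1_cst.
pose L := 2 * (2 * (2 * (K3 * Kq + KD) + Kq * 1 * KGd) + Kq * 1 * K4 * KG).
pose K := Kc * KP * KPP * 1 * 1 * L.
exists (Num.sqrt K * al^-1) => x A B x0 AE BE.
set a := dil sc_w; set b := C c * sc_w.
have hA : multiplier 1 (a * A) by exact: accretive_contraction (sc_accretive2 sc) x0 AE.
have hB : multiplier 1 (b * B).
  apply: (accretive_contraction _ x0 BE) => n v.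
  have -> : \sum_(k < n.+1) coef v k * coef (b * v) k = c * \sum_(k < n.+1) coef v k * coef (sc_w * v) k.
    rewrite mulr_sumr; apply: eq_bigr => k _; rewrite /b -mulrA coef_cstM; ring.
  by rewrite mulr_ge0 ?powR_ge0//; exact: sc_accretive1.
pose M : fps := C c^-1 * P * PP * (a * A) * (b * B) *
  (- (C al * (1 + X)) * q + (1 - X) * (1 + X) * D q - q * (a * A) * Gd - q * (b * B) * (1 + X) * G).
have hM : multiplier K M.
  apply: multiplierM; first by do 4 apply: multiplierM => //.
  apply: multiplierD; last by apply: multiplierN; do 3 apply: multiplierM => //.
  apply: multiplierD; last by apply: multiplierN; do 2 apply: multiplierM => //.
  by apply: multiplierD => //; apply: multiplierM => //; apply: multiplierN.
pose t : fps := dil theta.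
have t2 : t * t = sg (-1) * sg (- al) * (rh (-1) * rh (- al)).
  by rewrite /t -series_dilateM// theta2 series_dilateM// !dilate_sg; ring.
have DF : D (sg al * q * A * B) = t * t * M.
  have Db : D b = sg (-1) * G * b by rewrite /b series_derivM series_deriv_cst Dw; ring.
  have E (s u v y : fps) : D (s * u * v * y) =
      D s * u * v * y + s * D u * v * y + s * u * D v * y + s * u * v * D y.
    rewrite !series_derivM; ring.
  rewrite E (D_resolvent AE) (D_resolvent BE) -/a -/b Ddw -/a Db deriv_sg t2 /M.
  have ee : sg (- al) * rh (- al) * C c^-1 * P * PP * a * b = sg al.
    rewrite /a /b dilw /sc_w.
    transitivity ((sg al * sg (- al)) * (rh al * rh (- al)) * (C c * C c^-1) * (p * P) * (pp * PP) * sg al); first ring.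
    by rewrite sgNK rhNK -rmorphM divff ?gt_eqF ?powR_gt0// rmorph1 sc_pVE ppE !mul1r.
  transitivity ((sg (- al) * rh (- al) * C c^-1 * P * PP * a * b) * A * B * sg (-1) * rh (-1) *
    (- (C al * (1 + X)) * q + (1 - X) * (1 + X) * D q - q * (a * A) * Gd - q * (b * B) * (1 + X) * G)); last ring.
  rewrite ee.
  transitivity (- C al * sg (-1) * (rh (-1) * (1 + X)) * sg al * A * B * q
    + ((1 - X) * sg (-1)) * (rh (-1) * (1 + X)) * sg al * A * B * D q
    - sg (-1) * rh (-1) * Gd * a * A * A * B * sg al * q
    - sg (-1) * (rh (-1) * (1 + X)) * G * b * A * B * B * sg al * q); last ring.
  rewrite sgN1K rhN1K; ring.
apply: growth => // n; apply: coef_from_deriv hM DF _ _.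
- by rewrite mulr_ge0 ?powR_ge0// invr_ge0 ltW.
- by apply: le_trans (sqn_dilate2 _ _) _; exact: sqn_sg_bound.
Qed.

End scheme.

(** * Comparison of a step with its half, and refinement *)

Section refinement.
Variables (R : realType) (al : R).
Local Notation fps := (powerseries R).
Local Notation X := (series_X R).
Local Notation C := (@series_cst R).
Local Notation dil := (@series_dilate R 2).
Variable sc : scheme al.
Hypothesis al01 : 0 < al < 1.
Hypothesis sums_rh : sums (rh al) (2 `^ al).
Local Notation c := (2 `^ al : R).
Local Notation w := (sc_w sc).

Lemma coef_dilate2_even (F : fps) n : coef F n = coef (dil F) n.*2.
Proof. by rewrite coef_dilate dvdn2 odd_double /= -muln2 mulnK. Qed.

Lemma coef_dilate2_odd (F : fps) n : coef (X * dil F) n.*2 = 0.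
Proof.
case: n => [|n]; rewrite coef_XM// doubleS.
by rewrite coef_dilate dvdn2 /= odd_double.
Qed.

Let c0 : 0 < c. Proof. exact: powR_gt0. Qed.

(** Halving the step divides the symbol by 2^al, so that the resolvent of the
    half step is C c^-1 * A' in the variable where that of the full step is
    dil A. The resolvent identity and the double zero of sc_f do the rest. *)
Let resolvents_half x A A' : A * (w + C x) = 1 -> A' * (w + C (x / c)) = 1 ->
  [/\ dil A * (dil w + C x) = 1, C c^-1 * A' * (C c * w + C x) = 1 &
   dil A - C c^-1 * A' =
   (1 - X) * (1 - X) * (sg al * sc_q sc * dil A * (C c^-1 * A'))].
Proof.
move=> AE AE'.
have E1 : dil A * (dil w + C x) = 1.
  by rewrite -(series_dilate_cst x (ltn0Sn 1)) -series_dilateD -series_dilateM// AE series_dilate1.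
have cc : C c^-1 * C c = 1 by rewrite -rmorphM mulVf ?rmorph1// gt_eqF.
have E2 : C c^-1 * A' * (C c * w + C x) = 1.
  transitivity (C c^-1 * C c * (A' * w) + A' * (C x * C c^-1)); first ring.
  by rewrite cc mul1r -rmorphM -mulrDr.
split=> //; set B := C c^-1 * A'.
transitivity (dil A * B * (C c * w - dil w)).
  transitivity (dil A * (B * (C c * w + C x)) - B * (dil A * (dil w + C x))); last ring.
  by rewrite E1 E2 !mulr1.
have -> : C c * w - dil w = sg al * ((1 - X) * (1 - X) * sc_q sc).
  rewrite /sc_q (_ : -2 = -1 + -1); last ring.
  rewrite sgD; transitivity (sg al * (((1 - X) * sg (-1)) * ((1 - X) * sg (-1)) * sc_f sc)).
    rewrite sgN1K !mul1r /sc_f /sc_w series_dilateM// dilate_sg; ring.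
  ring.
ring.
Qed.

Let rhN1K : rh (-1) * (1 + X) = 1 :> fps.
Proof. by rewrite -rh1 -rhD addNr rh0. Qed.

(** Only coefficients of even order are compared, so whatever is odd in z drops
    out: this absorbs the mismatch between the data z^2 / (1 - z^2)^2 and
    z / (1 - z)^2 of the two grids. *)
Let half_step_linear x A A' n : A * (w + C x) = 1 -> A' * (w + C (x / c)) = 1 ->
  (0 < n)%N ->
  coef (X * sg (-2) * A) n - (2 * c)^-1 * coef (X * sg (-2) * A') n.*2 =
  1 / 2 * coef (sg al * sc_q sc * dil A * (C c^-1 * A')) n.*2.-1.
Proof.
move=> AE AE' n0; have [_ _ DE] := resolvents_half AE AE'.
set S := sg al * _ * _ * _ in DE *; set B := C c^-1 * A' in DE *.
have sg2 : sg (-2) = sg (-1) * sg (-1) :> fps by rewrite -sgD; congr sg; ring.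
have E1 : coef (X * X * sg (-2) * (1 + 1 - X) * dil A) n.*2 = 2 * coef (X * sg (-2) * A) n.
  set F := X * sg (-2) * A.
  have FE : dil F = X * X * (sg (-1) * rh (-1)) * (sg (-1) * rh (-1)) * dil A.
    by rewrite /F !series_dilateM// dilate2X sg2 series_dilateM// dilate_sg; ring.
  have -> : X * X * sg (-2) * (1 + 1 - X) * dil A =
     dil F + dil F + X * dil (F * (1 + 1 + 1 - X)).
    rewrite series_dilateM// series_dilateD.
    have -> : dil (1 + 1 + 1) = 1 + 1 + 1 :> fps by rewrite !series_dilateD series_dilate1.
    have -> : dil (- X) = - (X * X) :> fps.
      by rewrite -dilate2X; apply/seriesP => m; rewrite coefN !coef_dilate; case: ifP; rewrite ?coefN ?oppr0.
    transitivity (dil F * ((1 + X) * (1 + X) * (1 + 1 - X))); last ring.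
    rewrite FE sg2.
    transitivity ((rh (-1) * (1 + X)) * (rh (-1) * (1 + X)) *
       (X * X * (sg (-1) * sg (-1)) * (1 + 1 - X) * dil A)); last ring.
    by rewrite rhN1K !mul1r.
  by rewrite !coefD coef_dilate2_odd addr0 -coef_dilate2_even mulr_natl mulr2n.
have E2 : X * S = X * X * sg (-2) * (1 + 1 - X) * dil A - X * sg (-2) * B + X * dil A.
  transitivity (((1 - X) * sg (-1)) * ((1 - X) * sg (-1)) * (X * S)); first by rewrite sgN1K !mul1r.
  transitivity (X * (sg (-1) * sg (-1)) * (dil A - B)); first by rewrite DE; ring.
  rewrite sg2; transitivity (X * X * (sg (-1) * sg (-1)) * (1 + 1 - X) * dil A - X * (sg (-1) * sg (-1)) * B
     + ((1 - X) * sg (-1)) * ((1 - X) * sg (-1)) * X * dil A); first ring.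
  by rewrite sgN1K; ring.
have -> : coef S n.*2.-1 = coef (X * S) n.*2.
  by rewrite coef_XM; case: (n) n0.
rewrite E2 coefD coef_dilate2_odd addr0 coefB E1.
have -> : X * sg (-2) * B = C c^-1 * (X * sg (-2) * A') by rewrite /B; ring.
rewrite coef_cstM; field; rewrite gt_eqF//.
Qed.

Let half_step_const x A A' n : A * (w + C x) = 1 -> A' * (w + C (x / c)) = 1 ->
  (0 < n)%N ->
  coef (sg (-1) * A) n - c^-1 * coef (sg (-1) * A') n.*2 =
  coef (sg al * sc_q sc * dil A * (C c^-1 * A')) n.*2
  - coef (sg al * sc_q sc * dil A * (C c^-1 * A')) n.*2.-1.
Proof.
move=> AE AE' n0; have [_ _ DE] := resolvents_half AE AE'.
set S := sg al * _ * _ * _ in DE *; set B := C c^-1 * A' in DE *.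
have -> : coef S n.*2.-1 = coef (X * S) n.*2 by rewrite coef_XM; case: (n) n0.
rewrite -coefB.
have -> : S - X * S = sg (-1) * (dil A - B).
  by rewrite DE -mulrA; transitivity (((1 - X) * sg (-1)) * ((1 - X) * S)); [rewrite sgN1K|]; ring.
have -> : coef (sg (-1) * A) n = coef (sg (-1) * dil A) n.*2.
  rewrite coef_dilate2_even.
  have -> : sg (-1) * dil A = dil (sg (-1) * A) + X * dil (sg (-1) * A).
    rewrite series_dilateM// dilate_sg.
    transitivity (rh (-1) * (1 + X) * (sg (-1) * dil A)); first by rewrite rhN1K mul1r.
    ring.
  by rewrite coefD coef_dilate2_odd addr0.
rewrite mulrBr coefB; congr (_ - _).
by rewrite -coef_cstM; congr coef; rewrite /B; ring.
Qed.

Let powR_le1 n : (0 < n)%N -> (n%:R : R) `^ (al - 1) <= 1.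
Proof.
move=> n0; have /andP[a0 a1] := al01; rewrite -[leRHS](powRr0 n%:R).
by apply: (@ler_powR R n%:R); [rewrite ler1n|lra].
Qed.

(** Multiplying the scheme by z^n and summing gives
    (1 + z) / 2 (w + x) W = (1 + z) / 2 F - a / 2, where F is the series of the
    values a + b n tau; the last term cancels the coefficient of order 0, where
    no equation is imposed. Once divided by (1 + z) / 2 it becomes the
    oscillating datum a / (1 + z). *)
Definition numerical (tau a b : R) (A : fps) : fps :=
  C (tau `^ al) * ((C a * (sg (-1) - rh (-1)) + C (b * tau) * X * sg (-2)) * A).

Lemma coef_numerical tau a b A n : coef (numerical tau a b A) n =
  tau `^ al * (a * coef (sg (-1) * A) n - a * coef (rh (-1) * A) n + b * tau * coef (X * sg (-2) * A) n).
Proof.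
rewrite /numerical coef_cstM; congr (_ * _).
rewrite -!coef_cstM -coefB -coefD; congr coef; ring.
Qed.

(** The term in a comes only with tau^al, because the response to the
    oscillating datum does not decay; the term in b has the full order. *)
Lemma half_step_bound : exists2 K : R, 0 <= K & forall (tau x a b : R) (A A' : fps) n,
  0 < tau -> 0 <= x -> A * (w + C x) = 1 -> A' * (w + C (x / c)) = 1 -> (0 < n)%N ->
  `|coef (numerical tau a b A) n - coef (numerical (tau / 2) a b A') n.*2| <=
  K * (`|a| * tau `^ al + `|b| * (tau ^+ 2 * (n%:R * tau) `^ (al - 1))).
Proof.
have /andP[a0 a1] := al01.
have [K1 h1] := difference_bound sc al01 sums_rh.
have [K2 h2] := oscillation_bound sc al01.
pose K := `|K1| + `|K2|; exists (4 * K); first by rewrite mulr_ge0 ?addr_ge0.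
move=> tau x a b A A' n tau0 x0 AE AE' n0.
have [E1 E2 _] := resolvents_half AE AE'.
set S := sg al * sc_q sc * dil A * (C c^-1 * A').
have hS m : (n <= m)%N -> `|coef S m| <= K * n%:R `^ (al - 1).
  move=> nm; have m0 : (0 < m)%N by exact: leq_trans nm.
  apply: le_trans (h1 _ _ _ x0 E1 E2 _ m0) _.
  apply: (@le_trans _ _ (K * m%:R `^ (al - 1))).
    by rewrite ler_wpM2r ?powR_ge0// (le_trans (ler_norm _))// lerDl.
  rewrite ler_wpM2l ?addr_ge0//.
  have e (k : nat) : (k%:R : R) `^ (al - 1) = (k%:R `^ (1 - al))^-1 by rewrite -powRN opprB.
  rewrite !e lef_pV2 ?posrE ?powR_gt0 ?ltr0n//.
  by rewrite ge0_ler_powR ?nnegrE ?ler_nat//; lra.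
have hV (A0 : fps) y : 0 <= y -> A0 * (w + C y) = 1 -> forall m, (0 < m)%N -> `|coef (rh (-1) * A0) m| <= K.
  move=> y0 A0E m m0; apply: le_trans (h2 _ _ y0 A0E _ m0) _.
  by rewrite (le_trans (ler_norm _))// lerDr.
have n2 : (n <= n.*2.-1)%N.
  by move: n0; clear; case: n => // m _; rewrite doubleS /= -addnn; lia.
have n20 : (0 < n.*2)%N by rewrite double_gt0.
have xc : 0 <= x / c by rewrite divr_ge0// ltW.
rewrite !coef_numerical.
have -> : (tau / 2) `^ al = tau `^ al * c^-1.
  rewrite powRM ?ltW ?invr_gt0//; congr (_ * _).
  by rewrite -powR_inv1// -powRrM mulN1r powRN.
set u := coef _ n; set v := coef _ n; set z := coef _ n.
set u' := coef _ _.*2; set v' := coef _ _.*2; set z' := coef _ _.*2.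
have H1 : u - c^-1 * u' = coef S n.*2 - coef S n.*2.-1 by exact: (half_step_const AE AE' n0).
have H2 : z - (2 * c)^-1 * z' = 1 / 2 * coef S n.*2.-1 by exact: (half_step_linear AE AE' n0).
have -> : tau `^ al * (a * u - a * v + b * tau * z) -
   tau `^ al / c * (a * u' - a * v' + b * (tau / 2) * z') =
   tau `^ al * (a * (u - c^-1 * u' - v + c^-1 * v')) + b * tau * tau `^ al * (z - (2 * c)^-1 * z').
  by field; rewrite gt_eqF.
rewrite H1 H2.
have T0 : 0 <= tau `^ al by exact: powR_ge0.
have K0 : 0 <= K by rewrite addr_ge0.
have c1 : c^-1 <= 1.
  rewrite invf_le1//; have := @ler_powR R 2 (ler1n _ 2) _ _ (ltW a0); by rewrite powRr0.
have hS1 m : (n <= m)%N -> `|coef S m| <= K.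
  by move=> nm; apply: le_trans (hS m nm) _; rewrite -[leRHS]mulr1 ler_wpM2l ?powR_le1.
apply: le_trans (ler_normD _ _) _; rewrite [leRHS]mulrDr; apply: lerD.
- rewrite normrM (ger0_norm T0) normrM.
  have -> : 4 * K * (`|a| * tau `^ al) = tau `^ al * (`|a| * (4 * K)) by ring.
  rewrite ler_wpM2l// ler_wpM2l//.
  have B1 : `|coef S n.*2| <= K by apply: hS1; rewrite -addnn leq_addr.
  have B2 : `|coef S n.*2.-1| <= K by apply: hS1.
  have B3 : `|v| <= K by exact: hV AE _ n0.
  have B4 : `|c^-1 * v'| <= K.
    rewrite normrM ger0_norm ?invr_ge0 ?(ltW c0)// -[leRHS]mul1r ler_pM ?invr_ge0 ?(ltW c0)//.
    exact: hV AE' _ n20.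
  move: B1 B2 B3 B4; rewrite !ler_norml => /andP[? ?] /andP[? ?] /andP[? ?] /andP[? ?].
  by apply/andP; split; lra.
- have B2 : `|coef S n.*2.-1| <= K * n%:R `^ (al - 1) by apply: hS.
  rewrite !normrM (ger0_norm T0) (gtr0_norm tau0) normr1 mul1r.
  have -> : tau ^+ 2 * (n%:R * tau) `^ (al - 1) = tau * tau `^ al * n%:R `^ (al - 1).
    rewrite powRM ?(ltW tau0)// [tau `^ (al - 1)]powRB ?(gt_eqF tau0) ?implybT//.
    by rewrite powRr1 ?(ltW tau0)//; field; rewrite gt_eqF.
  apply: (@le_trans _ _ (`|b| * tau * tau `^ al * (`|2^-1| * (K * n%:R `^ (al - 1))))).
    by rewrite ler_wpM2l ?mulr_ge0 ?(ltW tau0)// ler_wpM2l.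
  rewrite ger0_norm ?invr_ge0//; have P0 : 0 <= `|b| * tau * tau `^ al * (K * n%:R `^ (al - 1)).
    by rewrite !mulr_ge0 ?powR_ge0 ?(ltW tau0).
  by move: P0; lra.
Qed.

Definition level (tau : R) j := tau / 2 ^+ j.

Lemma level_powR tau j : 0 <= tau -> level tau j `^ al = tau `^ al * (c^-1) ^+ j.
Proof.
move=> t0; rewrite /level powRM ?invr_ge0 ?exprn_ge0//; congr (_ * _).
rewrite -exprVn -powR_inv1// -powR_mulrn ?powR_ge0// -powRrM mulrC powRrM.
by rewrite -powR_inv1 ?powR_ge0// -!powRrM -powR_mulrn ?powR_ge0// -powRrM; congr (_ `^ _); ring.
Qed.

(** The half-step errors decay geometrically along dyadic refinements, with
    ratios 2^(-al) and 1/4 for the two terms, so their sum is of the size of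
    the first one. *)
Lemma refinement_bound : exists2 K : R, 0 < K & forall (tau lam a b y : R) (A : nat -> fps) n,
  0 < tau -> 0 <= lam -> (0 < n)%N ->
  (forall j, A j * (w + C (lam * level tau j `^ al)) = 1) ->
  (forall e : R, 0 < e -> exists j, `|coef (numerical (level tau j) a b (A j)) (n * 2 ^ j) - y| <= e) ->
  `|coef (numerical tau a b (A 0)) n - y| <=
  K * (`|a| * tau `^ al + `|b| * (tau ^+ 2 * (n%:R * tau) `^ (al - 1))).
Proof.
have [K K0 hK] := half_step_bound.
have /andP[a0 a1] := al01.
have c1 : 1 < c.
  have : 1 `^ al < 2 `^ al :> R by apply: gt0_ltr_powR; rewrite ?nnegrE ?ltr1n.
  by rewrite powR1.
pose r := c^-1; have r0 : 0 < r by rewrite invr_gt0.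
have r1 : r < 1 by rewrite invf_lt1.
pose M := (1 - r)^-1 + 4.
have r1' : 0 < 1 - r by rewrite subr_gt0.
have M0 : 0 < M by rewrite addr_gt0 ?invr_gt0.
exists ((K + 1) * M); first by rewrite mulr_gt0// ltr_wpDl.
move=> tau lam a b y A n tau0 lam0 n0 AE hy.
set t := n%:R * tau; set Q := `|a| * _ + _.
pose W j := coef (numerical (level tau j) a b (A j)) (n * 2 ^ j).
have W0 : coef (numerical tau a b (A 0)) n = W 0 by rewrite /W /level expr0 divr1 muln1.
have ltau j : 0 < level tau j by rewrite divr_gt0// exprn_gt0.
have step j : `|W j - W j.+1| <= K * (`|a| * tau `^ al * r ^+ j + `|b| * (tau ^+ 2 * t `^ (al - 1)) * (4^-1) ^+ j).
  have n2 : (0 < n * 2 ^ j)%N by rewrite muln_gt0 n0 expn_gt0.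
  have lS : level tau j.+1 = level tau j / 2 by rewrite /level exprS invfM; ring.
  have x0 : 0 <= lam * level tau j `^ al by rewrite mulr_ge0 ?powR_ge0.
  have AE' : A j.+1 * (w + C (lam * level tau j `^ al / c)) = 1.
    rewrite -(AE j.+1); congr (_ * (_ + C _)); rewrite !level_powR ?(ltW tau0)// exprS; ring.
  have := hK _ _ a b _ _ _ (ltau j) x0 (AE j) AE' n2.
  rewrite -lS (_ : (n * 2 ^ j).*2 = n * 2 ^ j.+1)%N; last by rewrite expnS mulnCA mul2n.
  move/le_trans; apply; rewrite ler_wpM2l// level_powR ?(ltW tau0)// mulrA lerD2l.
  rewrite (_ : (n * 2 ^ j)%:R * level tau j = t); last first.
    by rewrite natrM natrX /level /t; field; rewrite expf_neq0.
  rewrite -mulrA ler_wpM2l//.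
  have -> : level tau j ^+ 2 = tau ^+ 2 * 4^-1 ^+ j.
    rewrite /level expr_div_n -exprM mulnC exprM; congr (_ * _).
    by rewrite exprVn; congr (_ ^- _); ring.
  by rewrite mulrAC.
have geom (q : R) J : 0 <= q < 1 -> \sum_(j < J) q ^+ j <= (1 - q)^-1.
  move=> /andP[q0 q1]; have q1' : 0 < 1 - q by rewrite subr_gt0.
  rewrite -[leRHS]mul1r ler_pdivlMr// mulrC.
  have -> : (1 - q) * \sum_(j < J) q ^+ j = 1 - q ^+ J by rewrite -[1 - q]opprB mulNr -subrX1 opprB.
  by rewrite gerBl exprn_ge0.
have tele J : `|W 0 - W J| <= K * (M * Q).
  apply: (@le_trans _ _ (\sum_(j < J) `|W j - W j.+1|)).
    have -> : W 0 - W J = \sum_(j < J) (W j - W j.+1).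
      elim: J => [|J IH]; first by rewrite big_ord0 subrr.
      by rewrite big_ord_recr /= -IH; ring.
    exact: ler_norm_sum.
  apply: le_trans (ler_sum _ _) _; first by move=> j _; exact: step.
  rewrite -mulr_sumr ler_wpM2l// big_split /= -!mulr_sumr.
  set P1 := `|a| * _; set P2 := `|b| * _.
  have P10 : 0 <= P1 by rewrite mulr_ge0 ?powR_ge0.
  have P20 : 0 <= P2 by rewrite mulr_ge0// mulr_ge0 ?sqr_ge0 ?powR_ge0.
  have g1 := @geom r J; have g2 := @geom 4^-1 J.
  have {}g1 : \sum_(j < J) r ^+ j <= M.
    by apply: le_trans (g1 _) _; [rewrite ltW|rewrite /M lerDl].
  have {}g2 : \sum_(j < J) 4^-1 ^+ j <= M.
    apply: le_trans (g2 _) _; first by rewrite invr_ge0 ler0n /= invf_lt1 ?ltr1n.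
    have : 0 <= (1 - r)^-1 by rewrite invr_ge0 ltW.
    have -> : (1 - 4^-1)^-1 = 4 / 3 :> R by field.
    by rewrite /M; lra.
  by rewrite /Q -/P1 -/P2 mulrDr ![M * _]mulrC lerD// ler_wpM2l.
have Q0 : 0 <= Q.
  apply: addr_ge0; first by rewrite mulr_ge0 ?powR_ge0.
  by rewrite mulr_ge0// mulr_ge0 ?sqr_ge0 ?powR_ge0.
apply/ler_addgt0Pr => e e0; have [J hJ] := hy e e0.
rewrite W0 -(subrKA (W J)) (le_trans (ler_normD _ _))// lerD//.
apply: le_trans (tele J) _; rewrite mulrA ler_wpM2r// ler_wpM2r ?(ltW M0)//.
by rewrite lerDl.
Qed.

End refinement.

(** * Values of power series *)

Section evaluation.
Variable R : realType.
Local Notation fps := (powerseries R).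
Local Notation X := (series_X R).
Local Notation C := (@series_cst R).
Implicit Types a b : fps.

Definition evals a (z v : R) := sums (series_scale z a) v.

Lemma evalsD a b z u v : evals a z u -> evals b z v -> evals (a + b) z (u + v).
Proof. by move=> ha hb; rewrite /evals series_scaleD; exact: sumsD. Qed.

Lemma evalsM a b z u v : evals a z u -> evals b z v -> evals (a * b) z (u * v).
Proof. by move=> ha hb; rewrite /evals series_scaleM; exact: sumsM. Qed.

Lemma evals_cst c z : evals (C c) z c.
Proof.
rewrite /evals; have -> : series_scale z (C c) = C c; last exact: sums_cst.
by apply/seriesP => n; rewrite coef_scale coef_cst; case: n => [|n]; rewrite ?mul1r//= mulr0.
Qed.

Lemma scaleX z : series_scale z X = C z * X.
Proof.
apply/seriesP => n; rewrite coef_cstM coef_scale coef_X.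
by case: n => [|[|n]]; rewrite ?mulr0.
Qed.

Lemma evalsX z : evals X z z.
Proof.
rewrite /evals scaleX -[X in sums _ X]mulr1.
by apply: sumsM; [exact: sums_cst|exact: sumsX].
Qed.

Lemma evals_unique a z u v : evals a z u -> evals a z v -> u = v.
Proof. exact: sums_unique. Qed.

Lemma evals_scale a (c z v : R) : evals a (c * z) v -> evals (series_scale c a) z v.
Proof.
rewrite /evals; congr (sums _ _); apply/seriesP => n.
by rewrite !coef_scale exprMn mulrA [c ^+ n * _]mulrC.
Qed.

Lemma wl1_geometric a (M z : R) : (forall n, `|coef a n| <= M) -> `|z| < 1 ->
  wl1 0 (series_scale z a).
Proof.
move=> aM z1; have z1' : 0 < 1 - `|z| by rewrite subr_gt0.
have M0 : 0 <= M by apply: le_trans (aM 0).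
exists (M * (1 - `|z|)^-1) => n.
apply: (@le_trans _ _ (M * \sum_(k < n.+1) `|z| ^+ k)).
  rewrite mulr_sumr; apply: ler_sum => k _.
  by rewrite coef_wabs expr0 mul1r coef_scale normrM normrX mulrC ler_wpM2r ?exprn_ge0.
rewrite ler_wpM2l// -[leRHS]mul1r ler_pdivlMr// mulrC.
have -> : (1 - `|z|) * \sum_(k < n.+1) `|z| ^+ k = 1 - `|z| ^+ n.+1.
  by rewrite -[1 - `|z|]opprB mulNr -subrX1 opprB.
by rewrite gerBl exprn_ge0.
Qed.

Lemma pseries_psum a z n : pseries (coef a) z n.+1 = coef (sg (-1) * series_scale z a) n.
Proof.
rewrite coef_psum /pseries /= /series /= big_mkord; apply: eq_bigr => k _.
by rewrite coef_scale mulrC.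
Qed.

Lemma sums_cvg a v : null (fun n => coef (sg (-1) * a) n - v) <->
  coef (sg (-1) * a) @ \oo --> v.
Proof.
split=> [h|/cvgrPdist_le h e e0].
  apply/cvgrPdist_le => e e0; have [N hN] := h e e0.
  by exists N => // n /hN; rewrite distrC.
by have [N _ hN] := h e e0; exists N => n /hN /=; rewrite distrC.
Qed.

Lemma evals_pseries a z v : evals a z v -> pseries (coef a) z @ \oo --> v.
Proof.
move=> [_ /sums_cvg h]; rewrite -cvg_shiftS.
by under eq_fun do rewrite pseries_psum.
Qed.

Lemma pseries_evals a z v : wl1 0 (series_scale z a) ->
  pseries (coef a) z @ \oo --> v -> evals a z v.
Proof.
move=> la h; split=> //; apply/sums_cvg; move: h; rewrite -cvg_shiftS.
by under eq_fun do rewrite pseries_psum.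
Qed.

Lemma wl1_of_cvg a : cvgn (series (fun k => `|coef a k|)) -> wl1 0 a.
Proof.
move=> h; exists (limn (series (fun k => `|coef a k|))) => n.
have -> : \sum_(k < n.+1) coef (wabs 0 a) k = series (fun k => `|coef a k|) n.+1.
  rewrite /series /= big_mkord; apply: eq_bigr => k _.
  by rewrite coef_wabs expr0 mul1r.
apply: nondecreasing_cvgn_le => //; apply/nondecreasing_seqP => m.
by rewrite /series /= big_nat_recr//= lerDl.
Qed.

Lemma cvg_of_wl1 a : wl1 0 a -> exists v, sums a v.
Proof.
move=> la; have [M hM] := la.
have cv : cvgn (series (coef a)).
  apply: normed_cvg; rewrite /normed_series_of /=; apply: nondecreasing_is_cvgn.
    by apply/nondecreasing_seqP => n; rewrite /series /= big_nat_recr//= lerDl.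
  exists M => _ [n _ <-]; apply: (@le_trans _ _ (series (fun k => `|coef a k|) n.+1)).
    by rewrite /series /= big_nat_recr//= lerDl.
  rewrite /series /= big_mkord; apply: le_trans (hM n); apply: ler_sum => k _.
  by rewrite coef_wabs expr0 mul1r.
exists (limn (series (coef a))); split=> //; apply/sums_cvg.
have E : coef (sg (-1) * a) = (fun n => series (coef a) n.+1).
  by apply/funext => n; rewrite coef_psum /series /= big_mkord.
by rewrite E (cvg_shiftS (series (coef a))).
Qed.

(** Removing the factor z from a series with a(0) = 0 leaves one that still
    vanishes for z different from 0, so it is enough to see that the constant
    coefficient vanishes; it is z times a bounded quantity. *)
Lemma series_unique a : (forall z, 0 < `|z| < 1 -> evals a z 0) -> a = 0.
Proof.
have key b : (forall z, 0 < `|z| < 1 -> evals b z 0) ->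
    coef b 0 = 0 /\ (forall z, 0 < `|z| < 1 -> evals (Series (fun n => coef b n.+1)) z 0).
  move=> hb; pose b' := Series (fun n => coef b n.+1).
  have bE : b = C (coef b 0) + X * b'.
    by apply/seriesP => -[|n]; rewrite coefD coef_cst coef_XM ?addr0// add0r.
  have lb z : 0 < `|z| < 1 -> wl1 0 (series_scale z b').
    move=> hz; have [z0 _] := andP hz; have [lz _] := hb z hz.
    have [M hM] := lz; exists (M / `|z|) => n.
    rewrite ler_pdivlMr// mulr_suml; apply: le_trans (hM n.+1).
    rewrite [leRHS]big_ord_recl ler_wpDl ?coef_wabs_ge0//; apply: ler_sum => k _.
    by rewrite !coef_wabs !expr0 !mul1r !coef_scale lift0 exprSr !normrM mulrAC.
  have ev z : 0 < `|z| < 1 -> exists2 v, evals b' z v & coef b 0 + z * v = 0.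
    move=> hz; have [v hv] := cvg_of_wl1 (lb z hz); exists v => //.
    apply: (@evals_unique b z); last exact: hb.
    by rewrite {1}bE; apply: evalsD; [exact: evals_cst|apply: evalsM => //; exact: evalsX].
  have h2 : 0 < `|2^-1 : R| < 1 by rewrite ger0_norm ?invr_ge0// invr_gt0 ltr0n/= invf_lt1 ?ltr1n.
  have [M M0 hM] := wl1_bound (lb _ h2).
  have b0 : coef b 0 = 0.
    apply/eqP; rewrite -normr_eq0 eq_le normr_ge0 andbT; apply/ler_addgt0Pr => e e0.
    rewrite add0r; pose z := Num.min (2^-1) (e / (M + 1)).
    have M1 : 0 < M + 1 by rewrite ltr_wpDl.
    have z0 : 0 < z by rewrite lt_min invr_gt0 ltr0n divr_gt0.
    have z2 : z <= 2^-1 by rewrite ge_min lexx.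
    have zn : 0 < `|z| < 1.
      rewrite gtr0_norm// z0 (le_lt_trans z2)// invf_lt1 ?ltr1n//.
    have [v hv vE] := ev z zn.
    have vM : `|v| <= M.
      apply/ler_addgt0Pr => d d0; have [_ hv2] := hv; have [N hN] := hv2 d d0.
      have := hN N (leqnn N); set s := coef _ _ => hs.
      have : `|s| <= M.
        rewrite /s coef_psum (le_trans (ler_norm_sum _ _ _))//.
        apply: le_trans (hM N); apply: ler_sum => k _.
        rewrite coef_wabs expr0 mul1r !coef_scale !normrM ler_wpM2r// !normrX.
        by rewrite lerXn2r ?nnegrE// (gtr0_norm z0) ger0_norm ?invr_ge0.
      move=> h; rewrite -(subrK s v) (le_trans (ler_normD _ _))// distrC addrC lerD//.
    have -> : coef b 0 = - (z * v) by apply/eqP; rewrite -addr_eq0 vE.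
    rewrite normrN normrM gtr0_norm//; apply: (@le_trans _ _ (e / (M + 1) * (M + 1))).
      by rewrite ler_pM ?(ltW z0)// ?ge_min ?lexx ?orbT// (le_trans vM)// lerDl.
    by rewrite divfK// gt_eqF.
  split=> // z hz; have [v hv] := ev z hz; rewrite b0 add0r => /eqP.
  by have /andP[z0 _] := hz; rewrite mulf_eq0 -normr_eq0 gt_eqF//= => /eqP <-.
move=> ha; apply/seriesP => n; rewrite coef0.
have : forall z, 0 < `|z| < 1 -> evals (Series (fun k => coef a (n + k)%N)) z 0.
  elim: n => [|n IH]; first by case: a ha.
  have [_] := key _ IH; congr (forall z, _).
  apply/funext => z; congr (_ -> evals (Series _) z 0); apply/funext => k.
  by rewrite [LHS]/coef -addSnnS.
by move=> /key[+ _]; rewrite /coef addn0.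
Qed.

(** Abel's limit theorem, for functions F that are Lipschitz at 1 from the
    left; absolute summability makes it elementary. *)
Lemma sums_abel a v (F : R -> R) (K : R) : sums a v ->
  (forall z, 0 < z < 1 -> evals a z (F z)) ->
  (forall z, 0 < z < 1 -> `|F 1 - F z| <= K * (1 - z)) -> v = F 1.
Proof.
move=> [la hv] hF hK.
have [M M0 hM] := wl1_bound la.
have key e : 0 < e -> exists2 L : R, 0 <= L & forall z, 0 < z < 1 -> `|v - F 1| <= L * (1 - z) + e.
  move=> e0; have e3 : 0 < e / 3 by rewrite divr_gt0.
  have [N hN] := wl1_tail la e3.
  exists (N%:R * M + `|K|) => [|z hz]; first by rewrite addr_ge0// mulr_ge0.
  have [z0 z1] := andP hz; have z1' : 0 <= 1 - z by rewrite subr_ge0 ltW.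
  have [_ hz2] := hF z hz.
  have [n1 hn1] := hv _ e3; have [n2 hn2] := hz2 _ e3.
  pose n := (N + (n1 + n2))%N.
  have {hn1} B1 := hn1 n (leq_trans (leq_addr _ _) (leq_addl _ _)).
  have {hn2} B2 := hn2 n (leq_trans (leq_addl _ _) (leq_addl _ _)).
  set s1 := coef _ n in B1; set s2 := coef _ n in B2.
  have B3 : `|s1 - s2| <= N%:R * M * (1 - z) + e / 3.
    rewrite /s1 /s2 !coef_psum -sumrB.
    apply: (le_trans (ler_norm_sum _ _ _)).
    have E k : `|coef a k - coef (series_scale z a) k| = `|coef a k| * (1 - z ^+ k).
      have zk : 0 <= 1 - z ^+ k by rewrite subr_ge0 exprn_ile1// ltW.
      by rewrite coef_scale -[X in X - _]mul1r -mulrBl normrM mulrC (ger0_norm zk).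
    under eq_bigr do rewrite E.
    rewrite -(big_mkord xpredT (fun k => `|coef a k| * (1 - z ^+ k))).
    rewrite (big_cat_nat (n := N))//=; last by rewrite /n; lia.
    apply: lerD; last first.
      apply: le_trans (hN N n.+1 (leqnn _) _); last by rewrite /n; lia.
      by apply: ler_sum => k _; rewrite ler_piMr// gerBl exprn_ge0// ltW.
    rewrite -mulrA mulrCA mulrC; apply: (@le_trans _ _ (\sum_(0 <= k < N) `|coef a k| * (N%:R * (1 - z)))).
      rewrite big_nat_cond [leRHS]big_nat_cond; apply: ler_sum => k.
      rewrite andbT => /andP[_ kN]; rewrite ler_wpM2l//.
      rewrite -[1 - z ^+ k]opprB subrX1 -mulNr opprB mulrC ler_wpM2r//.
      apply: (@le_trans _ _ (\sum_(i < k) 1)); last by rewrite sumr_const card_ord ler_nat ltnW.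
      by apply: ler_sum => i _; rewrite exprn_ile1// ltW.
    rewrite -mulr_suml [leRHS]mulrC; apply: ler_wpM2r; first by rewrite mulr_ge0.
    apply: le_trans (hM N).
    rewrite big_mkord [leRHS]big_ord_recr ler_wpDr ?coef_wabs_ge0//=.
    by apply: ler_sum => k _; rewrite coef_wabs expr0 mul1r.
  have B4 : `|F 1 - F z| <= `|K| * (1 - z).
    by apply: le_trans (hK z hz) _; rewrite ler_wpM2r// ler_norm.
  move: B1 B2 B3 B4; rewrite !ler_norml => /andP[? ?] /andP[? ?] /andP[? ?] /andP[? ?].
  apply/andP; split; lra.
apply/eqP; rewrite -subr_eq0 -normr_eq0 eq_le normr_ge0 andbT; apply/ler_addgt0Pr => e e0.
have e2 : 0 < e / 2 by rewrite divr_gt0.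
have [L L0 hL] := key _ e2; have L1 : 0 < L + 1 by rewrite ltr_wpDl.
pose d := Num.min (2^-1) (e / 2 / (L + 1)).
have d0 : 0 < d by rewrite lt_min invr_gt0 ltr0n divr_gt0.
have d2 : d <= 2^-1 by rewrite ge_min lexx.
have h2 : (2^-1 : R) < 1 by rewrite invf_lt1 ?ltr1n.
have hz : 0 < 1 - d < 1 by apply/andP; split; lra.
rewrite add0r; have := hL _ hz; have -> : 1 - (1 - d) = d by ring.
move/le_trans; apply; rewrite [leRHS](splitr e) lerD2r.
apply: (@le_trans _ _ ((L + 1) * (e / 2 / (L + 1)))); last by rewrite mulrC divfK// gt_eqF.
by rewrite ler_pM// ?(ltW d0)// ?lerDl// ge_min lexx orbT.
Qed.

End evaluation.

Section binomial_function.
Variables (R : realType) (al : R).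
Local Notation fps := (powerseries R).
Local Notation X := (series_X R).
Local Notation C := (@series_cst R).
Hypothesis al01 : 0 < al < 1.

Let al0 : 0 <= al <= 1. Proof. by case/andP: al01 => *; apply/andP; split; lra. Qed.

Let coef_le1 n : `|coef (sg (al - 1)) n| <= 1.
Proof.
have /andP[a0 a1] := al01.
rewrite ger0_norm ?coef_sg_ge0//; last by lra.
apply: le_trans (coef_sg_bound n al01) _; rewrite powRN invf_le1 ?powR_gt0//.
have : 1 `^ al <= n.+1%:R `^ al :> R by rewrite ge0_ler_powR ?nnegrE ?ler1n// ltW.
by rewrite powR1.
Qed.

Let cvg_scale (a : fps) K : wl1 0 (series_scale K a) -> cvgn (pseries (coef a) K).
Proof.
move=> /cvg_of_wl1[v hv]; apply/cvg_ex; exists v; exact: evals_pseries.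
Qed.

Let constant_on_unit_interval (h : R -> R) : (forall x, `|x| < 1 -> is_derive x (1 : R) h 0) ->
  forall z, `|z| < 1 -> h z = h 0.
Proof.
move=> dh.
have key (a b : R) : a <= b -> -1 < a -> b < 1 -> h b = h a.
  move=> ab a1 b1.
  have d (x : R) : x \in `[a, b]%R -> is_derive x (1 : R) h 0.
    rewrite in_itv /= => /andP[ax xb]; apply: dh; rewrite ltr_norml.
    by rewrite (lt_le_trans a1 ax) (le_lt_trans xb b1).
  have cont : {within `[a, b], continuous h}.
    by apply: derivable_within_continuous => x xab; have [] := d x xab.
  have doo (x : R) : x \in `]a, b[%R -> is_derive x (1 : R) h ((fun=> 0) x).
    by move=> xab; apply: d; exact: subset_itv_oo_cc.
  have [c _ ] := MVT_segment ab doo cont.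
  by rewrite mul0r => /eqP; rewrite subr_eq0 => /eqP.
move=> z; rewrite ltr_norml => /andP[z1 z2]; case: (leP 0 z) => z0.
  by apply: key => //; lra.
by apply/esym/key => //; lra.
Qed.

(** The sum phi of the series satisfies (1 - z) phi' = - al phi, so
    phi(z) (1 - z)^(-al) is constant. *)
Lemma binomial_evals z : `|z| < 1 -> evals (sg al) z ((1 - z) `^ al).
Proof.
have /andP[a0 a1] := al01.
pose phi x := limn (pseries (coef (sg al)) x).
have lw : wl1 0 (sg al) by exact: wl1_sg.
have ev x : `|x| < 1 -> evals (sg al) x (phi x).
  move=> x1; have lx := wl1_scale (ltW x1) lw.
  by apply: pseries_evals => //; exact: cvg_scale.
have lw1 x : `|x| < 1 -> wl1 0 (series_scale x (sg (al - 1))).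
  by apply: wl1_geometric; exact: coef_le1.
have lN1 (x : R) : `|x| < 1 -> wl1 0 (series_scale x (sg (-1))).
  by apply: (@wl1_geometric _ _ 1) => n; rewrite coef_sgN1 normr1.
pose dphi x := - al * phi x / (1 - x).
have DE : series_deriv (sg al) = - C al * sg (al - 1).
  by rewrite deriv_sg -[al - 1]addrC sgD; ring.
have DDE : series_deriv (series_deriv (sg al)) = C (- al * (1 - al)) * (sg (-1) * sg (al - 1)).
  rewrite DE -rmorphN series_derivM series_deriv_cst mul0r add0r deriv_sg rmorphM -[1 - al]opprB rmorphN; ring.
have der x : `|x| < 1 -> is_derive x (1 : R) phi (dphi x).
  move=> x1; pose K := (1 + `|x|) / 2.
  have nx : 0 <= `|x| by exact: normr_ge0.
  have K0 : 0 < K by rewrite /K; lra.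
  have xK : `|x| < `|K| by rewrite (gtr0_norm K0) /K; lra.
  have K1 : `|K| < 1 by rewrite (gtr0_norm K0) /K; lra.
  have dE : dphi x = limn (pseries (pseries_diffs (coef (sg al))) x).
    have e1 : evals (series_deriv (sg al)) x (dphi x).
      have ld : wl1 0 (series_scale x (series_deriv (sg al))).
        rewrite DE -rmorphN series_scaleM; apply: wl1M; last exact: lw1.
        by case: (evals_cst (- al) x).
      have [v hv] := cvg_of_wl1 ld.
      suff : dphi x = v by move=> ->.
      have x1' : 1 - x != 0 by rewrite subr_eq0 gt_eqF// (le_lt_trans (ler_norm _)).
      apply: (mulfI x1'); rewrite /dphi mulrC divfK//.
      apply: (@evals_unique _ ((1 - X) * series_deriv (sg al)) x).
        rewrite X1_deriv_sg mulNr.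
        have -> : - (C al * sg al) = C (- al) * sg al by rewrite rmorphN mulNr.
        by rewrite -mulNr; apply: evalsM; [exact: evals_cst|exact: ev].
      apply: evalsM => //; rewrite /evals; have -> : 1 - X = C 1 + C (-1) * X by rewrite rmorphN1 rmorph1 mulN1r.
      rewrite -/(evals _ _ _) -[- x]mulN1r; apply: evalsD; first exact: evals_cst.
      by apply: evalsM; [exact: evals_cst|exact: evalsX].
    by apply/esym/cvg_lim => //; exact: (evals_pseries e1).
  rewrite dE; apply: (@pseries_snd_diffs _ _ K) => //.
  - by apply: cvg_scale; apply: wl1_scale => //; exact: ltW.
  - apply: (@cvg_scale (series_deriv (sg al))); rewrite DE -rmorphN series_scaleM; apply: wl1M; last exact: lw1.
    by case: (evals_cst (- al) K).
  - apply: (@cvg_scale (series_deriv (series_deriv (sg al)))); rewrite DDE series_scaleM.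
    apply: wl1M; first by case: (evals_cst (- al * (1 - al)) K).
    by rewrite series_scaleM; apply: wl1M; [exact: lN1|exact: lw1].
pose h x := phi x * (1 - x) `^ (- al).
have derh x : `|x| < 1 -> is_derive x (1 : R) h 0.
  move=> x1; have x1' : 0 < 1 - x by rewrite subr_gt0 (le_lt_trans (ler_norm _)).
  have d1 := der x x1.
  have d2 : is_derive x (1 : R) (fun y : R => (1 - y) `^ (- al)) (al * (1 - x) `^ (- al - 1)).
    have d3 : is_derive x (1 : R) (fun y : R => 1 - y) (-1).
      apply: is_derive_eq.
      by rewrite add0r mul1r.
    have d4 := is_derive1_powR (- al) x1'.
    have d5 := is_derive1_comp (f := fun y => y `^ (- al)) (g := fun y : R => 1 - y) d4 d3.
    by have -> : al * (1 - x) `^ (- al - 1) = - al * (1 - x) `^ (- al - 1) * -1 by rewrite mulrN1 mulNr opprK.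
  have d3 := is_deriveM d1 d2; set u := _ + _ in d3.
  have -> : 0 = u.
    rewrite /u /dphi.
    rewrite powRB ?(gt_eqF x1') ?implybT// powRr1 ?(ltW x1')// /GRing.scale /=.
    by field; rewrite gt_eqF.
  exact: d3.
have h0 : h 0 = 1.
  rewrite /h subr0 powR1 mulr1; apply: (@evals_unique _ (sg al) 0); first by apply: ev; rewrite normr0.
  rewrite /evals; have -> : series_scale 0 (sg al) = 1; last exact: sums1.
  by apply/seriesP => n; rewrite coef_scale coef1 expr0n; case: n => [|n]; rewrite ?coef_sg0 ?mulr1// mul0r.
move=> z1; have hz : h z = 1 by rewrite (constant_on_unit_interval derh).
have z1' : 0 < 1 - z by rewrite subr_gt0 (le_lt_trans (ler_norm _)).
have <- : phi z = (1 - z) `^ al; last exact: ev.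
by move: hz; rewrite /h powRN => /divr1_eq.
Qed.

End binomial_function.

(** * The two generating functions *)

Section instances.
Variables (R : realType) (al : R).
Local Notation fps := (powerseries R).
Local Notation X := (series_X R).
Local Notation C := (@series_cst R).
Local Notation D := (@series_deriv R).
Hypotheses (a0 : 0 < al) (a1 : al < 1).

Let al01 : 0 < al < 1. Proof. by rewrite a0. Qed.
Let al0 : 0 <= al <= 1. Proof. by rewrite !ltW. Qed.

Lemma series_scale_cst (c b : R) : series_scale c (C b) = C b.
Proof.
apply/seriesP => n; rewrite coef_scale coef_cst.
by case: n => [|n]; rewrite ?mul1r//= mulr0.
Qed.

(** The value of (1 + z)^al at the end point z = 1, from the values inside the
    disc. *)
Lemma sums_rh : sums (rh al) (2 `^ al).
Proof.
have A0 := a0; have A1 := a1.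
have [v hv] := cvg_of_wl1 (wl1_rh (wl1_sg al0)).
have -> : 2 `^ al = (fun z => (1 + z) `^ al) 1 by congr (_ `^ _).
rewrite -(@sums_abel _ _ v (fun z => (1 + z) `^ al) 1 hv)// => z /andP[z0 z1].
  apply: evals_scale; rewrite mulN1r -[1 + z]/(1 + z) -[in 1 + z](opprK z).
  by apply: binomial_evals => //; rewrite normrN gtr0_norm.
have y0 : 0 < 1 + z by rewrite addr_gt0.
have := powR_le_tangent_at al01 (ler0n R 2) y0.
have le : (1 + z) `^ al <= 2 `^ al.
  by rewrite ge0_ler_powR ?nnegrE ?(ltW a0) ?(ltW y0)//; lra.
rewrite ger0_norm ?subr_ge0// => h; rewrite lerBlDl (le_trans h)// lerD2l mul1r.
have -> : 2 - (1 + z) = 1 - z by ring.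
rewrite ler_piMl ?subr_ge0 ?(ltW z1)//.
apply: (@le_trans _ _ (1 * 1)); last by rewrite mulr1.
rewrite ler_pM ?powR_ge0 ?(ltW a0) ?(ltW a1)//.
rewrite -opprB powRN invf_le1 ?powR_gt0//.
have : (1 : R) `^ (1 - al) <= (1 + z) `^ (1 - al).
  by rewrite ge0_ler_powR ?nnegrE ?subr_ge0 ?(ltW a1) ?(ltW y0)// lerDl ltW.
by rewrite powR1.
Qed.

Lemma sums_sg : sums (sg al) 0.
Proof.
have A0 := a0; have A1 := a1.
split; first exact: wl1_sg.
move=> e e0; exists (Num.truncn (e^-1 `^ al^-1)) => n hn.
rewrite subr0 -sgD addrC; have c0 : 0 <= coef (sg (al - 1)) n by apply: coef_sg_ge0; lra.
rewrite ger0_norm// (le_trans (coef_sg_bound _ al01))// powRN -[leRHS]invrK lef_pV2 ?posrE ?powR_gt0 ?invr_gt0//.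
have h : e^-1 `^ al^-1 <= n.+1%:R.
  apply: ltW; apply: lt_le_trans (truncnS_gt _) _; by rewrite ler_nat ltnS.
have -> : e^-1 = (e^-1 `^ al^-1) `^ al by rewrite -powRrM mulVf ?gt_eqF// powRr1// invr_ge0 ltW.
by rewrite ge0_ler_powR ?nnegrE ?powR_ge0 ?(ltW a0).
Qed.

(** Beyond n the partial sums decrease, and their limit is 0. *)
Lemma psum_ge0_of_tail (a : fps) n : sums a 0 -> (forall k, (n < k)%N -> coef a k <= 0) ->
  0 <= \sum_(k < n.+1) coef a k.
Proof.
have A0 := a0; have A1 := a1.
move=> [_ ha] hk; apply/ler_addgt0Pr => e e0; have [N hN] := ha e e0.
have := hN (n + N)%N (leq_addl _ _); rewrite subr0 coef_psum ler_norml => /andP[h _].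
rewrite -(big_mkord xpredT) in h; rewrite -(big_mkord xpredT).
rewrite (big_cat_nat (n := n.+1))//= in h; last by lia.
have : \sum_(n.+1 <= i < (n + N).+1) coef a i <= 0.
  rewrite big_nat_cond; apply: sumr_le0 => i; rewrite andbT => /andP[ni _]; exact: hk.
by move: h; lra.
Qed.

Lemma dilate1 (a : fps) : series_dilate 1 a = a.
Proof. by apply/seriesP => n; rewrite coef_dilate dvd1n divn1. Qed.

Lemma accretive12 (w : fps) : sums w 0 -> (forall k, (4 <= k)%N -> coef w k <= 0) ->
  4 * Num.max (coef w 2) 0 + 9 * Num.max (coef w 3) 0 <= - coef w 1 ->
  accretive w /\ accretive (series_dilate 2 w).
Proof.
move=> w0 w4 w3; have h n : (3 <= n)%N -> 0 <= \sum_(k < n.+1) coef w k.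
  by move=> n3; apply: psum_ge0_of_tail => // k nk; apply: w4; lia.
by split; [rewrite -[w]dilate1|]; apply: toeplitz_accretive.
Qed.

Lemma sums_sg_mul (p : fps) : sums p 1 -> sums (sg al * p) 0.
Proof. by move=> hp; rewrite -[X in sums _ X](mul0r 1); apply: sumsM hp; exact: sums_sg. Qed.

(** The factor 3^(-n) beats the weight (n + 1)^2 <= 4 * 2^n. *)
Lemma wl1_third j (a : fps) (M : R) : (j <= 2)%N -> (forall n, `|coef a n| <= M) ->
  wl1 j (series_scale 3^-1 a).
Proof.
move=> j2 hM; apply: (@wl1_mono _ _ 2) => //.
have M0 : 0 <= M by apply: le_trans (hM 0).
have sq n : (n.+1 ^ 2 <= 4 * 2 ^ n)%N.
  elim: n => // -[|[|n]] //; move=> IH; rewrite expnS.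
  have : (n.+4 ^ 2 <= 2 * n.+3 ^ 2)%N by rewrite -!mulnn; nia.
  by rewrite expn1 mulnn [(2 ^ n.+3)%N]expnS => h; move: IH h; nia.
have l23 : `|2 / 3 : R| < 1 by rewrite ger0_norm ?divr_ge0// ltr_pdivrMr// mul1r ltr_nat.
have [L hL] := @wl1_geometric R (sg (-1)) 1 _ (fun n => ltac:(by rewrite coef_sgN1 normr1)) l23.
exists (4 * M * L) => n.
have L0 : 0 <= 4 * M by rewrite mulr_ge0.
apply: le_trans (ler_wpM2l L0 (hL n)); rewrite mulr_sumr; apply: ler_sum => k _.
rewrite !coef_wabs !coef_scale expr0 mul1r coef_sgN1 mulr1 !normrM !normrX.
rewrite [`|2 / 3|]ger0_norm ?divr_ge0// [`|3^-1|]ger0_norm ?invr_ge0// exprMn.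
apply: (@le_trans _ _ (4 * 2 ^+ k * (3^-1 ^+ k * M))); last by rewrite le_eqVlt; apply/orP; left; apply/eqP; ring.
apply: ler_pM => //; rewrite ?exprn_ge0 ?mulr_ge0 ?exprn_ge0 ?invr_ge0//.
- by rewrite -!natrX -natrM ler_nat.
- by rewrite ler_wpM2l ?exprn_ge0 ?invr_ge0.
Qed.

(** ** Fractional BDF-2 *)

Let k0 : R := (3 / 2) `^ al.
Let k0_gt0 : 0 < k0. Proof. exact: powR_gt0. Qed.

(** 3/2 - 2 z + z^2 / 2 = (1 - z) (3/2) (1 - z / 3), so p is regular up to the
    circle of radius 3. *)
Definition bdf_p : fps := C k0 * series_scale 3^-1 (sg al).
Definition bdf_pV : fps := C k0^-1 * series_scale 3^-1 (sg (- al)).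

Let coef_sg_le1 (g : R) n : -1 <= g <= 1 -> `|coef (sg g) n| <= 1.
Proof.
have A0 := a0; have A1 := a1.
move=> /andP[g1 g2]; elim: n => [|n IH]; first by rewrite coef_sg0 normr1.
rewrite coef_sgS normrM -[leRHS]mulr1 ler_pM// normrM normfV normr_nat ler_pdivrMr// mul1r.
by rewrite -natr1 ler_norml; have := ler0n R n; move=> ?; apply/andP; split; lra.
Qed.

Let third1 : `|3^-1 : R| < 1.
Proof. by rewrite ger0_norm ?invr_ge0// invf_lt1 ?ltr1n. Qed.

Lemma bdf_pVE : bdf_p * bdf_pV = 1.
Proof.
rewrite /bdf_p /bdf_pV; transitivity (C k0 * C k0^-1 * (series_scale 3^-1 (sg al) * series_scale 3^-1 (sg (- al)))); first ring.
by rewrite -series_scaleM sgNK series_scale1 -rmorphM divff ?gt_eqF// rmorph1 mulr1.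
Qed.

Lemma bdf_p_gt0 : 0 < coef bdf_p 0.
Proof. by rewrite /bdf_p coef_cstM coef_scale coef_sg0 !mulr1. Qed.

Lemma bdf_wl1 : wl1 2 bdf_p.
Proof.
have A0 := a0; have A1 := a1.
apply: wl1M; first exact: wl1_cst.
by apply: (@wl1_third _ _ 1) => // n; apply: coef_sg_le1; apply/andP; split; lra.
Qed.

Lemma bdf_wl1V : wl1 0 bdf_pV.
Proof.
have A0 := a0; have A1 := a1.
apply: wl1M; first exact: wl1_cst.
by apply: (@wl1_third _ _ 1) => // n; apply: coef_sg_le1; apply/andP; split; lra.
Qed.

Let powR23 : k0 * (1 - 3^-1) `^ al = 1.
Proof.
rewrite /k0 -powRM ?divr_ge0//; last by rewrite subr_ge0 invf_le1// ler1n.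
have -> : 3 / 2 * (1 - 3^-1) = 1 :> R by field.
by rewrite powR1.
Qed.

Lemma bdf_p1 : sums bdf_p 1.
Proof.
rewrite -powR23 /bdf_p; apply: sumsM; first exact: sums_cst.
exact: binomial_evals.
Qed.

Lemma bdf_dp1 : sums (D bdf_p) (- (al / 2)).
Proof.
have A0 := a0; have A1 := a1.
have -> : D bdf_p = C k0 * C 3^-1 * (C (- al) * series_scale 3^-1 (sg (-1)) * series_scale 3^-1 (sg al)).
  rewrite /bdf_p series_derivM series_deriv_cst mul0r add0r series_deriv_scale deriv_sg.
  by rewrite -mulNr -rmorphN !series_scaleM series_scale_cst !mulrA.
have -> : - (al / 2) = k0 * 3^-1 * (- al * (3 / 2) * (1 - 3^-1) `^ al).
  transitivity (3^-1 * (- al * (3 / 2)) * (k0 * (1 - 3^-1) `^ al)); last by ring.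
  by rewrite powR23; field.
apply: sumsM; first by apply: sumsM; exact: sums_cst.
apply: sumsM; last exact: binomial_evals.
apply: sumsM; first exact: sums_cst.
have l : wl1 0 (series_scale 3^-1 (sg (-1 : R))).
  by apply: (@wl1_geometric _ _ 1) => // n; rewrite coef_sgN1 normr1.
have [v hv] := cvg_of_wl1 l.
have : (1 - 3^-1) * v = 1 :> R.
  apply: (@evals_unique _ ((1 - X) * sg (-1)) 3^-1); last by rewrite sgN1K /evals series_scale1; exact: sums1.
  apply: evalsM => //; have -> : 1 - X = C 1 + C (-1) * X by rewrite rmorphN1 rmorph1 mulN1r.
  rewrite -[- 3^-1]mulN1r; apply: evalsD; first exact: evals_cst.
  by apply: evalsM; [exact: evals_cst|exact: evalsX].
by move=> vE; have -> : 3 / 2 = v by lra.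
Qed.

Let w : fps := sg al * bdf_p.

(** The polynomial 3 - 4 z + z^2 = (3 - z) (1 - z) turns the power into a
    solution of a differential equation with polynomial coefficients, hence the
    three-term recurrence for the weights. *)
Let ode : (1 + 1 + 1 - X) * (1 - X) * D w = - (C al * (1 + 1 + 1 + 1 - X - X) * w).
Proof.
have E : (1 + 1 + 1 - X) * series_scale 3^-1 (D (sg al)) = - (C (3 * al) * series_scale 3^-1 (sg al)).
  have -> : 1 + 1 + 1 - X = C 3 * series_scale 3^-1 (1 - X).
    have -> : series_scale 3^-1 (1 - X) = 1 - C 3^-1 * X.
      apply/seriesP => n; rewrite coef_scale !coefB coef_cstM coef1 coef_X.
      by case: n => [|[|n]] /=; rewrite ?expr0 ?expr1; ring.
    rewrite mulrBr mulrA -rmorphM mulfV ?pnatr_eq0// rmorph1 mul1r mulr1; congr (_ - _).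
    by rewrite -!(rmorph1 C) -!rmorphD; congr C; ring.
  rewrite -mulrA -series_scaleM X1_deriv_sg -mulNr -rmorphN series_scaleM series_scale_cst.
  by rewrite rmorphM rmorphN; ring.
have c3 : C 3^-1 * C (3 * al) = C al by rewrite -rmorphM; congr C; field.
rewrite /w /bdf_p !series_derivM series_deriv_cst series_deriv_scale.
transitivity ((1 + 1 + 1 - X) * ((1 - X) * D (sg al)) * (C k0 * series_scale 3^-1 (sg al))
  + (1 - X) * sg al * C k0 * C 3^-1 * ((1 + 1 + 1 - X) * series_scale 3^-1 (D (sg al)))); first ring.
rewrite X1_deriv_sg E.
transitivity (- (C al * (1 + 1 + 1 - X) * sg al * C k0 * series_scale 3^-1 (sg al))
  - (C 3^-1 * C (3 * al)) * (1 - X) * sg al * C k0 * series_scale 3^-1 (sg al)); first ring.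
rewrite c3; ring.
Qed.

Let rec k : 3 * k.+2%:R * coef w k.+2 = 4 * (k.+1%:R - al) * coef w k.+1 - (k%:R - 2 * al) * coef w k.
Proof.
have A0 := a0; have A1 := a1.
have := congr1 (fun a => coef a k.+1) ode.
have -> : (1 + 1 + 1 - X) * (1 - X) * D w = C 3 * D w - C 4 * (X * D w) + X * (X * D w).
  by rewrite !rmorph_nat; ring.
have -> : - (C al * (1 + 1 + 1 + 1 - X - X) * w) = C (- (4 * al)) * w + C (2 * al) * (X * w).
  by rewrite rmorphN !rmorphM !rmorph_nat; ring.
rewrite !coefD coefN !coef_cstM !coef_XM !coef_sderiv.
case: k => [|k]; rewrite ?coef_sderiv; lra.
Qed.

Let w0 : coef w 0 = k0.
Proof. by rewrite /w /bdf_p coefM big_ord_recl big_ord0 coef_cstM coef_scale !coef_sg0; ring. Qed.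

Let w1 : coef w 1 = - (4 / 3 * al * k0).
Proof.
have A0 := a0; have A1 := a1.
have := congr1 (fun a => coef a 0) ode.
have -> : (1 + 1 + 1 - X) * (1 - X) * D w = C 3 * D w - C 4 * (X * D w) + X * (X * D w).
  by rewrite !rmorph_nat; ring.
have -> : - (C al * (1 + 1 + 1 + 1 - X - X) * w) = C (- (4 * al)) * w + C (2 * al) * (X * w).
  by rewrite rmorphN !rmorphM !rmorph_nat; ring.
rewrite !coefD coefN !coef_cstM !coef_XM !coef_sderiv w0; lra.
Qed.

Let w2 : coef w 2 = k0 * al * (8 * al - 5) / 9.
Proof.
have A0 := a0; have A1 := a1. have := rec 0; rewrite w0 w1; nra. Qed.

Let w3 : coef w 3 = - (4 / 81 * k0 * al * (1 - al) * (7 - 8 * al)).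
Proof.
have A0 := a0; have A1 := a1. have := rec 1; rewrite w1 w2; nra. Qed.

Let w4 : coef w 4 = - (k0 * al * (1 - al) * (123 - 176 * al + 64 * al ^+ 2) / 486).
Proof.
have A0 := a0; have A1 := a1. have := rec 2; rewrite w2 w3; nra. Qed.

(** The sign alone does not propagate through the recurrence, whose last term
    has the wrong sign; the second bound, that weights shrink by a factor of at
    most 3 at each step, makes up for it. *)
Let neg k : coef w k.+4 <= 0 /\ 3 * coef w k.+4 <= coef w k.+3.
Proof.
have A0 := a0; have A1 := a1.
have ka : 0 <= k0 * al * (1 - al) by rewrite !mulr_ge0 ?(ltW k0_gt0) ?(ltW a0) ?subr_ge0 ?(ltW a1).
elim: k => [|k [IH1 IH2]].
  rewrite w4 w3; split.
    have : 0 <= 123 - 176 * al + 64 * al ^+ 2 by have := sqr_ge0 (8 * al - 11); lra.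
    move=> /(mulr_ge0 ka); lra.
  have : 0 <= 67 - 112 * al + 64 * al ^+ 2 by have := sqr_ge0 (8 * al - 7); lra.
  move=> /(mulr_ge0 ka); lra.
have r := rec k.+3.
have kge : 0 <= k.+3%:R - 2 * al.
  have : (3 : R) <= k.+3%:R by rewrite ler_nat.
  by move=> ?; lra.
have h : 3 * k.+4.+1%:R * coef w k.+4.+1 <= (k.+4.+1%:R + 2 + 2 * al) * coef w k.+4.
  rewrite r; have := ler_wpM2l kge IH2; rewrite -!natr1; lra.
have kp : (0 : R) < k.+4.+1%:R by rewrite ltr0n.
have ge1 : k.+4.+1%:R * coef w k.+4 >= (k.+4.+1%:R + 2 + 2 * al) * coef w k.+4.
  by rewrite -addrA mulrDl gerDl mulr_ge0_le0// ; lra.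
have h2 : k.+4.+1%:R * (3 * coef w k.+4.+1) <= k.+4.+1%:R * coef w k.+4 by lra.
rewrite ler_pM2l// in h2; split=> //; lra.
Qed.

Let bdf_acc : accretive w /\ accretive (series_dilate 2 w).
Proof.
have A0 := a0; have A1 := a1.
apply: accretive12; first exact/sums_sg_mul/bdf_p1.
  by move=> [|[|[|[|k]]]] // _; case: (neg k).
have ka : 0 <= k0 * al by rewrite mulr_ge0 ?(ltW k0_gt0) ?(ltW a0).
have kb : 0 <= k0 * al * (1 - al) by rewrite mulr_ge0 ?subr_ge0 ?(ltW a1).
have kc : 0 <= k0 * al * (1 - al) * (15 - 8 * al) by rewrite mulr_ge0//; lra.
rewrite w1 w2 w3; set c2 := k0 * al * (8 * al - 5) / 9; set c3 := - _.
case: (leP c2 0) => h2; case: (leP c3 0) => h3; rewrite /c2 /c3 in h2 h3 *; try lra.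
have : 8 * al <= 5.
  rewrite leNgt; apply/negP => h; have : 0 < al * k0 * (8 * al - 5) by rewrite !mulr_gt0// subr_gt0.
  lra.
move=> h; have : 0 <= k0 * al * (1 - al) * (7 - 8 * al) by rewrite mulr_ge0//; lra.
lra.
Qed.

Definition bdf_scheme : scheme al :=
  Scheme bdf_pVE bdf_p_gt0 bdf_wl1 bdf_wl1V bdf_p1 bdf_dp1 (proj1 bdf_acc) (proj2 bdf_acc).

Lemma bdf_evals z : `|z| < 1 -> evals w z (generating_function al BDF2 z).
Proof.
have A0 := a0; have A1 := a1.
move=> z1; rewrite /generating_function /w /bdf_p; have z1' := z1; rewrite ltr_norml in z1'.
have /andP[za zb] := z1'.
have -> : 3 / 2 - 2 * z + z ^+ 2 / 2 = (1 - z) * (3 / 2 * (1 - 3^-1 * z)) by field.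
rewrite powRM ?mulr_ge0 ?subr_ge0 ?(ltW zb)//; try lra.
rewrite powRM ?divr_ge0//; last by lra.
apply: evalsM; first exact: binomial_evals.
apply: evalsM; first exact: evals_cst.
apply: evals_scale; apply: binomial_evals => //.
by rewrite normrM ger0_norm ?invr_ge0//; have := normr_ge0 z; lra.
Qed.

(** ** Generalized Newton-Gregory formula of order two *)

Definition ng_p : fps := C (1 + al / 2) - C (al / 2) * X.
Let kap : R := (al / 2) / (1 + al / 2).
Definition ng_pV : fps := C (1 + al / 2)^-1 * series_scale kap (sg (-1)).

Let m0 : 0 < 1 + al / 2. Proof.
have A0 := a0; have A1 := a1. by have := a0; lra. Qed.

Let kap1 : `|kap| < 1.
Proof.
have A0 := a0; have A1 := a1.
have h : 0 <= al / 2 by have := a0; lra.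
have kap0 : 0 <= kap by rewrite /kap divr_ge0// ltW.
rewrite ger0_norm// /kap ltr_pdivrMr// mul1r; lra.
Qed.

Lemma ng_pVE : ng_p * ng_pV = 1.
Proof.
rewrite /ng_p /ng_pV.
have -> : C (1 + al / 2) - C (al / 2) * X = C (1 + al / 2) * series_scale kap (1 - X).
  have -> : series_scale kap (1 - X) = 1 - C kap * X.
    apply/seriesP => n; rewrite coef_scale !coefB coef_cstM coef1 coef_X.
    by case: n => [|[|n]] /=; rewrite ?expr0 ?expr1; ring.
  rewrite mulrBr mulr1 mulrA -rmorphM; congr (_ - C _ * _).
  by rewrite /kap mulrCA mulfV ?mulr1// gt_eqF.
transitivity (C (1 + al / 2) * C (1 + al / 2)^-1 * (series_scale kap (1 - X) * series_scale kap (sg (-1)))); first ring.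
by rewrite -series_scaleM sgN1K series_scale1 -rmorphM divff ?gt_eqF// rmorph1 mulr1.
Qed.

Lemma ng_p_gt0 : 0 < coef ng_p 0.
Proof. by rewrite /ng_p coefB coef_cst coef_cstM coef_X /= mulr0 subr0. Qed.

Lemma ng_wl1 : wl1 2 ng_p.
Proof.
by apply: wl1B; [exact: wl1_cst|apply: wl1M; [exact: wl1_cst|exact: wl1_X]].
Qed.

Lemma ng_wl1V : wl1 0 ng_pV.
Proof.
apply: wl1M; first exact: wl1_cst.
by apply: (@wl1_geometric _ _ 1) => // n; rewrite coef_sgN1 normr1.
Qed.

Lemma ng_p1 : sums ng_p 1.
Proof.
have -> : 1 = (1 + al / 2) - (al / 2) * 1 by ring.
apply: sumsB; first exact: sums_cst.
by apply: sumsM; [exact: sums_cst|exact: sumsX].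
Qed.

Lemma ng_dp1 : sums (D ng_p) (- (al / 2)).
Proof.
have -> : D ng_p = C (- (al / 2)).
  by rewrite /ng_p series_derivB series_derivM !series_deriv_cst series_derivX rmorphN; ring.
exact: sums_cst.
Qed.

Let v : fps := sg al * ng_p.

Let vS k : coef v k.+1 = coef (sg al) k * ((1 + al / 2) * ((k%:R - al) / k.+1%:R) - al / 2).
Proof.
have -> : v = C (1 + al / 2) * sg al - C (al / 2) * (X * sg al) by rewrite /v /ng_p; ring.
rewrite coefB !coef_cstM coef_XM coef_sgS; ring.
Qed.

Let ng_acc : accretive v /\ accretive (series_dilate 2 v).
Proof.
have A0 := a0; have A1 := a1.
have h3 k : (3 <= k)%N -> coef v k <= 0.
  case: k => [|[|[|k]]] // _; rewrite vS mulr_le0_ge0//; first exact: coef_sg_le0.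
  have kp : (0 : R) < k.+3%:R by rewrite ltr0n.
  rewrite subr_ge0 mulrA ler_pdivlMr//.
  have kn : (0 : R) <= k%:R by [].
  rewrite -[k.+3]addn3 -[k.+2]addn2 !natrD.
  have h1 : 0 <= al * (1 - al) by rewrite mulr_ge0 ?subr_ge0 ?ltW.
  have h2 : al ^+ 2 <= al by rewrite expr2; lra.
  rewrite expr2 in h2; lra.
apply: accretive12; first exact/sums_sg_mul/ng_p1.
  by move=> k k4; apply: h3; lia.
rewrite (max_r (h3 3 _))// mulr0 addr0 !vS !coef_sgS coef_sg0.
have -> : 1 * ((1 + al / 2) * ((0%:R - al) / 1%:R) - al / 2) = - (al * (3 + al) / 2).
  by rewrite /=; field.
have -> : 1 * ((0%:R - al) / 1%:R) * ((1 + al / 2) * ((1%:R - al) / 2%:R) - al / 2) = al * (al ^+ 2 + 3 * al - 2) / 4.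
  by rewrite /=; field.
have h1 : 0 <= al * (1 - al) * (2 * al + 7) by rewrite !mulr_ge0 ?subr_ge0 ?ltW//; have := a0; lra.
have h2 : 0 <= al * (3 + al) by rewrite mulr_ge0 ?ltW//; have := a0; lra.
have hm : Num.max (al * (al ^+ 2 + 3 * al - 2) / 4) 0 <= al * (3 + al) / 8.
  by rewrite ge_max; apply/andP; split; lra.
by lra.
Qed.

Definition ng_scheme : scheme al :=
  Scheme ng_pVE ng_p_gt0 ng_wl1 ng_wl1V ng_p1 ng_dp1 (proj1 ng_acc) (proj2 ng_acc).

Lemma ng_evals z : `|z| < 1 -> evals v z (generating_function al NewtonGregory2 z).
Proof.
move=> z1; rewrite /generating_function /v /ng_p.
have -> : 1 + al / 2 * (1 - z) = (1 + al / 2) - (al / 2) * z by ring.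
apply: evalsM; first exact: binomial_evals.
rewrite -mulNr; apply: evalsD; first exact: evals_cst.
rewrite -mulNr -rmorphN; apply: evalsM; [exact: evals_cst|exact: evalsX].
Qed.

(** ** Weights with a given generating function *)

Definition scheme_of (c : generating_formula) : scheme al :=
  match c with BDF2 => bdf_scheme | NewtonGregory2 => ng_scheme end.

Lemma weights_of_generating_function c (wt : nat -> R) :
  has_power_series (generating_function al c) wt -> wt = coef (sc_w (scheme_of c)).
Proof.
have A0 := a0; have A1 := a1.
move=> hwt; pose a : fps := Series wt.
have ha z : `|z| < 1 -> evals a z (generating_function al c z).
  move=> z1; apply: pseries_evals; last exact: hwt.
  apply: wl1_of_cvg; pose K := (1 + `|z|) / 2.
  have nz : 0 <= `|z| by [].
  have K0 : 0 <= K by rewrite /K; lra.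
  have K1 : `|K| < 1 by rewrite (ger0_norm K0) /K; lra.
  have zK : `|z| < `|K| by rewrite (ger0_norm K0) /K; lra.
  have cK : cvgn (pseries wt K) by apply/cvg_ex; exists (generating_function al c K); exact: hwt.
  have := @is_cvg_pseries_inside_norm R wt K `|z| cK.
  rewrite normr_id => /(_ zK).
  suff -> : series (fun k => `|coef (series_scale z a) k|) = pseries (fun i => `|wt i|) `|z| by [].
  apply/funext => n; rewrite /pseries /series /=; apply: eq_bigr => k _.
  by rewrite coef_scale normrM normrX mulrC.
have hb z : `|z| < 1 -> evals (sc_w (scheme_of c)) z (generating_function al c z).
  by case: c {hwt ha}; [exact: bdf_evals|exact: ng_evals].
suff : a = sc_w (scheme_of c) by move=> <-.
apply/eqP; rewrite -subr_eq0; apply/eqP/series_unique => z /andP[_ z1].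
rewrite -[X in evals _ _ X](subrr (generating_function al c z)).
rewrite -mulN1r -[- generating_function _ _ _]mulN1r; apply: evalsD; first exact: ha.
have -> : -1 = C (-1) :> fps by rewrite rmorphN1.
by apply: evalsM; [exact: evals_cst|exact: hb].
Qed.

End instances.

(** * Integrals of real-valued functions *)

Section real_integrable.
Context d (T : measurableType d) (R : realType).
Variables (mu : {measure set T -> \bar R}) (D : set T).
Hypothesis mD : measurable D.
Implicit Types f g : T -> R.

Lemma integrable_scale (k : R) f :
  mu.-integrable D (EFin \o f) -> mu.-integrable D (EFin \o (fun x => k * f x)).
Proof. by move=> fi; have := integrableZl mD k fi. Qed.

Lemma integrable_add f g :
  mu.-integrable D (EFin \o f) -> mu.-integrable D (EFin \o g) ->
  mu.-integrable D (EFin \o (fun x => f x + g x)).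
Proof. by move=> fi gi; have := integrableD mD fi gi. Qed.

Lemma integrable_sub f g :
  mu.-integrable D (EFin \o f) -> mu.-integrable D (EFin \o g) ->
  mu.-integrable D (EFin \o (fun x => f x - g x)).
Proof. by move=> fi gi; have := integrableB mD fi gi. Qed.

End real_integrable.

(** * Binomial coefficients and Gamma *)

Lemma powRD_gt0 (R : realType) (x r s : R) : 0 < x -> x `^ (r + s) = x `^ r * x `^ s.
Proof. by move=> x0; apply: powRD; apply/implyP => _; rewrite gt_eqF. Qed.

Section gamma_asymptotics.
Variable R : realType.
Local Notation mu := (@lebesgue_measure R).
Implicit Types s : R.

Let lo (n : nat) : R := n.+2%:R^-1.
Let hi (n : nat) : R := n.+2%:R.

Let lo_gt0 n : 0 < lo n. Proof. by rewrite invr_gt0. Qed.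
Let lo_hi n : lo n < hi n.
Proof. by rewrite (@lt_le_trans _ _ 1) ?invf_lt1 ?ltr1n// ler1n. Qed.

Let integrand s (t : R) : R := t `^ s * expR (- t).

(** The integrals of Gamma over segments that exhaust the half line: on each
    of them the integrand is continuous, for negative exponents as well. *)
Let moment s n : R := \int[mu]_(t in `[lo n, hi n]) integrand s t.

Let continuous_integrand s (t : R) : 0 < t -> {for t, continuous (integrand s)}.
Proof.
move=> t0; apply: differentiable_continuous; apply/derivable1_diffP.
by apply: derivableM => //; apply: derivable_powR; rewrite in_itv/= t0.
Qed.

Let within_integrand s n : {within `[lo n, hi n], continuous (integrand s)}.
Proof.
apply: continuous_in_subspaceT => t /set_mem; rewrite /= in_itv/= => /andP[h _].
by apply: continuous_integrand; rewrite (lt_le_trans (lo_gt0 n)).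
Qed.

Let integrable_integrand s n : mu.-integrable `[lo n, hi n] (EFin \o integrand s).
Proof.
by apply: continuous_compact_integrable => //; exact: segment_compact.
Qed.

Let boundary s n : R := integrand s (lo n) - integrand s (hi n).

Let moment_rec s n :
  moment (s + 1) n = (s + 1) * moment s n + boundary (s + 1) n.
Proof.
have h : moment (s + 1) n - (s + 1) * moment s n = boundary (s + 1) n.
  have iI r := integrable_integrand r n.
  have iZ : mu.-integrable `[lo n, hi n] (EFin \o (fun t => (s + 1) * integrand s t)).
    exact: integrable_scale.
  rewrite /moment -RintegralZl// -RintegralB//.
  rewrite /Rintegral (@continuous_FTC2 _ _ (fun t => - integrand (s + 1) t))//=.
  - by rewrite /boundary opprK addrC.
  - move=> t; apply: cvgB; first exact: within_integrand.
    by apply: cvgMl_tmp; exact: within_integrand.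
  - split.
    + move=> t; rewrite in_itv/= => /andP[h _]; have t0 := lt_trans (lo_gt0 n) h.
      apply: derivableN; apply: derivableM => //.
      by apply: derivable_powR; rewrite in_itv/= t0.
    + apply: cvg_at_right_filter; apply: cvgN.
      exact: continuous_integrand.
    + apply: cvg_at_left_filter; apply: cvgN.
      by apply: continuous_integrand; rewrite (lt_trans (lo_gt0 n)).
  - move=> t; rewrite in_itv/= => /andP[h _]; have t0 := lt_trans (lo_gt0 n) h.
    rewrite derive1E; have dp := is_derive1_powR (s + 1) t0.
    have de : is_derive t 1 (fun u => expR (- u)) (- expR (- t)).
      have dn : is_derive t 1 (fun u : R => - u) (- 1) by apply: is_deriveN.
      by have := is_derive1_comp (is_derive_expR (- t)) dn; rewrite mulrN1.
    have dF := is_deriveN (is_deriveM dp de).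
    rewrite (@derive_val _ _ _ _ _ _ _ dF) /integrand addrK /GRing.scale/=; ring.
by move: h; rewrite -/(moment _ _) -/(moment s n); lra.
Qed.

Let squeeze0 (u v : nat -> R) :
  (forall n, 0 <= u n <= v n) -> v @ \oo --> (0 : R) -> u @ \oo --> (0 : R).
Proof.
move=> uv v0; apply: (@squeeze_cvgr _ _ _ _ (cst 0) v) => //; last exact: cvg_cst.
exact: nearW.
Qed.

Let le_cvg (u v : nat -> R) (x y : R) : u @ \oo --> x -> v @ \oo --> y ->
  (forall n, u n <= v n) -> x <= y.
Proof. by move=> ux vy uv; apply: (ler_cvg_to ux vy); exact: nearW. Qed.

Let lo_cvg : lo @ \oo --> (0 : R).
Proof.
rewrite /lo (_ : (fun n => _) = (fun n => harmonic (n + 1)%N)).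
  by rewrite cvg_shiftn; exact: cvg_harmonic.
by apply/funext => n; rewrite /= addn1.
Qed.

(** Any power is beaten by the exponential: it suffices that
    [expR t >= (t / m) ^+ m] for every [m]. *)
Let boundary_cvg s : 0 < s -> boundary s @ \oo --> (0 : R).
Proof.
move=> s0; rewrite -[X in _ --> X](subr0 (0 : R)); apply: cvgB.
  have hl : (fun n => lo n `^ s) @ \oo --> (0 : R).
    have /cvg_at_rightP H := @powR_cvg0 R s s0.
    by apply: (H lo); split; [exact: lo_gt0|exact: lo_cvg].
  apply: squeeze0 hl => n; rewrite /integrand mulr_ge0 ?powR_ge0 ?expR_ge0//=.
  by rewrite ler_piMr ?powR_ge0// -expR0 ler_expR lerNl oppr0 ltW.
have [m sm] : exists m, s <= m%:R.
  exists (Num.bound `|s|).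
  by rewrite (le_trans (ler_norm s))// ltW// archi_boundP.
pose c : R := m.+1%:R ^+ m.+1.
have c0 : 0 <= c by rewrite exprn_ge0.
have hl : (fun n => c * lo n) @ \oo --> (0 : R).
  by rewrite -[X in _ --> X](mulr0 c); apply: cvgMl_tmp; exact: lo_cvg.
apply: squeeze0 hl => n; rewrite /integrand mulr_ge0 ?powR_ge0 ?expR_ge0//=.
have h0 : 0 < hi n by rewrite ltr0n.
have h1 : 1 <= hi n by rewrite ler1n.
have he : (hi n / m.+1%:R) ^+ m.+1 <= expR (hi n).
  have -> : expR (hi n) = expR (hi n / m.+1%:R) ^+ m.+1.
    by rewrite -expRM_natl mulrC divfK.
  rewrite lerXn2r ?nnegrE ?divr_ge0 ?expR_ge0 ?(ltW h0)//.
  by rewrite (le_trans _ (expR_ge1Dx _))// lerDr.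
rewrite (@le_trans _ _ (hi n ^+ m * expR (- hi n)))//.
  by rewrite ler_wpM2r ?expR_ge0// -powR_mulrn ?(ltW h0)// ler_powR.
rewrite expRN ler_pdivrMr ?expR_gt0//.
have -> : hi n ^+ m = c * lo n * (hi n / m.+1%:R) ^+ m.+1.
  rewrite expr_div_n -/c [hi n ^+ m.+1]exprS /lo -/(hi n).
  have hc : c != 0 by rewrite expf_neq0.
  by field; rewrite hc gt_eqF.
by rewrite ler_wpM2l// mulr_ge0// ltW.
Qed.

Let le_moment s f n : (forall t, 0 < t -> t `^ s * expR (- t) <= f t) ->
  mu.-integrable `[lo n, hi n] (EFin \o f) ->
  moment s n <= \int[mu]_(t in `[lo n, hi n]) f t.
Proof.
move=> sf fi; apply: (le_Rintegral _ (integrable_integrand s n) fi) => // t.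
rewrite /= in_itv/= => /andP[h _]; apply: sf.
exact: lt_le_trans (lo_gt0 n) h.
Qed.

Let moment_nondecreasing s : nondecreasing_seq (moment s).
Proof.
move=> m n mn; rewrite /moment /Rintegral fine_le//.
- exact: integrable_fin_num (integrable_integrand s m).
- exact: integrable_fin_num (integrable_integrand s n).
apply: ge0_subset_integral => //.
- exact: measurable_int (integrable_integrand s n).
- by move=> t _; rewrite lee_fin mulr_ge0 ?powR_ge0 ?expR_ge0.
- by apply: subset_itv; rewrite bnd_simp /lo /hi ?lef_pV2 ?ler_nat ?posrE ?ltr0n.
Qed.

Let moment_rec_cvg s v : -1 < s -> moment s @ \oo --> v ->
  moment (s + 1) @ \oo --> (s + 1) * v.
Proof.
move=> s1 h; rewrite (_ : moment (s + 1) =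
    (fun n => (s + 1) * moment s n + boundary (s + 1) n)); last first.
  by apply/funext => n; exact: moment_rec.
rewrite -[X in _ --> X]addr0; apply: cvgD; first exact: cvgMl_tmp.
by apply: boundary_cvg; lra.
Qed.

Let moment0 : moment 0 @ \oo --> (1 : R).
Proof.
apply/cvgrPdist_le => e e0.
have h : (fun n => 2 * lo n) @ \oo --> (0 : R).
  by rewrite -[X in _ --> X](mulr0 2); apply: cvgMl_tmp; exact: lo_cvg.
move/cvgrPdist_le : h => /(_ _ e0); apply: filterS => n.
rewrite sub0r normrN ger0_norm ?mulr_ge0 ?(ltW (lo_gt0 n))//; apply: le_trans.
have := moment_rec (-1) n; rewrite addNr mul0r add0r => ->.
rewrite /boundary /integrand !powRr0 !mul1r.
have l0 := lo_gt0 n.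
have h1 := expR_ge1Dx (- lo n).
have h2 : expR (- lo n) <= 1 by rewrite -expR0 ler_expR lerNl oppr0 ltW.
have h3 := expR_ge0 (- hi n).
have h4 : expR (- hi n) <= lo n.
  rewrite expRN /lo lef_pV2 ?posrE ?expR_gt0 ?ltr0n//.
  by rewrite (le_trans _ (expR_ge1Dx _))// lerDr.
rewrite ger0_norm; lra.
Qed.

Let moment_nat k : moment k%:R @ \oo --> (k`!%:R : R).
Proof.
elim: k => [|k IH]; first exact: moment0.
rewrite -[k.+1%:R]natr1 factS natrM -natr1.
by apply: moment_rec_cvg => //; rewrite (lt_le_trans (ltrN10 _)).
Qed.

Section exponent.
Variable al : R.
Hypothesis al01 : 0 < al < 1.

Let moment_exists : exists v : R, moment (- al) @ \oo --> v.
Proof.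
have [a0 a1] := andP al01.
have bnd n : moment (1 - al) n <= moment 0 n + moment 1 n.
  rewrite /moment -(RintegralD _ (integrable_integrand 0 n) (integrable_integrand 1 n))//.
  apply: le_moment => [t t0|].
    rewrite /integrand powRr0 (powRr1 (ltW t0)) -mulrDl ler_wpM2r ?expR_ge0//.
    have al1 : 0 < 1 - al < 1 by lra.
    have := powR_le_tangent al1 (ltW t0).
    have : 0 <= al * t by rewrite mulr_ge0 ?ltW.
    by move=> h1 h2; have A1 := a1; lra.
  by apply: integrable_add => //; exact: integrable_integrand.
have [v hv] : exists v : R, moment (1 - al) @ \oo --> v.
  have ub k n : moment k%:R n <= k`!%:R.
    have h := @moment_nat k.
    have /nondecreasing_cvgn_le H := @moment_nondecreasing k%:R.
    have cv : cvgn (moment k%:R) by apply/cvg_ex; exists (k`!%:R : R).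
    by have := H cv n; rewrite (cvg_lim _ h).
  have cv : cvgn (moment (1 - al)).
    apply: nondecreasing_is_cvgn => //; exists (0`!%:R + 1`!%:R) => _ [n _ <-].
    by rewrite (le_trans (bnd n))// lerD// ?(ub 0) ?(ub 1).
  by exists (lim (moment (1 - al) @ \oo)).
exists ((1 - al)^-1 * (v - 0)).
rewrite (_ : moment (- al) =
    (fun n => (1 - al)^-1 * (moment (1 - al) n - boundary (1 - al) n))).
  by apply: cvgMl_tmp; apply: cvgB => //; apply: boundary_cvg; lra.
apply/funext => n; have := moment_rec (- al) n; rewrite addrC => ->.
by rewrite addrK mulKf//; lra.
Qed.

Let moment_Gamma : moment (- al) @ \oo --> Gamma (1 - al).
Proof.
have [v hv] := moment_exists; suff -> : Gamma (1 - al) = v by [].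
pose F n : set R := `[lo n, hi n]%classic.
have UF : \bigcup_n F n = `]0, +oo[%classic.
  apply/seteqP; split => t /=; rewrite ?in_itv/= ?andbT.
    move=> [n _]; rewrite /F /= in_itv/= => /andP[h _].
    exact: lt_le_trans (lo_gt0 n) h.
  move=> t0; pose n := maxn (Num.bound t) (Num.bound t^-1); exists n => //.
  have ht : t < n%:R.
    rewrite (lt_le_trans (archi_boundP (ltW t0)))//.
    by rewrite ler_nat leq_maxl.
  have hw : t^-1 < n%:R.
    rewrite (lt_le_trans (archi_boundP _))// ?invr_ge0 ?(ltW t0)//.
    by rewrite ler_nat leq_maxr.
  rewrite /F /= in_itv/= /lo /hi; apply/andP; split.
    rewrite -[leRHS]invrK lef_pV2 ?posrE ?invr_gt0 ?ltr0n//.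
    by rewrite (le_trans (ltW hw))// ler_nat leqW// leqW.
  by rewrite (le_trans (ltW ht))// ler_nat leqW// leqW.
have H : (\int[mu]_(x in F i) (integrand (- al) x)%:E)%E @[i --> \oo] -->
    (\int[mu]_(x in \bigcup_i F i) (integrand (- al) x)%:E)%E.
  apply: ge0_nondecreasing_set_cvg_integral => //.
  - move=> m n mn; apply/subsetPset; apply: subset_itv;
      by rewrite bnd_simp /lo /hi ?lef_pV2 ?ler_nat ?posrE ?ltr0n.
  - by move=> n; exact: measurable_itv.
  - by move=> n; exact: (measurable_int mu (integrable_integrand (- al) n)).
  - by move=> n x _; rewrite lee_fin mulr_ge0 ?powR_ge0 ?expR_ge0.
have H2 : (\int[mu]_(x in F i) (integrand (- al) x)%:E)%E @[i --> \oo] --> v%:E.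
  rewrite (_ : (fun n => _) = EFin \o moment (- al)).
    by apply: cvg_EFin => //; exact: nearW.
  apply/funext => n; rewrite /= /moment /Rintegral fineK//.
  exact: integrable_fin_num (integrable_integrand _ n).
have := cvg_unique (@ereal_hausdorff R) H H2; rewrite UF => E.
rewrite -[RHS]/(fine v%:E) -E /Gamma /Rintegral; congr fine.
by apply: eq_integral => x _; rewrite /integrand addrAC subrr add0r.
Qed.

Let g : R := (1 - al) * Gamma (1 - al).

Let moment_shift m :
  moment (m%:R + (1 - al)) @ \oo --> g * (coef (sg (al - 2)) m * m`!%:R).
Proof.
have [a0 a1] := andP al01.
elim: m => [|m IH].
  rewrite coef_sg0 mulr1 mulr1 add0r (addrC 1) /g (addrC 1).
  by apply: moment_rec_cvg; [lra|rewrite (addrC _ 1); exact: moment_Gamma].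
have h : -1 < m%:R + (1 - al) by have : 0 <= m%:R :> R by []; lra.
have := moment_rec_cvg h IH.
rewrite (_ : m%:R + (1 - al) + 1 = m.+1%:R + (1 - al)); last by rewrite -natr1; lra.
rewrite (_ : (m.+1%:R + (1 - al)) * _ = g * (coef (sg (al - 2)) m.+1 * m.+1`!%:R))//.
rewrite factS natrM coef_sgS -natr1; have : m%:R + 1 != 0 :> R by rewrite natr1.
by move=> m0; field.
Qed.

Let moment_upper m : g * (coef (sg (al - 2)) m * m`!%:R) <= m.+1%:R `^ (1 - al) * m`!%:R.
Proof.
have [a0 a1] := andP al01.
pose y : R := m.+1%:R; have y0 : 0 < y by rewrite ltr0n.
pose k := (1 - al) * y `^ (1 - al - 1).
have cv : (fun n => (y `^ (1 - al) - k * y) * moment m%:R n + k * moment m.+1%:R n) @ \oo -->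
    (y `^ (1 - al) - k * y) * m`!%:R + k * m.+1`!%:R.
  by apply: cvgD; apply: cvgMl_tmp; exact: moment_nat.
rewrite (_ : y `^ (1 - al) * m`!%:R =
  (y `^ (1 - al) - k * y) * m`!%:R + k * m.+1`!%:R); last first.
  by rewrite factS natrM -/y; ring.
have H := le_cvg (@moment_shift m) cv; apply: H => n.
have iI r := integrable_integrand r n.
rewrite /moment -!RintegralZl//.
have i1 := integrable_scale _ (y `^ (1 - al) - k * y) (iI m%:R).
have i2 := integrable_scale _ k (iI m.+1%:R).
rewrite -RintegralD; [|exact: measurable_itv|exact: i1|exact: i2].
apply: le_moment; last by apply: integrable_add; [|exact: i1|exact: i2].
move=> t t0; rewrite /integrand -[m.+1%:R]natr1 (powRD_gt0 m%:R (1 - al) t0) (powRD_gt0 m%:R 1 t0) (powRr1 (ltW t0)).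
have al1 : 0 < 1 - al < 1 by lra.
have := powR_le_tangent_at al1 (ltW t0) y0; rewrite -/k => h.
have e0 : 0 <= t `^ m%:R * expR (- t) by rewrite mulr_ge0 ?powR_ge0 ?expR_ge0.
have := ler_wpM2l e0 h; lra.
Qed.

Let moment_lower m : m.+1`!%:R <= (m%:R + 2 - al) `^ al * (g * (coef (sg (al - 2)) m * m`!%:R)).
Proof.
have [a0 a1] := andP al01.
pose y : R := m%:R + 2 - al.
have y0 : 0 < y by rewrite /y; have : 0 <= m%:R :> R by []; lra.
pose k := al * y `^ (al - 1).
pose v := g * (coef (sg (al - 2)) m * m`!%:R).
have h1 : -1 < m%:R + (1 - al) by have : 0 <= m%:R :> R by []; lra.
have cv : (fun n => (y `^ al - k * y) * moment (m%:R + (1 - al)) n +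
    k * moment (m%:R + (1 - al) + 1) n) @ \oo -->
    (y `^ al - k * y) * v + k * ((m%:R + (1 - al) + 1) * v).
  apply: cvgD; apply: cvgMl_tmp; first exact: moment_shift.
  by apply: moment_rec_cvg => //; exact: moment_shift.
rewrite -/v -/y (_ : y `^ al * v =
  (y `^ al - k * y) * v + k * ((m%:R + (1 - al) + 1) * v)); last first.
  by rewrite /y; ring.
have H := le_cvg (@moment_nat m.+1) cv; apply: H => n.
have iI r := integrable_integrand r n.
rewrite /moment -!RintegralZl//.
have i1 := integrable_scale _ (y `^ al - k * y) (iI (m%:R + (1 - al))).
have i2 := integrable_scale _ k (iI (m%:R + (1 - al) + 1)).
rewrite -RintegralD; [|exact: measurable_itv|exact: i1|exact: i2].
apply: le_moment; last by apply: integrable_add; [|exact: i1|exact: i2].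
move=> t t0; rewrite /integrand -natr1.
rewrite (_ : m%:R + 1 = al + (m%:R + (1 - al))); last lra.
rewrite (powRD_gt0 al _ t0) (powRD_gt0 _ 1 t0) (powRr1 (ltW t0)).
have := powR_le_tangent_at al01 (ltW t0) y0; rewrite -/k => h.
have e0 : 0 <= t `^ (m%:R + (1 - al)) * expR (- t) by rewrite mulr_ge0 ?powR_ge0 ?expR_ge0.
have := ler_wpM2l e0 h; lra.
Qed.

Lemma Gamma_gt0 : 0 < Gamma (1 - al).
Proof.
have [a0 a1] := andP al01.
have := moment_lower 0; rewrite coef_sg0 !mulr1 => h.
have : 0 < (0 + 2 - al) `^ al * g by apply: lt_le_trans h.
by rewrite pmulr_rgt0 ?powR_gt0 ?pmulr_rgt0//; lra.
Qed.

(** Gautschi's inequality: the tangent lines of a concave power, integrated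
    against Gamma densities, enclose quotients of Gamma values; here
    [coef (sg (al - 2)) m = Gamma (m + 2 - al) / (m`! * Gamma (2 - al))]. *)
Lemma coef_sg_Gamma m :
  `|(1 - al) * Gamma (1 - al) * coef (sg (al - 2)) m - m.+1%:R `^ (1 - al)| <= 1.
Proof.
have [a0 a1] := andP al01; rewrite -/g.
have f0 : 0 < m`!%:R :> R by rewrite ltr0n fact_gt0.
have hu : g * coef (sg (al - 2)) m <= m.+1%:R `^ (1 - al).
  by have := moment_upper m; rewrite mulrA ler_pM2r.
have hl : m.+1%:R <= (m%:R + 2 - al) `^ al * (g * coef (sg (al - 2)) m).
  have := moment_lower m; rewrite factS natrM mulrA mulrA -mulrA.
  by rewrite !mulrA ler_pM2r// -!mulrA.
pose z : R := m.+1%:R; have z0 : 0 < z by rewrite ltr0n.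
have z1 : 1 <= z by rewrite ler1n.
have yE : m%:R + 2 - al = z + (1 - al) by rewrite /z -natr1; lra.
rewrite yE -/z in hl; set c := g * _ in hu hl *.
have y0 : 0 < z + (1 - al) by lra.
have ht := powR_le_tangent_at al01 (ltW y0) z0.
have zE : z `^ al * z `^ (1 - al) = z.
  by rewrite -powRD_gt0// (_ : al + (1 - al) = 1) ?powRr1 ?(ltW z0)//; ring.
have zE2 : z * z `^ (al - 1) = z `^ al.
  rewrite -{1}(powRr1 (ltW z0)) -powRD_gt0//.
  by rewrite addrC subrK.
have p0 : 0 < z `^ al by rewrite powR_gt0.
have pa : 1 <= z `^ al by rewrite -[leLHS](powRr0 z) ler_powR// ltW.
have c0 : 0 <= c.
  have q0 : 0 < (z + (1 - al)) `^ al by rewrite powR_gt0.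
  by rewrite -(pmulr_rge0 _ q0) (le_trans _ hl)// ltW.
have w0 : 0 <= z `^ (al - 1) by rewrite powR_ge0.
have w1 : z `^ (al - 1) * z `^ (1 - al) = 1.
  by rewrite -powRD_gt0// (_ : al - 1 + (1 - al) = 0) ?powRr0//; ring.
rewrite ler_norml; apply/andP; split; last by lra.
suff : z `^ al * (z `^ (1 - al) - c) <= z `^ al by rewrite ger_pMr//; lra.
have h3 : z <= (z `^ al + al * z `^ (al - 1) * (1 - al)) * c.
  by apply: (le_trans hl); rewrite ler_wpM2r//; lra.
rewrite mulrBr zE.
have h4 : z `^ (al - 1) * c <= 1.
  by have := ler_wpM2l w0 hu; rewrite -/z w1.
have h5 : 0 <= z `^ (al - 1) * c by rewrite mulr_ge0.
suff : al * (1 - al) * (z `^ (al - 1) * c) <= 1 by lra.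
have q : al * (1 - al) <= 1 by rewrite mulr_ile1//; lra.
by rewrite mulr_ile1// mulr_ge0//; lra.
Qed.

End exponent.

End gamma_asymptotics.

(** * The integrated fractional equation *)

Section volterra.
Variables (R : realType) (al c lam : R).
Hypotheses (al01 : 0 < al < 1) (c0 : 0 <= c) (lam0 : 0 <= lam).
Local Notation mu := (@lebesgue_measure R).

Definition kernel_density (u : R) : R := c * u `^ (- al) + lam.

Definition kernel_primitive (u : R) : R := c / (1 - al) * u `^ (1 - al) + lam * u.

Local Notation phi := kernel_density.
Local Notation K := kernel_primitive.

Let phi_ge0 u : 0 <= phi u.
Proof. by rewrite addr_ge0// mulr_ge0// powR_ge0. Qed.

Let measurable_phi (s : R) : measurable_fun setT (fun r : R => phi (r - s)).
Proof.
apply: measurable_funD => //; apply: measurable_funM => //.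
apply: (measurableT_comp (measurable_powR _)).
exact: measurable_funB.
Qed.

Let measurable_phi0 : measurable_fun setT (phi \_ `]0, +oo[).
Proof.
apply: (measurable_restrictT phi (measurable_itv _)).1; apply: measurable_funTS.
have := measurable_phi 0; rewrite (_ : (fun r => _) = phi)//.
by apply/funext => r; rewrite subr0.
Qed.

Let K_ge0 u : 0 <= u -> 0 <= K u.
Proof.
move=> u0; have [a0 a1] := andP al01.
by rewrite addr_ge0 ?mulr_ge0 ?powR_ge0 ?invr_ge0//; lra.
Qed.

Let measurable_K (s : R) : measurable_fun setT (fun r : R => K (s - r)).
Proof.
have mB : measurable_fun setT (fun r : R => s - r) by exact: measurable_funB.
apply: measurable_funD; apply: measurable_funM => //.
exact: (measurableT_comp (measurable_powR _)).
Qed.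

Let is_derive_K (s r : R) : s < r ->
  is_derive r 1 (fun x => K (x - s)) (phi (r - s)).
Proof.
have [a0 a1] := andP al01.
move=> sr; have rs0 : 0 < r - s by rewrite subr_gt0.
have dB : is_derive r 1 (fun x : R => x - s) 1.
  by have := is_deriveB (is_derive_id r (1 : R)) (is_derive_cst s r (1 : R)); rewrite subr0.
have dp := is_derive1_powR (1 - al) rs0.
have d1 := @is_derive1_comp R (fun y => y `^ (1 - al)) (fun x => x - s) r _ _ dp dB.
have := is_deriveD (is_deriveZ (c / (1 - al)) d1) (is_deriveZ lam dB).
set f1 := (X in is_derive _ _ X _); set f2 := fun x => _.
have -> : f1 = f2 by [].
move=> h; apply: (is_derive_eq h).
rewrite /phi /GRing.scale/= (_ : 1 - al - 1 = - al); last by ring.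
by field; lra.
Qed.

Let continuous_phi (s r : R) : s < r -> {for r, continuous (fun x => phi (x - s))}.
Proof.
move=> sr; have rs0 : 0 < r - s by rewrite subr_gt0.
apply: cvgD; last exact: cvg_cst.
apply: cvgMl_tmp.
apply: (@continuous_comp _ _ _ (fun x : R => x - s) (fun y => y `^ (- al))).
  by apply: cvgB => //; exact: cvg_cst.
apply: differentiable_continuous; apply/derivable1_diffP.
by apply: derivable_powR; rewrite in_itv/= rs0.
Qed.

Let continuous_K (s r : R) : s < r -> {for r, continuous (fun x => K (x - s))}.
Proof.
move=> sr; apply: differentiable_continuous; apply/derivable1_diffP.
by have [] := is_derive_K sr.
Qed.

Lemma integral_kernel_density (s t : R) : s < t ->
  (\int[mu]_(r in `]s, t]) (phi (r - s))%:E = (K (t - s))%:E)%E.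
Proof.
have [a0 a1] := andP al01.
move=> st; have ts0 : 0 < t - s by rewrite subr_gt0.
pose e (n : nat) : R := (t - s) / n.+2%:R.
have e0 n : 0 < e n by rewrite divr_gt0.
have e1 n : e n < t - s by rewrite ltr_pdivrMr// ltr_pMr// ltr1n.
pose F n : set R := `[s + e n, t]%classic.
have UF : \bigcup_n F n = `]s, t]%classic.
  apply/seteqP; split => r /=; rewrite ?in_itv/=.
    move=> [n _]; rewrite /F /= in_itv/= => /andP[h ->]; rewrite andbT.
    by rewrite (lt_le_trans _ h)// ltrDl.
  move=> /andP[sr rt]; have rs0 : 0 < r - s by rewrite subr_gt0.
  exists (Num.bound ((t - s) / (r - s))) => //.
  rewrite /F /= in_itv/= rt andbT -lerBrDl /e ler_pdivrMr// mulrC -ler_pdivrMr//.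
  rewrite (le_trans (ltW (archi_boundP _)))// ?divr_ge0 ?(ltW ts0) ?(ltW rs0)//.
  by rewrite ler_nat leqW.
have FTC n : (\int[mu]_(r in F n) (phi (r - s))%:E = (K (t - s) - K (e n))%:E)%E.
  have ht : s + e n < t by have := e1 n; lra.
  have := @continuous_FTC2 R (fun x => phi (x - s)) (fun x => K (x - s)) _ _ ht.
  rewrite (_ : s + e n - s = e n); last by ring.
  apply.
  - apply: continuous_in_subspaceT => r /set_mem; rewrite /= in_itv/= => /andP[h _].
    by apply: continuous_phi; rewrite (lt_le_trans _ h)// ltrDl.
  - split.
    + move=> r; rewrite in_itv/= => /andP[h _].
      have sr : s < r by rewrite (lt_trans _ h)// ltrDl.
      by have [] := is_derive_K sr.
    + by apply: cvg_at_right_filter; apply: continuous_K; rewrite ltrDl.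
    + by apply: cvg_at_left_filter; exact: continuous_K.
  - move=> r; rewrite in_itv/= => /andP[h _].
    have sr : s < r by rewrite (lt_trans _ h)// ltrDl.
    by rewrite derive1E; have dr := is_derive_K sr; rewrite (@derive_val _ _ _ _ _ _ _ dr).
have H : (\int[mu]_(r in F i) (phi (r - s))%:E)%E @[i --> \oo] -->
    (\int[mu]_(r in \bigcup_i F i) (phi (r - s))%:E)%E.
  apply: ge0_nondecreasing_set_cvg_integral => //.
  - move=> m n mn; apply/subsetPset; apply: subset_itv; rewrite bnd_simp//.
    by rewrite lerD2l ler_pM2l// lef_pV2 ?posrE ?ltr0n// ler_nat.
  - by move=> n; exact: measurable_itv.
  - move=> n; apply/measurable_EFinP; apply: measurable_funTS.
    exact: measurable_phi.
  - by move=> n r _; rewrite lee_fin.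
have ecvg : e @ \oo --> (0 : R).
  rewrite -[X in _ --> X](mulr0 (t - s)); apply: cvgMl_tmp.
  rewrite (_ : (fun n => _) = (fun n => harmonic (n + 1)%N)).
    by rewrite cvg_shiftn; exact: cvg_harmonic.
  by apply/funext => n; rewrite /= addn1.
have Kcvg : (fun n => K (e n)) @ \oo --> (0 : R).
  rewrite -[X in _ --> X](addr0 (0 : R)); apply: cvgD.
    rewrite -[X in _ --> X](mulr0 (c / (1 - al))); apply: cvgMl_tmp.
    have al1 : 0 < 1 - al by lra.
    have /cvg_at_rightP := @powR_cvg0 R _ al1; apply; split => //.
  by rewrite -[X in _ --> X](mulr0 lam); apply: cvgMl_tmp.
have H2 : (\int[mu]_(r in F i) (phi (r - s))%:E)%E @[i --> \oo] --> (K (t - s))%:E.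
  rewrite (_ : (fun n => _) = EFin \o (fun n => K (t - s) - K (e n))).
    apply: cvg_EFin; first exact: nearW.
    rewrite -[X in _ --> X]subr0; apply: cvgB => //; exact: cvg_cst.
  by apply/funext => n; rewrite FTC.
by have := cvg_unique (@ereal_hausdorff R) H H2; rewrite UF => ->.
Qed.

Section fubini.
Variables (T a b : R) (g : R -> R).
Hypothesis gT : mu.-integrable `[0, T] (EFin \o g).
Hypothesis gphi : forall r, 0 < r <= T ->
  mu.-integrable `]0, r[ (EFin \o (fun s => g s * phi (r - s))).
Hypothesis geq : forall r, 0 < r <= T ->
  \int[mu]_(s in `]0, r[) (g s * phi (r - s)) = a + b * r.

Variable t : R.
Hypothesis t0T : 0 < t <= T.

Let g0 : R -> R := g \_ `]0, t[.
(** The integrand on the triangle s < r <= t, extended by zero to the plane. *)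
Let F (z : R * R) : \bar R :=
  (g0 z.2 * ((phi \_ `]0, +oo[) (z.1 - z.2) * \1_`]-oo, t] z.1))%:E.

Let i0 : mu.-integrable `]0, t[ (EFin \o g).
Proof.
have [t0 tT] := andP t0T.
by apply: integrableS gT => //; apply: subset_itv; rewrite bnd_simp.
Qed.

Let ig0 : mu.-integrable setT (EFin \o g0).
Proof.
by rewrite -restrict_EFin; apply: (integrable_mkcond _ _).1; [exact: measurable_itv|exact: i0].
Qed.

Let mF : measurable_fun setT F.
Proof.
apply/measurable_EFinP; apply: measurable_funM.
  apply: (measurableT_comp _ measurable_snd).
  by apply/measurable_EFinP; have /measurable_int := ig0.
apply: measurable_funM; last first.
  apply: (measurableT_comp _ measurable_fst).
  exact: measurable_indic.
apply: (measurableT_comp measurable_phi0).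
by apply: measurable_funB; [exact: measurable_fst|exact: measurable_snd].
Qed.

(** The kernel integrates in r to kernel_primitive; with absolute values this
    gives integrability on the product. *)
Let inner_r s : (\int[mu]_r `|F (r, s)| = (`|g0 s| * K (t - s))%:E)%E /\
  (\int[mu]_r F (r, s) = (g0 s * K (t - s))%:E)%E.
Proof.
have [st|ts] := ltP s t; last first.
  have g00 : g0 s = 0 by rewrite /g0 patchE; case: ifPn => // /set_mem; rewrite /= in_itv/=; lra.
  rewrite /F/= g00 normr0 !mul0r; split; apply: integral0_eq => r _;
    by rewrite ?mul0r ?normr0.
have E : (\int[mu]_r ((phi \_ `]0, +oo[) (r - s) * \1_`]-oo, t] r)%:E = (K (t - s))%:E)%E.
  rewrite -(integral_kernel_density st) [in RHS]integral_mkcond.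
  apply: eq_integral => r _; rewrite /patch indicE !mem_setE !in_itv/=.
  by rewrite andbT subr_gt0; case: ifP => sr; case: (r <= t); rewrite ?mulr1 ?mulr0 ?mul0r.
have p0 r : 0 <= (phi \_ `]0, +oo[) (r - s) * \1_`]-oo, t] r.
  by rewrite mulr_ge0// ?indicE//; rewrite /patch; case: ifP.
have mp : measurable_fun setT (fun r : R => ((phi \_ `]0, +oo[) (r - s) * \1_`]-oo, t] r)%:E).
  apply/measurable_EFinP; apply: measurable_funM; last exact: measurable_indic.
  apply: (measurableT_comp measurable_phi0).
  exact: measurable_funB.
have ip : mu.-integrable setT (fun r : R => ((phi \_ `]0, +oo[) (r - s) * \1_`]-oo, t] r)%:E).
  apply/integrableP; split => //; under eq_integral do rewrite gee0_abs ?lee_fin//.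
  by rewrite E ltry.
split.
  transitivity (\int[mu]_r (`|g0 s|%:E *
      ((phi \_ `]0, +oo[) (r - s) * \1_`]-oo, t] r)%:E))%E.
    by apply: eq_integral => r _; rewrite /F/= normrM EFinM (ger0_norm (p0 r)).
  by rewrite integralZl// E.
transitivity (\int[mu]_r ((g0 s)%:E *
    ((phi \_ `]0, +oo[) (r - s) * \1_`]-oo, t] r)%:E))%E.
  by apply: eq_integral => r _; rewrite /F/= EFinM.
by rewrite integralZl// E.
Qed.

Let iF : (mu \x mu)%E.-integrable setT F.
Proof.
have [a0 a1] := andP al01.
apply/integrable21ltyP => //.
have -> : (\int[mu]_y \int[mu]_x `|F (x, y)| = \int[mu]_y (`|g0 y| * K (t - y))%:E)%E.
  by apply: eq_integral => s _; rewrite (inner_r s).1.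
apply: (@le_lt_trans _ _ (\int[mu]_y (K t * `|g0 y|)%:E)%E); last first.
  have /integrable_abse/(integrableZl measurableT (K t))/integrable_lty := ig0.
  by apply.
apply: ge0_le_integral => //.
- move=> s _; have [st|ts] := ltP s t.
    by rewrite lee_fin mulr_ge0// K_ge0// subr_ge0 ltW.
  have -> : g0 s = 0 by rewrite /g0 patchE; case: ifPn => // /set_mem; rewrite /= in_itv/=; lra.
  by rewrite normr0 mul0r.
- apply/measurable_EFinP; apply: measurable_funM.
    by apply: measurableT_comp => //; apply/measurable_EFinP; have /measurable_int := ig0.
  exact: measurable_K.
- apply/measurable_EFinP; apply: measurable_funM => //.
  by apply: measurableT_comp => //; apply/measurable_EFinP; have /measurable_int := ig0.
- move=> s _; rewrite lee_fin mulrC.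
  have [st|ts] := boolP (s \in `]0, t[%classic); last first.
    by rewrite /g0 patchE (negbTE ts) normr0 !mulr0.
  rewrite ler_wpM2r//; move: st => /set_mem; rewrite /= in_itv/= => /andP[s0 st].
  rewrite /K lerD// ler_wpM2l ?ge0_ler_powR ?nnegrE//; try lra.
  by rewrite divr_ge0//; lra.
Qed.

Let inner_s r : (\int[mu]_s F (r, s) = (((fun x => a + b * x) \_ `]0, t]) r)%:E)%E.
Proof.
have [t0 tT] := andP t0T.
have [rt|tr] := leP r t; last first.
  rewrite patchE ifF; last by apply/negbTE; rewrite mem_setE in_itv/= negb_and (lt_geF tr) orbT.
  apply: integral0_eq => s _.
  by rewrite /F/= indicE mem_setE in_itv/= (lt_geF tr) !mulr0.
have [r0|r0] := leP r 0.
  rewrite patchE ifF; last by apply/negbTE; rewrite mem_setE in_itv/= negb_and -leNgt r0.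
  apply: integral0_eq => s _; rewrite /F/= /g0 /patch !mem_setE !in_itv/= andbT.
  case: ifP => [/andP[s0 _]|]; last by rewrite mul0r.
  by rewrite subr_gt0 ifF ?mul0r ?mulr0//; apply/negbTE; rewrite -leNgt (le_trans r0)// ltW.
have rT : 0 < r <= T by rewrite r0 (le_trans rt).
rewrite patchE ifT; last by rewrite mem_setE in_itv/= r0.
rewrite -(geq rT) /Rintegral fineK; last exact: integrable_fin_num (gphi rT).
rewrite [RHS]integral_mkcond; apply: eq_integral => s _.
rewrite /F/= /g0 /patch indicE !mem_setE !in_itv/= andbT rt mulr1 subr_gt0.
have [sr|rs] := ltP s r; last by rewrite andbF mulr0.
by rewrite andbT (lt_le_trans sr rt) andbT; case: ifP; rewrite ?mul0r.
Qed.

(** Integrating the equation in time turns its singular kernel into the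
    continuous [kernel_primitive], applied to the derivative [g]. *)
Lemma volterra_identity :
  \int[mu]_(s in `]0, t[) (g s * K (t - s)) = a * t + b * t ^+ 2 / 2.
Proof.
have [t0 tT] := andP t0T.
have := Fubini iF.
have -> : (\int[mu]_y \int[mu]_x F (x, y) = \int[mu]_(s in `]0%R, t[) (g s * K (t - s))%:E)%E.
  rewrite [RHS]integral_mkcond; apply: eq_integral => s _; rewrite (inner_r s).2.
  by rewrite /g0 /patch; case: ifP; rewrite ?mul0r.
have -> : (\int[mu]_x \int[mu]_y F (x, y) = (a * t + b * t ^+ 2 / 2)%:E)%E.
  transitivity (\int[mu]_(r in `[0%R, t]) (a + b * r)%:E)%E.
    rewrite -integral_itv_obnd_cbnd; last first.
      by apply/measurable_EFinP; apply: measurable_funTS; apply: measurable_funD => //; exact: measurable_funM.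
    rewrite [RHS]integral_mkcond; apply: eq_integral => r _; rewrite inner_s.
    by rewrite /patch; case: ifP.
  pose P (r : R) := a * r + b * r ^+ 2 / 2.
  have dP (x : R) : is_derive x 1 P (a + b * x).
    have d1 := is_deriveZ a (is_derive_id x (1 : R)).
    have d2 := is_deriveZ (b / 2) (is_deriveM (is_derive_id x (1 : R)) (is_derive_id x (1 : R))).
    have := is_deriveD d1 d2; rewrite (_ : _ + _ = P); last first.
      apply/funext => r; transitivity (a * r + b / 2 * (r * r)) => //.
      by rewrite /P; field.
    by move=> h; apply: (is_derive_eq h); rewrite /GRing.scale/= !mulr1; field.
  have cP (x : R) : {for x, continuous P}.
    by apply: differentiable_continuous; apply/derivable1_diffP; have [] := dP x.
  rewrite (@continuous_FTC2 R _ P _ _ t0).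
  - by rewrite /P mulr0 expr0n/= mulr0 mul0r addr0 sube0.
  - by apply: continuous_subspaceT => x; apply: cvgD; [exact: cvg_cst|apply: cvgMl_tmp].
  - split; first by move=> x _; have [] := dP x.
      exact/cvg_at_right_filter/cP.
    exact/cvg_at_left_filter/cP.
  - by move=> x _; rewrite derive1E; have dx := dP x; rewrite (@derive_val _ _ _ _ _ _ _ dx).
by rewrite /Rintegral => <-.
Qed.

End fubini.

End volterra.

(** * Convergence of the scheme for a fixed equation *)

Section cells.
Variable R : realType.
Local Notation mu := (@lebesgue_measure R).

Definition cell (d : R) (k : nat) : interval R := `]k%:R * d, k.+1%:R * d].

(** A Riemann-Stieltjes sum against the measure with density g: the error is
    controlled by the L^1 norm of g, which need not be bounded. *)
Lemma cells_estimate (g h : R -> R) (d e : R) (w : nat -> R) n : 0 <= d ->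
  mu.-integrable `]0, n%:R * d] (EFin \o g) ->
  mu.-integrable `]0, n%:R * d] (EFin \o (fun s => g s * h s)) ->
  (forall k s, (k < n)%N -> k%:R * d <= s <= k.+1%:R * d -> `|w k - h s| <= e) ->
  `|\sum_(k < n) w k * (\int[mu]_(s in [set` cell d k]) g s) -
    \int[mu]_(s in `]0, n%:R * d]) (g s * h s)| <=
  e * \int[mu]_(s in `]0, n%:R * d]) `|g s|.
Proof.
move=> d0; elim: n => [|n IH] ig igh wh.
  by rewrite big_ord0 mul0r set_itv_ge ?bnd_simp ?ltxx// !Rintegral_set0 subr0 normr0 mulr0.
have nd : n%:R * d <= n.+1%:R * d by rewrite ler_wpM2r// ler_nat.
have n0 : 0 <= n%:R * d by rewrite mulr_ge0.
have sub : `]0, n%:R * d] `<=` `]0, n.+1%:R * d] by apply: subset_itvl; rewrite bnd_simp.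
have subc : [set` cell d n] `<=` `]0, n.+1%:R * d] by apply: subset_itvr; rewrite bnd_simp.
have ign : mu.-integrable `]0, n%:R * d] (EFin \o g) by exact: integrableS ig.
have ighn : mu.-integrable `]0, n%:R * d] (EFin \o (fun s => g s * h s)) by exact: integrableS igh.
have igc : mu.-integrable [set` cell d n] (EFin \o g) by exact: integrableS ig.
have ighc : mu.-integrable [set` cell d n] (EFin \o (fun s => g s * h s)) by exact: integrableS igh.
have iga : mu.-integrable `]0, n.+1%:R * d] (EFin \o (fun s => `|g s|)) by have := integrable_abse ig.
have igac : mu.-integrable [set` cell d n] (EFin \o (fun s => `|g s|)) by have := integrable_abse igc.
have {}IH := IH ign ighn (fun k s kn => wh k s (ltnW kn)).
have split (f : R -> R) : mu.-integrable `]0, n.+1%:R * d] (EFin \o f) ->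
    \int[mu]_(s in `]0, n.+1%:R * d]) f s =
    \int[mu]_(s in `]0, n%:R * d]) f s + \int[mu]_(s in [set` cell d n]) f s.
  move=> fi; have := Rintegral_itvB (x := n%:R * d) fi; rewrite !bnd_simp => /(_ n0 nd) H.
  by rewrite /cell -H addrC subrK.
rewrite (split _ igh) (split _ iga) big_ord_recr/= mulrDr.
have -> (x y z u : R) : x + y - (z + u) = (x - z) + (y - u) by ring.
apply: le_trans (ler_normD _ _) _; apply: lerD => //.
have iw : mu.-integrable [set` cell d n] (EFin \o (fun s => w n * g s)) by exact: integrable_scale.
rewrite -RintegralZl// -RintegralB//.
have iD : mu.-integrable [set` cell d n] (EFin \o (fun s => w n * g s - g s * h s)).
  exact: integrable_sub.
apply: le_trans (le_normr_Rintegral _ iD) _ => //.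
rewrite -RintegralZl//; apply: le_Rintegral => //.
- by have := integrable_abse iD.
- exact: integrable_scale.
move=> s; rewrite /cell /= in_itv/= => /andP[s1 s2].
rewrite (_ : _ - _ = (w n - h s) * g s); last by ring.
by rewrite normrM ler_wpM2r// wh// s2 ltW.
Qed.

Lemma sum_cells (g : R -> R) (d : R) n : 0 <= d ->
  mu.-integrable `]0, n%:R * d] (EFin \o g) ->
  \sum_(k < n) \int[mu]_(s in [set` cell d k]) g s = \int[mu]_(s in `]0, n%:R * d]) g s.
Proof.
move=> d0 ig; have ig1 : mu.-integrable `]0, n%:R * d] (EFin \o (fun s => g s * 1)).
  by rewrite (_ : (fun s => g s * 1) = g)//; apply/funext => s; rewrite mulr1.
have H : `|\sum_(k < n) 1 * (\int[mu]_(s in [set` cell d k]) g s) -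
    \int[mu]_(s in `]0, n%:R * d]) (g s * 1)| <= 0 * \int[mu]_(s in `]0, n%:R * d]) `|g s|.
  by apply: (cells_estimate (w := fun=> 1) d0 ig ig1) => k s _ _; rewrite subrr normr0.
move: H; rewrite mul0r normr_le0 subr_eq0 => /eqP H.
rewrite (_ : (fun s => g s * 1) = g) in H; last by apply/funext => s; rewrite mulr1.
by rewrite -H; apply: eq_bigr => k _; rewrite mul1r.
Qed.

End cells.

Lemma powR_subadditive (R : realType) (s x y : R) : 0 < s < 1 -> 0 <= x -> 0 <= y ->
  (x + y) `^ s <= x `^ s + y `^ s.
Proof.
move=> /andP[s0 s1] x0 y0; have [xy|xy] := leP (x + y) 0.
  have -> : x + y = 0 by lra.
  by rewrite powR0 ?gt_eqF// addr_ge0 ?powR_ge0.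
have q0 z : 0 <= z -> z <= x + y -> z / (x + y) * (x + y) `^ s <= z `^ s.
  move=> z0 zxy; have h0 : 0 <= z / (x + y) by rewrite divr_ge0// ltW.
  have -> : z `^ s = (z / (x + y)) `^ s * (x + y) `^ s.
    by rewrite -powRM ?(ltW xy)// divfK// gt_eqF.
  rewrite ler_wpM2r ?powR_ge0//.
  have [->|hn0] := eqVneq (z / (x + y)) 0; first by rewrite powR_ge0.
  have hp : 0 < z / (x + y) by rewrite lt_def hn0.
  rewrite -{1}(powRr1 h0) ger_powR ?hp ?ler_pdivrMr ?mul1r//; lra.
have hx := q0 x x0; have hy := q0 y y0.
apply: le_trans (lerD (hx _) (hy _)); [|lra|lra].
by rewrite -mulrDl -mulrDl mulfV ?gt_eqF// mul1r.
Qed.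

Lemma powR_small (R : realType) (s e : R) : 0 < s -> 0 < e ->
  exists2 d0 : R, 0 < d0 & forall d, 0 <= d <= d0 -> d `^ s <= e.
Proof.
move=> s0 e0; exists (e `^ s^-1); first exact: powR_gt0.
move=> d /andP[dd0 dd]; apply: (@le_trans _ _ ((e `^ s^-1) `^ s)).
  by rewrite ge0_ler_powR ?nnegrE ?powR_ge0// ltW.
by rewrite -powRrM mulVf ?gt_eqF// powRr1// ltW.
Qed.

(** The difference of two partial sums controls the average of u over a block
    that ends at N, and slow variation turns the average into the value. *)
Lemma block_average (R : realType) (u : nat -> R) (N L : nat) (E w : R) :
  (0 < L <= N)%N -> `|\sum_(k < N.+1) u k| <= E -> `|\sum_(k < (N - L).+1) u k| <= E ->
  (forall k, (N - L < k <= N)%N -> `|u k - u N| <= w) ->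
  `|u N| <= 2 * E / L%:R + w.
Proof.
move=> /andP[L0 LN] h1 h2 hw; have L1 : 0 < L%:R :> R by rewrite ltr0n.
have hs : \sum_(k < N.+1) u k = \sum_(k < (N - L).+1) u k + \sum_((N - L).+1 <= k < N.+1) u k.
  by rewrite -!(big_mkord xpredT) (@big_cat_nat _ _ _ (N - L).+1)//= ltnS leq_subr.
have hc : \sum_((N - L).+1 <= k < N.+1) (u N : R) = L%:R * u N.
  by rewrite sumr_const_nat subSS subKn// mulr_natl.
have hd : `|\sum_((N - L).+1 <= k < N.+1) (u k - u N)| <= L%:R * w.
  apply: le_trans (ler_norm_sum _ _ _) _.
  rewrite (_ : L%:R * w = \sum_((N - L).+1 <= k < N.+1) w); last first.
    by rewrite sumr_const_nat subSS subKn// mulr_natl.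
  by rewrite !big_nat; apply: ler_sum => k; rewrite ltnS => hk; exact: hw.
rewrite sumrB hc in hd.
have h : `|L%:R * u N| <= 2 * E + L%:R * w.
  rewrite ler_norml; move: h1 h2 hd; rewrite hs !ler_norml; lra.
rewrite -lerBlDr ler_pdivlMr// mulrBl.
by move: h; rewrite normrM (ger0_norm (ltW L1)); lra.
Qed.

Section limit.
Variables (R : realType) (al : R) (sc : scheme al).
Hypothesis al01 : 0 < al < 1.
Variable lam : R.
Hypothesis lam0 : 0 <= lam.
Local Notation mu := (@lebesgue_measure R).
Local Notation fps := (powerseries R).
Local Notation X := (series_X R).
Local Notation C := (@series_cst R).
Local Notation p := (sc_p sc).
Local Notation w := (sc_w sc).

Let G0 := Gamma_gt0 al01.
Let c : R := (Gamma (1 - al))^-1.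
Let c0 : 0 <= c. Proof. by rewrite invr_ge0 ltW. Qed.
Local Notation K := (kernel_primitive al c lam).

(** The symbol d^(-al) w + lam of the scheme with step d, divided by 1 - z
    twice: once because the unknown is the derivative of the solution, once
    (with a factor d) because the equation is integrated in time. *)
Definition discrete_kernel (d : R) : fps :=
  C (d `^ (1 - al)) * (sg (al - 2) * p) + C (lam * d) * sg (-2).

Lemma coef_sgN2 n : coef (sg (-2) : fps) n = n.+1%:R.
Proof.
rewrite (_ : -2 = -1 + -1); last by ring.
rewrite sgD coef_psum (eq_bigr (fun=> 1)); last by move=> i _; rewrite coef_sgN1.
by rewrite sumr_const card_ord.
Qed.

Lemma coef_XsgN3 n : coef (X * sg (-3) : fps) n = n%:R * n.+1%:R / 2.
Proof.
rewrite coef_XM; case: n => [|n]; first by rewrite !mul0r.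
rewrite (_ : -3 = -1 + -2); last by ring.
rewrite sgD coef_psum; elim: n => [|n IH].
  by rewrite big_ord1 coef_sgN2/=; field.
by rewrite big_ord_recr IH/= coef_sgN2 -![in RHS]natr1 -!natr1; field.
Qed.

(** For p = 1 this is Gautschi's inequality; p - 1 is divisible by 1 - z, which
    makes its contribution a bounded multiple of d^(1 - al). *)
Lemma kernel_consistency : exists2 C0 : R, 0 <= C0 & forall d m u, 0 < d ->
  m%:R * d <= u <= m.+1%:R * d ->
  `|coef (discrete_kernel d) m - K u| <= C0 * (d `^ (1 - al) + d).
Proof.
have [a0 a1] := andP al01.
pose pt := sg (-1) * (p - 1).
have lpt : wl1 0 pt.
  apply: wl1_div1X; first by apply: wl1B; [exact: wl1_mono (sc_wl1 sc)|exact: wl1_1].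
  by rewrite -[X in sums _ X](subrr 1); apply: sumsB; [exact: sc_p1|exact: sums1].
have [M M0 hM] := wl1_bound lpt.
pose c' := c / (1 - al); have c'0 : 0 <= c' by rewrite divr_ge0//; lra.
exists (M + 2 * c' + lam); first by rewrite !addr_ge0// mulr_ge0.
move=> d m u d0 /andP[u1 u2].
have u0 : 0 <= u by rewrite (le_trans _ u1)// mulr_ge0// ltW.
have pE : sg (al - 2) * p = sg (al - 2) + sg (al - 1) * pt.
  rewrite /pt (_ : al - 2 = al - 1 + -1); last by ring.
  by rewrite sgD; ring.
have h1 : `|coef (sg (al - 1) * pt) m| <= M.
  rewrite coefM; apply: le_trans (ler_norm_sum _ _ _) _.
  apply: le_trans (hM m); rewrite (reindex_inj rev_ord_inj)/=.
  apply: ler_sum => i _; rewrite subSS subKn ?leq_ord// coef_wabs expr0 mul1r normrM.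
  rewrite ler_piMl// ger0_norm ?coef_sg_ge0; try lra.
  rewrite (le_trans (coef_sg_bound _ al01))// powRN invf_le1 ?powR_gt0//.
  by rewrite -[leLHS](powRr0 (m - i).+1%:R) ler_powR ?ler1n// ltW.
have h2 : `|coef (sg (al - 2)) m - c' * m.+1%:R `^ (1 - al)| <= c'.
  have := coef_sg_Gamma al01 m.
  have gn0 : (1 - al) * Gamma (1 - al) != 0 by rewrite mulf_neq0 ?gt_eqF//; lra.
  have cE : c' * ((1 - al) * Gamma (1 - al)) = 1.
    have al1 : 1 - al != 0 by rewrite gt_eqF//; lra.
    by rewrite /c' /c; field; rewrite al1 gt_eqF.
  move=> /(ler_wpM2l c'0); rewrite mulr1 -[c' in X in X <= _]ger0_norm// -normrM mulrBr.
  by rewrite mulrA cE mul1r.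
have h3 : `|d `^ (1 - al) * m.+1%:R `^ (1 - al) - u `^ (1 - al)| <= d `^ (1 - al).
  rewrite -powRM ?(ltW d0)// mulrC.
  have s0 : 0 <= 1 - al by lra.
  have k1 : u `^ (1 - al) <= (m.+1%:R * d) `^ (1 - al).
    by rewrite ge0_ler_powR ?nnegrE// (le_trans u0).
  have al1 : 0 < 1 - al < 1 by lra.
  have r0 : 0 <= m.+1%:R * d - u by lra.
  have k2 := powR_subadditive al1 u0 r0.
  have rd : m.+1%:R * d - u <= d by move: u1; rewrite -natr1 mulrDl mul1r; lra.
  have k3 : (m.+1%:R * d - u) `^ (1 - al) <= d `^ (1 - al).
    by rewrite ge0_ler_powR ?nnegrE// ltW.
  rewrite ler_norml; move: k2; rewrite addrC subrK; lra.
have h4 : `|m.+1%:R * d - u| <= d.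
  by rewrite ler_norml; move: u1; rewrite -natr1 mulrDl mul1r; lra.
rewrite /discrete_kernel coefD !coef_cstM pE coefD coef_sgN2 /kernel_primitive -/c'.
set e := d `^ (1 - al) in h3 *; have e0 : 0 <= e by exact: powR_ge0.
have -> : e * (coef (sg (al - 2)) m + coef (sg (al - 1) * pt) m) + lam * d * m.+1%:R -
   (c' * u `^ (1 - al) + lam * u) = e * (coef (sg (al - 2)) m - c' * m.+1%:R `^ (1 - al)) +
   e * coef (sg (al - 1) * pt) m + c' * (e * m.+1%:R `^ (1 - al) - u `^ (1 - al)) +
   lam * (m.+1%:R * d - u) by ring.
have t1 : `|e * (coef (sg (al - 2)) m - c' * m.+1%:R `^ (1 - al))| <= e * c'.
  by rewrite normrM (ger0_norm e0) ler_wpM2l.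
have t2 : `|e * coef (sg (al - 1) * pt) m| <= e * M by rewrite normrM (ger0_norm e0) ler_wpM2l.
have t3 : `|c' * (e * m.+1%:R `^ (1 - al) - u `^ (1 - al))| <= c' * e.
  by rewrite normrM (ger0_norm c'0) ler_wpM2l.
have t4 : `|lam * (m.+1%:R * d - u)| <= lam * d by rewrite normrM (ger0_norm lam0) ler_wpM2l.
have q1 : 0 <= (M + 2 * c') * d by rewrite mulr_ge0 ?(ltW d0)// addr_ge0// mulr_ge0.
have q2 : 0 <= lam * e by rewrite mulr_ge0.
move: t1 t2 t3 t4; rewrite !ler_norml; lra.
Qed.

Lemma resolvent_sum : exists2 M : R, 0 <= M & forall (x : R) (A : fps) n, 0 <= x ->
  A * (w + C x) = 1 -> \sum_(k < n.+1) `|coef A k| <= M * n.+1%:R `^ al.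
Proof.
have [a0 a1] := andP al01; have [K1 hK] := resolvent_bound sc al01.
pose P0 := (coef p 0)^-1; have P00 : 0 <= P0 by rewrite invr_ge0 ltW// sc_p_gt0.
exists (P0 + `|K1| * al^-1); first by rewrite addr_ge0// mulr_ge0// invr_ge0 ltW.
move=> x A n x0 AE; rewrite big_ord_recl mulrDl; apply: lerD.
  apply: (le_trans (resolvent0 x0 AE)); rewrite ler_peMr//.
  by rewrite -[leLHS](powRr0 n.+1%:R) ler_powR ?ler1n// ltW.
apply: (@le_trans _ _ (`|K1| * \sum_(k < n.+1) (k.+1%:R : R) `^ (al - 1))); last first.
  by rewrite -mulrA ler_wpM2l// sum_powR_bound.
rewrite mulr_sumr [leRHS]big_ord_recr ler_wpDr ?mulr_ge0 ?powR_ge0//.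
apply: ler_sum => k _; apply: (le_trans (hK _ _ x0 AE _ _)) => //=.
by rewrite ler_wpM2r ?powR_ge0// ler_norm.
Qed.

Section equation.
Variables (T a b : R) (g : R -> R).
Hypothesis T0 : 0 < T.
Hypothesis gT : mu.-integrable `[0, T] (EFin \o g).
Hypothesis gal : forall r, 0 < r <= T ->
  mu.-integrable `]0, r[ (EFin \o (fun s => g s / (r - s) `^ al)).
Hypothesis geq : forall r, 0 < r <= T ->
  c * \int[mu]_(s in `]0, r[) (g s / (r - s) `^ al) +
  lam * \int[mu]_(s in `[0, r]) g s = a + b * r.

Let y (t : R) : R := \int[mu]_(s in `[0, t]) g s.

Let gI (i : interval R) : [set` i] `<=` `[0, T] -> mu.-integrable [set` i] (EFin \o g).
Proof. by move=> h; apply: integrableS gT. Qed.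

Let goc t : t <= T -> mu.-integrable `]0, t] (EFin \o g).
Proof. by move=> tT; apply: gI; apply: subset_itv; rewrite bnd_simp. Qed.

Let yE t : t <= T -> y t = \int[mu]_(s in `]0, t]) g s.
Proof. by move=> tT; rewrite /y Rintegral_itv_obnd_cbnd//; exact: goc. Qed.

Let integrated t : 0 < t <= T ->
  \int[mu]_(s in `]0, t]) (g s * K (t - s)) = a * t + b * t ^+ 2 / 2 /\
  mu.-integrable `]0, t] (EFin \o (fun s => g s * K (t - s))).
Proof.
move=> /andP[t0 tT]; have [a0 a1] := andP al01.
have goo r : r <= T -> mu.-integrable `]0, r[ (EFin \o g).
  by move=> rT; apply: gI; apply: subset_itv; rewrite bnd_simp.
have E r : (fun s => g s * kernel_density al c lam (r - s)) =
    (fun s => c * (g s / (r - s) `^ al) + lam * g s).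
  by apply/funext => s; rewrite /kernel_density powRN; ring.
have i1 r : 0 < r <= T -> mu.-integrable `]0, r[
    (EFin \o (fun s => g s * kernel_density al c lam (r - s))).
  move=> r0T; have /andP[r0 rT] := r0T.
  rewrite E.
  apply: integrable_add => //; apply: integrable_scale => //.
    exact: gal.
  exact: goo.
have eq1 r : 0 < r <= T ->
    \int[mu]_(s in `]0, r[) (g s * kernel_density al c lam (r - s)) = a + b * r.
  move=> r0T; have /andP[r0 rT] := r0T.
  rewrite -(geq r0T) -/(y r) yE// -Rintegral_itv_bndo_bndc ?goo//.
  have j1 := gal r0T; have j2 := goo r rT.
  rewrite -RintegralZl// -[lam * _]RintegralZl// -RintegralD//.
  - by rewrite E.
  - exact: integrable_scale.
  - exact: integrable_scale.
have iK : mu.-integrable `]0, t] (EFin \o (fun s => g s * K (t - s))).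
  have iab := integrable_abse (goc tT).
  have iKt : mu.-integrable `]0, t] (EFin \o (fun s => K t * `|g s|)) by exact: integrable_scale.
  apply: le_integrable iKt => //.
    apply/measurable_EFinP; apply: measurable_funM.
      by apply/measurable_EFinP; have /measurable_int := goc tT.
    apply: measurable_funTS; apply: measurable_funD; apply: measurable_funM => //.
      by apply: (measurableT_comp (measurable_powR _)); exact: measurable_funB.
    exact: measurable_funB.
  move=> s; rewrite /= in_itv/= => /andP[s0 st]; rewrite lee_fin !normrM normr_id mulrC.
  have ts0 : 0 <= t - s by lra.
  have k1 : 0 <= c / (1 - al) by rewrite divr_ge0//; lra.
  have k2 : 0 <= K (t - s) by apply: addr_ge0; apply: mulr_ge0 => //; exact: powR_ge0.
  have k3 : K (t - s) <= K t.
    rewrite /kernel_primitive lerD ?ler_wpM2l ?ge0_ler_powR ?nnegrE//; lra.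
  by rewrite ler_wpM2r// !ger0_norm// (le_trans k2).
split => //.
rewrite -Rintegral_itv_bndo_bndc; last first.
  by apply: integrableS iK => //; apply: subset_itvl; rewrite bnd_simp.
apply: (volterra_identity al01 c0 lam0 gT i1 eq1); exact/andP.
Qed.

(** Y samples the solution, and V is the numerical solution but for its
    oscillating part. *)
Let cells (d : R) : fps := Series (fun k => \int[mu]_(s in [set` cell d k]) g s).
Let Y (d : R) : fps := X * (sg (-1) * cells d).
Let V (d : R) (A : fps) : fps :=
  C (d `^ al) * ((C a * sg (-1) + C (b * d) * X * sg (-2)) * A).

Let coef_Y d k : 0 <= d -> k%:R * d <= T -> coef (Y d) k = y (k%:R * d).
Proof.
move=> d0 kT; rewrite coef_XM; case: k kT => [|k] kT.
  by rewrite mul0r /y set_itv1 Rintegral_set1.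
by rewrite coef_psum yE// -sum_cells//; exact: goc.
Qed.

(** What is left of the integrated discrete equation when the solution is
    inserted into it. *)
Let residual (d : R) : fps := X * (discrete_kernel d * cells d) -
  (C (a * d) * sg (-2) + C (b * d ^+ 2) * (X * sg (-3))).

Let residual_bound : exists2 C1 : R, 0 <= C1 & forall d n, 0 < d -> n%:R * d <= T ->
  `|coef (residual d) n| <= C1 * (d `^ (1 - al) + d).
Proof.
have [C0 C00 hC0] := kernel_consistency.
pose M := \int[mu]_(s in `[0, T]) `|g s|.
have M0 : 0 <= M by apply: Rintegral_ge0.
exists (C0 * M + `|a| + `|b| * T); first by rewrite !addr_ge0 ?mulr_ge0 ?(ltW T0).
move=> d n d0 nT; rewrite /residual coefB coefD !coef_cstM coef_XsgN3 coef_sgN2.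
have e0 : 0 <= d `^ (1 - al) by exact: powR_ge0.
case: n nT => [|m] nT.
  rewrite coef_XM !mul0r mulr0 addr0 sub0r normrN mulr1 normrM (gtr0_norm d0).
  have q1 : 0 <= (C0 * M + `|b| * T) * d by rewrite mulr_ge0 ?addr_ge0 ?mulr_ge0 ?(ltW T0) ?(ltW d0).
  have q2 : 0 <= (C0 * M + `|a| + `|b| * T) * d `^ (1 - al).
    by rewrite mulr_ge0 ?addr_ge0 ?mulr_ge0 ?(ltW T0).
  by lra.
set t := m.+1%:R * d in nT *.
have t0 : 0 < t by rewrite mulr_gt0.
have t0T : 0 < t <= T by rewrite t0.
have [I1 I2] := integrated t0T.
have gt := goc nT.
have h1 : `|coef (X * (discrete_kernel d * cells d)) m.+1 - (a * t + b * t ^+ 2 / 2)| <=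
    C0 * (d `^ (1 - al) + d) * M.
  rewrite coef_XM coefMr -I1.
  apply: (@le_trans _ _ (C0 * (d `^ (1 - al) + d) * \int[mu]_(s in `]0, t]) `|g s|)).
    apply: (cells_estimate (w := fun k => coef (discrete_kernel d) (m - k)) (ltW d0) gt I2).
    move=> k s; rewrite ltnS => km /andP[s1 s2]; apply: hC0 => //.
    move: s1 s2; rewrite /t -!natr1 natrB// => s1 s2; apply/andP; split; lra.
  rewrite ler_wpM2l ?mulr_ge0 ?addr_ge0 ?(ltW d0)// /M /Rintegral fine_le//.
  - have := integrable_abse gt; exact: integrable_fin_num.
  - have := integrable_abse gT; exact: integrable_fin_num.
  apply: ge0_subset_integral => //.
  - by have /integrable_abse/measurable_int := gT.
  - by apply: subset_itv; rewrite bnd_simp.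
have hb : `|b * (t * d) / 2| <= `|b| * T * d.
  have td0 : 0 <= t * d by rewrite mulr_ge0// ltW.
  have tdT : t * d <= T * d by rewrite ler_wpM2r// ltW.
  rewrite -mulrA normrM -mulrA ler_wpM2l// ger0_norm; lra.
set Z := coef _ _ in h1 *.
have E : Z - (a * d * m.+2%:R + b * d ^+ 2 * (m.+1%:R * m.+2%:R / 2)) =
    (Z - (a * t + b * t ^+ 2 / 2)) - a * d - b * (t * d) / 2.
  by rewrite /t -(natr1 m.+1); field.
rewrite E.
have ha : `|a * d| <= `|a| * d by rewrite normrM (gtr0_norm d0).
have q2 : 0 <= (`|a| + `|b| * T) * d `^ (1 - al) by rewrite mulr_ge0 ?addr_ge0 ?mulr_ge0 ?(ltW T0).
have := ler_normB (Z - (a * t + b * t ^+ 2 / 2) - a * d) (b * (t * d) / 2).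
have := ler_normB (Z - (a * t + b * t ^+ 2 / 2)) (a * d).
lra.
Qed.

(** The equation was integrated once, so its residual, divided by the symbol,
    gives the partial sums of the error rather than the error itself. *)
Let partial_sum_bound : exists2 C2 : R, 0 <= C2 & forall d (A : fps) n, 0 < d -> d <= T ->
  n%:R * d <= T -> A * (w + C (lam * d `^ al)) = 1 ->
  d * `|\sum_(k < n.+1) coef (Y d - V d A) k| <= C2 * (d `^ (1 - al) + d).
Proof.
have [a0 a1] := andP al01.
have [C1 C10 hC1] := residual_bound; have [M M0 hM] := resolvent_sum.
exists (M * (2 * T) `^ al * C1); first by rewrite !mulr_ge0// powR_ge0.
move=> d A n d0 dT nT AE; have x0 : 0 <= lam * d `^ al by rewrite mulr_ge0 ?powR_ge0.
set e := d `^ (1 - al); have e0 : 0 <= e by exact: powR_ge0.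
have ed : e * d `^ al = d by rewrite -powRD_gt0// subrK powRr1// ltW.
have kE : discrete_kernel d = C e * (sg (-1) * sg (-1)) * (w + C (lam * d `^ al)).
  rewrite /discrete_kernel -/e /sc_w (_ : al - 2 = al + (-1 + -1)); last by ring.
  rewrite !sgD (_ : -2 = -1 + -1); last by ring.
  rewrite sgD (_ : lam * d = e * (lam * d `^ al)); last by rewrite mulrCA ed.
  by rewrite (rmorphM C e); ring.
have QE : C e * (sg (-1) * (Y d - V d A)) = A * residual d.
  rewrite /residual /Y /V kE (_ : -3 = -1 + -2); last by ring.
  rewrite !sgD (_ : -2 = -1 + -1); last by ring.
  rewrite !sgD expr2.
  have -> : C (a * d) = C e * C (d `^ al) * C a by rewrite -!rmorphM ed mulrC.
  have -> : C (b * (d * d)) = C e * C (d `^ al) * C b * C d by rewrite -!rmorphM ed; congr C; ring.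
  rewrite (rmorphM C b d).
  move: AE; set W := w + _ => AE.
  transitivity (C e * (sg (-1) * (X * (sg (-1) * cells d))) * (A * W) -
     C e * (sg (-1) * (C (d `^ al) * ((C a * sg (-1) + C b * C d * X * (sg (-1) * sg (-1))) * A)))).
    by rewrite AE; ring.
  ring.
have h : `|coef (A * residual d) n| <= M * n.+1%:R `^ al * (C1 * (e + d)).
  rewrite coefM; apply: le_trans (ler_norm_sum _ _ _) _.
  apply: (@le_trans _ _ (\sum_(i < n.+1) `|coef A i| * (C1 * (e + d)))).
    apply: ler_sum => i _; rewrite normrM ler_wpM2l// hC1//.
    by rewrite (le_trans _ nT)// ler_wpM2r ?(ltW d0)// ler_nat leq_subr.
  rewrite -mulr_suml ler_wpM2r ?mulr_ge0 ?addr_ge0 ?(ltW d0)//.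
  exact: hM x0 AE.
rewrite -coef_psum -{1}ed -[e]ger0_norm// mulrAC -normrM -coef_cstM QE mulrC.
apply: (@le_trans _ _ (d `^ al * (M * n.+1%:R `^ al * (C1 * (e + d))))).
  by rewrite ler_wpM2l ?powR_ge0.
rewrite (ger0_norm e0) !mulrA ler_wpM2r ?addr_ge0 ?(ltW d0)// ler_wpM2r//.
rewrite -mulrA mulrCA ler_wpM2l// -powRM ?(ltW d0)//.
rewrite ge0_ler_powR ?nnegrE ?mulr_ge0 ?(ltW d0) ?(ltW a0) ?(ltW T0)//.
by rewrite -natr1 mulrDr mulr1; lra.
Qed.

(** The discrete solution is Lipschitz in time away from 0: multiplication by
    1 - z brings it down to the resolvent and its sums. *)
Let increment_bound (s : R) : 0 < s -> exists2 C3 : R, 0 <= C3 & forall d (A : fps) k, 0 < d ->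
  s <= k.+1%:R * d <= T -> A * (w + C (lam * d `^ al)) = 1 ->
  `|coef (V d A) k.+1 - coef (V d A) k| <= C3 * d.
Proof.
have [a0 a1] := andP al01.
have [K1 hK] := resolvent_bound sc al01; have [M M0 hM] := resolvent_sum => s0.
exists (`|a| * (`|K1| * s `^ (al - 1)) + `|b| * (M * T `^ al)).
  by rewrite addr_ge0 ?mulr_ge0 ?powR_ge0.
move=> d A k d0 /andP[sk kT] AE.
have x0 : 0 <= lam * d `^ al by rewrite mulr_ge0 ?powR_ge0.
have -> : coef (V d A) k.+1 - coef (V d A) k =
    d `^ al * (a * coef A k.+1 + b * d * \sum_(i < k.+1) coef A i).
  have -> : coef (V d A) k.+1 - coef (V d A) k = coef ((1 - X) * V d A) k.+1.
    by rewrite mulrBl mul1r coefB coef_XM.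
  have -> : (1 - X) * V d A = C (d `^ al) * (C a * A + C (b * d) * (X * (sg (-1) * A))).
    rewrite /V (_ : -2 = -1 + -1); last by ring.
    rewrite sgD; move: (@sgN1K R); set W := sg (-1) => E.
    transitivity (C (d `^ al) * (C a * ((1 - X) * W) * A + C (b * d) * X * W * ((1 - X) * W) * A)).
      ring.
    by rewrite E; ring.
  by rewrite coef_cstM coefD !coef_cstM coef_XM coef_psum.
have h1 : d `^ al * `|coef A k.+1| <= `|K1| * s `^ (al - 1) * d.
  apply: (@le_trans _ _ (d `^ al * (`|K1| * k.+1%:R `^ (al - 1)))).
    rewrite ler_wpM2l ?powR_ge0// (le_trans (hK _ _ x0 AE _ _))//.
    by rewrite ler_wpM2r ?powR_ge0// ler_norm.
  have -> : d `^ al = d * d `^ (al - 1).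
    by rewrite -{2}(powRr1 (ltW d0)) -powRD_gt0// addrC subrK.
  have -> : d * d `^ (al - 1) * (`|K1| * k.+1%:R `^ (al - 1)) =
      `|K1| * (k.+1%:R * d) `^ (al - 1) * d.
    by rewrite powRM ?(ltW d0)//; ring.
  rewrite ler_wpM2r ?(ltW d0)// ler_wpM2l//.
  have E (z : R) : z `^ (al - 1) = (z `^ (1 - al))^-1 by rewrite -powRN opprB.
  rewrite !E lef_pV2 ?posrE ?powR_gt0 ?(lt_le_trans s0)//.
  by rewrite ge0_ler_powR ?nnegrE ?(ltW s0)//; lra.
have h2 : d `^ al * `|\sum_(i < k.+1) coef A i| <= M * T `^ al.
  apply: (@le_trans _ _ (d `^ al * (M * k.+1%:R `^ al))).
    rewrite ler_wpM2l ?powR_ge0//; apply: le_trans (ler_norm_sum _ _ _) _.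
    exact: hM x0 AE.
  rewrite mulrCA ler_wpM2l// -powRM ?(ltW d0)// mulrC.
  by rewrite ge0_ler_powR ?nnegrE ?(ltW a0) ?(ltW T0) ?mulr_ge0 ?(ltW d0).
rewrite normrM (ger0_norm (powR_ge0 _ _)) mulrDl.
apply: (@le_trans _ _ (`|a| * (d `^ al * `|coef A k.+1|) +
    `|b| * (d `^ al * `|\sum_(i < k.+1) coef A i|) * d)).
  rewrite (_ : `|a| * _ + _ = d `^ al * (`|a * coef A k.+1| + `|b * d * \sum_(i < k.+1) coef A i|)).
    by rewrite ler_wpM2l ?powR_ge0// ler_normD.
  by rewrite !normrM (gtr0_norm d0); ring.
rewrite lerD//; first by rewrite -[leRHS]mulrA ler_wpM2l.
by rewrite ler_wpM2r ?(ltW d0)// ler_wpM2l.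
Qed.

Let y_left_continuous t e : 0 < t <= T -> 0 < e ->
  exists2 h : R, 0 < h & forall s, s <= t -> t - s <= h -> `|y s - y t| <= e.
Proof.
move=> /andP[t0 tT] e0.
have gt : mu.-integrable `[0, t] (EFin \o g).
  by apply: gI; apply: subset_itv; rewrite bnd_simp.
have /cvgrPdist_le /(_ _ e0) := parameterized_integral_cvg_at_left t0 gt.
rewrite /at_left /within /= => /nbhs_ballP[h /= h0 H].
exists (h / 2); first by rewrite divr_gt0.
move=> s st ts; have [->|ne] := eqVneq s t; first by rewrite subrr normr0 ltW.
rewrite distrC; apply: H; last by rewrite lt_neqAle ne.
by rewrite /ball/= ger0_norm; lra.
Qed.

(** Partial sums of the error, times the step, tend to zero, and both the
    solution and the numerical solution vary little over a short time interval
    of length eta before t. Averaging over that interval shows that the error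
    at t is small; the oscillating part is of the order of the step to the
    power al. *)
Lemma numerical_converges (tau : R) (A : nat -> fps) n : 0 < tau -> (0 < n)%N -> n%:R * tau <= T ->
  (forall j, A j * (w + C (lam * level tau j `^ al)) = 1) ->
  forall e, 0 < e -> exists j,
    `|coef (numerical al (level tau j) a b (A j)) (n * 2 ^ j) -
      \int[mu]_(s in `[0, n%:R * tau]) g s| <= e.
Proof.
have [a0 a1] := andP al01.
move=> tau0 n0 nT AE e e0; rewrite -/(y _); set t := n%:R * tau.
have n1 : 1 <= n%:R :> R by rewrite ler1n.
have t0 : 0 < t by rewrite mulr_gt0// ltr0n.
have e4 : 0 < e / 4 by lra.
have t0T : 0 < t <= T by rewrite t0.
have [h h0 hy] := y_left_continuous t0T e4.
have t20 : 0 < t / 2 by lra.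
have [C3 C30 hC3] := increment_bound t20.
have [C2 C20 hC2] := partial_sum_bound.
have [Ko hKo] := oscillation_bound sc al01.
have lev0 j : 0 < level tau j by rewrite divr_gt0// exprn_gt0.
have levS i m : level tau (i + m) = level tau i / 2 ^+ m.
  by rewrite /level exprD invfM mulrA.
have lev_le i m : level tau (i + m) <= level tau m.
  by rewrite addnC levS ler_pdivrMr ?exprn_gt0// ler_peMr ?(ltW (lev0 m))// exprn_ege1// ler1n.
have small d0 : 0 < d0 -> exists m, level tau m <= d0.
  move=> d00; exists (Num.bound (tau / d0)).
  have hb := archi_boundP (divr_ge0 (ltW tau0) (ltW d00)).
  rewrite /level ler_pdivrMr ?exprn_gt0// mulrC -ler_pdivrMr// (le_trans (ltW hb))//.
  by rewrite -natrX ler_nat ltnW// ltn_expl.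
pose e1 := Num.min h (e / 4 / (C3 + 1)).
have e10 : 0 < e1 by rewrite lt_min h0 divr_gt0//; lra.
have [i0 hi0] := small _ e10.
pose i := i0.+1; pose eta := level tau i; have eta0 : 0 < eta by exact: lev0.
have etah : eta <= e1 by rewrite (le_trans _ hi0)// /eta /i -add1n lev_le.
have eta_h : eta <= h by rewrite (le_trans etah)// ge_min lexx.
have eta_C : C3 * eta <= e / 4.
  have : eta <= e / 4 / (C3 + 1) by rewrite (le_trans etah)// ge_min lexx orbT.
  by rewrite ler_pdivlMr; lra.
have eta_t : eta <= t / 2.
  have lt : level tau i0 <= tau by rewrite -[i0]addn0 (le_trans (lev_le _ _))// /level expr0 divr1.
  have : eta = level tau i0 / 2 by rewrite /eta /i -addn1 levS expr1.
  have : tau <= t by rewrite /t ler_peMl// ltW.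
  lra.
(* Once eta is fixed, the step is taken so small that the average of the error
   over the interval, at most 2 C2 (d^(1-al) + d) / eta, is below e / 4. *)
pose q := e * eta / (16 * (C2 + 1)).
have q0 : 0 < q by rewrite divr_gt0 ?mulr_gt0//; lra.
have al1 : 0 < 1 - al by lra.
have [d1 d10 hd1] := powR_small al1 q0.
pose r := e / 4 / (`|a| * `|Ko| + 1).
have r0 : 0 < r by rewrite divr_gt0// ltr_wpDl// mulr_ge0.
have [d2 d20 hd2] := powR_small a0 r0.
have [m hm] : exists m, level tau m <= Num.min q (Num.min d1 d2).
  by apply: small; rewrite !lt_min q0 d10.
pose j := (i + m)%N; exists j; pose d := level tau j.
have d0 : 0 < d by exact: lev0.
have dm : d <= Num.min q (Num.min d1 d2) by rewrite (le_trans (lev_le _ _)).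
move: dm; rewrite !le_min => /and3P[dq dd1 dd2].
have Nd : (n * 2 ^ j)%:R * d = t.
  by rewrite natrM natrX /d /level -mulrA [X in _ * X]mulrC divfK// expf_neq0.
have Ld : (2 ^ m)%:R * d = eta.
  by rewrite natrX /d /j levS mulrC divfK// expf_neq0.
pose N := (n * 2 ^ j)%N; pose L := (2 ^ m)%N.
have L0 : (0 < L)%N by rewrite expn_gt0.
have LN : (L <= N)%N.
  by rewrite /L /N /j expnD mulnA leq_pmull// muln_gt0 n0 expn_gt0.
have dT : d <= T.
  rewrite (le_trans _ nT)// -/t -Nd ler_peMl ?(ltW d0)// ler1n muln_gt0 n0 expn_gt0//.
pose u k := coef (Y d - V d (A j)) k.
have hu : `|u N| <= 2 * (C2 * (d `^ (1 - al) + d) / d) / L%:R + (e / 4 + e / 4).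
  have ps k : (k <= N)%N -> `|\sum_(i < k.+1) u i| <= C2 * (d `^ (1 - al) + d) / d.
    move=> kN; rewrite ler_pdivlMr// mulrC; apply: hC2 => //.
    by rewrite (le_trans _ nT)// -/t -Nd ler_wpM2r ?(ltW d0)// ler_nat.
  apply: block_average; rewrite ?L0//; [exact: ps|by apply: ps; exact: leq_subr|].
  move=> k /andP[kL kN].
  have kd : k%:R * d <= t by rewrite -Nd ler_wpM2r ?(ltW d0)// ler_nat.
  have tkL (k' : nat) : (N - L <= k')%N -> t - eta <= k'%:R * d.
    move=> hk; rewrite -Nd -Ld -mulrBl ler_wpM2r ?(ltW d0)// -natrB// ler_nat//.
  rewrite /u !coefB.
  rewrite (_ : _ - _ - _ = coef (Y d) k - coef (Y d) N - (coef (V d (A j)) k - coef (V d (A j)) N)); last by ring.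
  apply: le_trans (ler_normB _ _) _; apply: lerD.
    rewrite !coef_Y ?(ltW d0) ?Nd//; last by rewrite (le_trans kd).
    by apply: hy => //; have := tkL k (ltnW kL); lra.
  have tel (x : nat) : (x <= L)%N -> `|coef (V d (A j)) (N - x) - coef (V d (A j)) N| <= x%:R * (C3 * d).
    elim: x => [|x IH] xL; first by rewrite subn0 subrr normr0 mul0r.
    have NxE : (N - x)%N = (N - x.+1).+1.
      by rewrite subnS prednK// subn_gt0 (leq_trans xL).
    rewrite -natr1 mulrDl mul1r; apply: (le_trans (ler_distD (coef (V d (A j)) (N - x)) _ _)).
    rewrite addrC lerD ?IH 1?ltnW// distrC {1}NxE; apply: hC3 => //.
    rewrite -NxE; have := tkL (N - x)%N (leq_sub2l _ (ltnW xL)).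
    have : (N - x)%:R * d <= t by rewrite -Nd ler_wpM2r ?(ltW d0)// ler_nat leq_subr.
    by have := nT; rewrite -/t; lra.
  have kL' : (N - k <= L)%N by rewrite leq_subLR addnC -leq_subLR ltnW.
  have := tel _ kL'; rewrite subKn// => H; apply: (le_trans H).
  apply: le_trans eta_C; rewrite mulrCA ler_wpM2l// -Ld ler_wpM2r ?(ltW d0)// ler_nat//.
have uE : u N = y t - coef (V d (A j)) N.
  by rewrite /u coefB coef_Y ?(ltW d0)// /N Nd.
have numE : coef (numerical al d a b (A j)) N = coef (V d (A j)) N - d `^ al * (a * coef (rh (-1) * A j) N).
  rewrite -!coef_cstM -coefB; congr (coef _ _); rewrite /numerical /V; ring.
have osc : `|d `^ al * (a * coef (rh (-1) * A j) N)| <= e / 4.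
  rewrite !normrM (ger0_norm (powR_ge0 _ _)).
  have x0 : 0 <= lam * d `^ al by rewrite mulr_ge0 ?powR_ge0.
  have N0 : (0 < N)%N by rewrite muln_gt0 n0 expn_gt0.
  have hk : `|coef (rh (-1) * A j) N| <= `|Ko|.
    by rewrite (le_trans (hKo _ _ x0 (AE j) _ N0))// ler_norm.
  apply: (@le_trans _ _ (r * (`|a| * `|Ko|))).
    apply: ler_pM; rewrite ?powR_ge0 ?mulr_ge0 ?ler_wpM2l//.
    by apply: hd2; rewrite (ltW d0).
  have k0 : 0 <= `|a| * `|Ko| by rewrite mulr_ge0.
  by rewrite /r mulrAC ler_pdivrMr; nra.
have small2 : 2 * (C2 * (d `^ (1 - al) + d) / d) / L%:R <= e / 4.
  have -> : 2 * (C2 * (d `^ (1 - al) + d) / d) / L%:R = 2 * C2 * (d `^ (1 - al) + d) / eta.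
    by rewrite -Ld; field; rewrite gt_eqF// gt_eqF// ltr0n.
  have dd : d `^ (1 - al) <= q by apply: hd1; rewrite (ltW d0).
  have dd0 : 0 <= d `^ (1 - al) by exact: powR_ge0.
  rewrite ler_pdivrMr//.
  have qE : q * (C2 + 1) = e * eta / 16 by rewrite /q; field; lra.
  have : C2 * (d `^ (1 - al) + d) <= (C2 + 1) * (q + q) by apply: ler_pM => //; [lra|lra|lra].
  move: qE; have := e0; lra.
rewrite -/N numE; move: hu; rewrite uE; move: small2 osc; rewrite !ler_norml; lra.
Qed.

End equation.

End limit.

(** * Scalar equations *)

Section scalar.
Variables (R : realType) (al : R) (gf : generating_formula) (wt : nat -> R).
Hypothesis al01 : 0 < al < 1.
Hypothesis hwt : has_power_series (generating_function al gf) wt.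
Local Notation mu := (@lebesgue_measure R).
Local Notation fps := (powerseries R).
Local Notation X := (series_X R).
Local Notation C := (@series_cst R).

Let a0 : 0 < al. Proof. by case/andP: al01. Qed.
Let a1 : al < 1. Proof. by case/andP: al01. Qed.
Let sc := scheme_of a0 a1 gf.
Local Notation w := (sc_w sc).

Let wtE : wt = coef w.
Proof. exact: weights_of_generating_function. Qed.

Let resolvent (x : R) : 0 <= x -> {A : fps | A * (w + C x) = 1}.
Proof.
move=> x0; have [|A hA] := @series_inverse _ (w + C x); last by exists A; rewrite mulrC.
rewrite coefD coef_cst /sc_w coefM big_ord1 coef_sg0 mul1r gt_eqF//.
by rewrite ltr_wpDr// sc_p_gt0.
Qed.

Let coef_1X (F : fps) n : coef ((1 + X) * F) n = coef F n + (if n is m.+1 then coef F m else 0).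
Proof. by rewrite mulrDl mul1r coefD coef_XM; case: n. Qed.

Definition load (tau a b : R) : fps := C a * sg (-1) + C (b * tau) * X * sg (-2).

Lemma coef_load tau a b n : coef (load tau a b) n = a + b * (n%:R * tau).
Proof.
rewrite /load coefD -mulrA !coef_cstM coef_sgN1 coef_XM.
by case: n => [|n]; rewrite ?coef_sgN2; ring.
Qed.

(** The equations only hold up to the index N, so the computation with
    generating functions is carried out modulo higher orders: the series S
    collects the equations and has no coefficients up to order n. *)
Lemma scheme_numerical (tau lam a b : R) (A : fps) (W : nat -> R) N : 0 < tau ->
  A * (w + C (lam * tau `^ al)) = 1 -> W 0 = 0 ->
  (forall n, (0 < n <= N)%N ->
    discrete_derivative al tau wt W n + 2^-1 * (lam * W n + lam * W n.-1) =
    2^-1 * ((a + b * (n%:R * tau)) + (a + b * (n.-1%:R * tau)))) ->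
  forall n, (n <= N)%N -> W n = coef (numerical al tau a b A) n.
Proof.
move=> tau0 AE W0 hW n nN.
pose F : fps := Series W; pose f := load tau a b.
pose S := (1 + X) * ((C (tau `^ (- al)) * w + C lam) * F - f) + C a.
have S0 k : (k <= n)%N -> coef S k = 0.
  move=> kn; rewrite /S coefD coef_1X coef_cst; case: k kn => [|k] kn.
    rewrite coefB coef_load mul0r mulr0 addr0 coefM big_ord1 /=.
    by rewrite [coef F 0]W0 mulr0 sub0r !addr0 addNr.
  rewrite addr0; have := hW k.+1; rewrite ltn0Sn (leq_trans kn nN) => /(_ isT).
  have -> : discrete_derivative al tau wt W k.+1 =
      2^-1 * tau `^ (- al) * (coef (w * F) k.+1 + coef (w * F) k).
    rewrite /discrete_derivative -mulrA [RHS]mulrCA; congr (_ * _).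
    have -> : coef (w * F) k.+1 + coef (w * F) k = coef ((1 + X) * w * F) k.+1.
      by rewrite -mulrA coef_1X.
    rewrite coefMr mulr_sumr; apply: eq_bigr => i _; rewrite mulrA; congr (_ * _).
    by rewrite /averaged_weights wtE coef_1X mulrDr.
  have cE i : coef ((C (tau `^ (- al)) * w + C lam) * F - f) i =
      tau `^ (- al) * coef (w * F) i + lam * W i - (a + b * (i%:R * tau)).
    by rewrite coefB coef_load mulrDl coefD -mulrA !coef_cstM.
  by rewrite !cE /=; lra.
have E : F - numerical al tau a b A = S * (rh (-1) * C (tau `^ al) * A).
  rewrite /S /numerical -/f.
  have rK : rh (-1) * (1 + X) = 1 :> fps by rewrite -rh1 mulrC rhNK.
  have tK : C (tau `^ al) * C (tau `^ (- al)) = 1.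
    by rewrite -rmorphM -powRD_gt0// subrr powRr0 rmorph1.
  have -> : C lam = C (tau `^ (- al)) * C (lam * tau `^ al).
    by rewrite -rmorphM mulrCA -powRD_gt0// addNr powRr0 mulr1.
  move: AE rK tK; rewrite /f /load.
  set x := C (lam * _); set r := rh (-1); set t := C (tau `^ al); set t' := C (tau `^ (- al)).
  move=> AE rK tK.
  transitivity ((r * (1 + X)) * (t * t') * (A * (w + x)) * F
    - (r * (1 + X)) * t * (C a * sg (-1) + C (b * tau) * X * sg (-2)) * A + C a * r * t * A); last by ring.
  rewrite AE rK tK; ring.
have : coef (F - numerical al tau a b A) n = 0 by rewrite E; exact: coefM_low.
by rewrite coefB => /eqP; rewrite subr_eq0 => /eqP.
Qed.

(** One constant serves all parameters lam >= 0: convergence of the refinements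
    holds at a rate that depends on lam, but enters refinement_bound only
    qualitatively. *)
Theorem scalar_error : exists2 K : R, 0 < K &
  forall (T lam a b tau : R) (g : R -> R) (W : nat -> R) N n,
  0 < tau -> 0 <= lam -> N%:R * tau <= T ->
  mu.-integrable `[0, T] (EFin \o g) ->
  (forall r, 0 < r <= T ->
    mu.-integrable `]0, r[ (EFin \o (fun s => g s / (r - s) `^ al))) ->
  (forall r, 0 < r <= T ->
    (Gamma (1 - al))^-1 * \int[mu]_(s in `]0, r[) (g s / (r - s) `^ al) +
    lam * \int[mu]_(s in `[0, r]) g s = a + b * r) ->
  W 0 = 0 ->
  (forall n, (0 < n <= N)%N ->
    discrete_derivative al tau wt W n + 2^-1 * (lam * W n + lam * W n.-1) =
    2^-1 * ((a + b * (n%:R * tau)) + (a + b * (n.-1%:R * tau)))) ->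
  (0 < n <= N)%N ->
  `|\int[mu]_(s in `[0, n%:R * tau]) g s - W n| <=
  K * (`|a| * tau `^ al + `|b| * (tau ^+ 2 * (n%:R * tau) `^ (al - 1))).
Proof.
have [K K0 hK] := refinement_bound sc al01 (sums_rh a0 a1).
exists K => // T lam a b tau g W N n tau0 lam0 NT gT gal geq W0 hW /andP[n0 nN].
have x0 j : 0 <= lam * level tau j `^ al by rewrite mulr_ge0 ?powR_ge0.
pose A j := sval (resolvent (x0 j)).
have AE j : A j * (w + C (lam * level tau j `^ al)) = 1 by exact: svalP (resolvent (x0 j)).
have nT : n%:R * tau <= T by rewrite (le_trans _ NT)// ler_wpM2r ?(ltW tau0)// ler_nat.
have T0 : 0 < T by rewrite (lt_le_trans _ nT)// mulr_gt0// ltr0n.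
have l0 : level tau 0 = tau by rewrite /level expr0 divr1.
have A0 := AE 0; rewrite l0 in A0.
rewrite (scheme_numerical tau0 A0 W0 hW nN) distrC.
apply: hK (AE) _ => //.
exact: (numerical_converges al01 lam0 T0 gT gal geq tau0 n0 nT AE).
Qed.

End scalar.

(** * Lebesgue measure on row vectors *)

Section measure_rV.
Variable R : realType.

(** The norm of row vectors is the sup norm, so balls are products of intervals,
    and an open set is a countable union of balls with rational data. *)
Lemma open_measurable_rV d (U : set 'rV[R]_d) : open U -> measurable U.
Proof.
move=> oU; pose ctr (q : 'rV[rat]_d) : 'rV[R]_d := map_mx ratr q.
pose B (i : 'rV[rat]_d * nat) : set 'rV[R]_d := ball (ctr i.1) i.2.+1%:R^-1.
pose F i : set 'rV[R]_d := [set x | B i `<=` U /\ B i x].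
have mB i : measurable (B i).
  have -> : B i = \bigcap_(j in [set: 'I_d])
      ((fun x : 'rV[R]_d => x ord0 j) @^-1` ball (ctr i.1 ord0 j) i.2.+1%:R^-1).
    apply/seteqP; split => x.
      by move=> [_ h] j _; exact: h.
    move=> h; split => [|i' j]; first by rewrite invr_gt0.
    by rewrite (ord1 i'); exact: h.
  apply: fin_bigcap_measurable => // j _; rewrite -[X in measurable X]setTI.
  by apply: measurable_rV_coord => //; exact: measurable_ball.
have -> : U = \bigcup_i F i.
  apply/seteqP; split => x.
    move=> Ux; have /nbhs_ballP[e /= e0 he] := open_nbhs_nbhs (conj oU Ux).
    have [k hk] : exists k : nat, 2 * k.+1%:R^-1 < e.
      exists (Num.bound (2 / e)).
      rewrite ltr_pdivrMr// mulrC -ltr_pdivrMr// (lt_le_trans (archi_boundP _))// ?ler_nat//.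
      by rewrite divr_ge0// ltW.
    have k0 : 0 < k.+1%:R^-1 :> R by rewrite invr_gt0.
    have /choice[q hq] : forall j : 'I_d, exists q : rat,
        ratr q \in `](x ord0 j - k.+1%:R^-1), (x ord0 j + k.+1%:R^-1)[.
      by move=> j; apply: rat_in_itvoo; rewrite ltrBlDr -addrA ltrDl addr_gt0.
    pose Q : 'rV[rat]_d := \row_j q j.
    have hQ j : `|ratr (q j) - x ord0 j| < k.+1%:R^-1.
      by have := hq j; rewrite in_itv/= ltr_distl.
    exists (Q, k) => //; split => [z [_ hz]|]; last first.
      by split => // i j; rewrite (ord1 i) /ctr !mxE; exact: hQ.
    apply: he; split => // i j; rewrite (ord1 i).
    have := hz ord0 j; have := hQ j; rewrite /ball/= !mxE => h1 h2.
    rewrite (le_lt_trans (ler_distD (ratr (q j)) _ _))// distrC (lt_trans _ hk)//.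
    by rewrite mulrDl mul1r ltrD.
  by case=> i _ [h]; exact: h.
apply: countable_bigcupT_measurable; first exact: countableP.
move=> i; have [h|h] := pselect (B i `<=` U).
  by rewrite (_ : F i = B i)//; apply/seteqP; split => x; [case|].
by rewrite (_ : F i = set0)// -subset0 => x [].
Qed.

Lemma continuous_measurable_rV d (f : 'rV[R]_d -> R) : continuous f -> measurable_fun setT f.
Proof.
move=> /continuousP cf; apply: (measurability _ (RGenOpens.measurableE R)).
move=> _ [_ [a [b ->] <-]]; rewrite setTI; apply: open_measurable_rV.
by apply: cf; exact: interval_open.
Qed.

Lemma box_measurable d (M : R) : measurable [set x : 'rV[R]_d | forall i, `|x ord0 i| <= M].
Proof.
have -> : [set x : 'rV[R]_d | forall i, `|x ord0 i| <= M] = \bigcap_(j in [set: 'I_d])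
    ((fun x : 'rV[R]_d => x ord0 j) @^-1` `[(- M), M]).
  by apply/seteqP; split => x h j; [move=> _|]; have := h j; rewrite /= in_itv/= ler_norml//; apply.
apply: fin_bigcap_measurable => // j _; rewrite -[X in measurable X]setTI.
by apply: measurable_rV_coord.
Qed.

Lemma box_finite_measure d (M : R) :
  (@lebesgue_measure_rV R d [set x | forall i, (`|x ord0 i| <= M)%R] < +oo)%E.
Proof.
rewrite /lebesgue_measure_rV; elim: d => [|d IH].
  by change (@dirac _ _ (0 : 'rV[R]_0)%R R [set x : 'rV[R]_0 | forall i, (`|x ord0 i| <= M)%R] < +oo)%E; rewrite diracE ltry.
pose A' := [set x : 'rV[R]_d | forall i, `|x ord0 i| <= M].
pose A := [set x : 'rV[R]_d.+1 | forall i, `|x ord0 i| <= M].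
have mA' : measurable A' by exact: box_measurable.
have E : @rV_cons R d @^-1` A = `[(- M), M]%classic `*` A'.
  apply/seteqP; split => -[z x]; rewrite /A /A' /rV_cons /=.
    move=> h; split; rewrite /= ?in_itv/=.
      have := h ord0; rewrite (_ : ord0 = lshift d (ord0 : 'I_1)); last exact: val_inj.
      by rewrite (@row_mxEl R 1 1 d) mxE eqxx mulr1n ler_norml.
    move=> i; have := h (rshift 1 i).
    by rewrite (@row_mxEr R 1 1 d).
  case=> /=; rewrite in_itv/= => hz hx i.
  case: (@split_ordP 1 d i) => j ->.
    by rewrite (@row_mxEl R 1 1 d) (ord1 j) mxE eqxx mulr1n ler_norml.
  by rewrite (@row_mxEr R 1 1 d).
have PE := product_measure1E (@lebesgue_measure R) (lebesgue_rV_rec d)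
  (measurable_itv `[(- M), M]) mA'.
have -> : lebesgue_rV_rec d.+1 [set x | forall i, (`|x ord0 i| <= M)%R] =
    (lebesgue_measure `[(- M)%R, M] * lebesgue_rV_rec d A')%E by rewrite -PE -E.
apply: lte_mul_pinfty => //.
by rewrite ge0_fin_numE// lebesgue_measure_itv/=; case: ifP => _; rewrite ?ltry.
Qed.

End measure_rV.

(** * Spectral decomposition of a form on a semi-inner product space *)

Module ComplexSpectral.
Import mathcomp.real_closed.complex mathcomp.algebra.spectral.
Local Open Scope sesquilinear_scope.

(** Real and imaginary parts of the rows of a unitary diagonalization over
    [R[i]]; both are eigenvectors as the matrix is real.  This makes a frame
    rather than a basis, which is all that Parseval's identity needs. *)
Lemma symmetric_spectral (R : rcfType) n (A : 'I_n -> 'I_n -> R) :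
  (forall i j, A i j = A j i) ->
  exists (I : finType) (P : I -> 'I_n -> R) (d : I -> R),
    (forall i j, \sum_l P i l * A l j = d i * P i j) /\
    (forall j k, \sum_i P i j * P i k = (j == k)%:R).
Proof.
move=> symA; pose M : 'M[complex R]_n := \matrix_(i, j) Complex (A i j) 0.
have hM : M \is hermsymmx.
  apply: realsym_hermsym.
    by apply/is_hermitianmxP; rewrite expr0 scale1r; apply/matrixP => i j; rewrite !mxE symA.
  by apply/mxOverP => i j; rewrite mxE complex_real.
pose Q := spectralmx M; pose D := spectral_diag M.
have uQ := spectral_unitarymx M.
have uQ1 : Q \in unitmx := spectral_unit M.
have QM : Q *m M = diag_mx D *m Q.
  rewrite {1}(orthomx_spectralP (hermitian_normalmx hM)) -/Q -/D.
  by rewrite -!mulmxA mulKVmx.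
have dreal i : complex.Im (D 0 i) = 0.
  have /mxOverP/(_ 0 i) := hermitian_spectral_diag_real hM.
  by rewrite -/D; case: (D 0 i) => x y; rewrite complex_real => /eqP.
pose P (i : 'I_n * bool) l := if i.2 then complex.Re (Q i.1 l) else complex.Im (Q i.1 l).
have ReS (f : 'I_n -> complex R) : complex.Re (\sum_l f l) = \sum_l complex.Re (f l).
  by elim/big_rec2: _ => // i y z _ <-; case: (f i) => ? ?; case: z.
have ImS (f : 'I_n -> complex R) : complex.Im (\sum_l f l) = \sum_l complex.Im (f l).
  by elim/big_rec2: _ => // i y z _ <-; case: (f i) => ? ?; case: z.
exists ('I_n * bool)%type, P, (fun i => complex.Re (D 0 i.1)); split.
  move=> [i b] j; have /matrixP/(_ i j) := QM.
  rewrite mul_diag_mx !mxE => E; rewrite /P/=; case: b.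
    have := congr1 (@complex.Re R) E; rewrite ReS.
    have := dreal i; case: (D 0 i) => x y /= ->; case: (Q i j) => u v /=.
    rewrite mul0r subr0 => <-; apply: eq_bigr => l _.
    by rewrite mxE; case: (Q i l) => u' v' /=; rewrite mulr0 subr0.
  have := congr1 (@complex.Im R) E; rewrite ImS.
  have := dreal i; case: (D 0 i) => x y /= ->; case: (Q i j) => u v /=.
  rewrite mul0r addr0 => <-; apply: eq_bigr => l _.
  by rewrite mxE; case: (Q i l) => u' v' /=; rewrite mulr0 add0r.
move=> j k; have QQ : (Q ^t*) *m Q = 1%:M.
  by rewrite -(invmx_unitary uQ) mulVmx.
have /matrixP/(_ j k) := QQ; rewrite !mxE => /(congr1 (@complex.Re R)); rewrite ReS.
have -> : complex.Re ((j == k)%:R : complex R) = (j == k)%:R by case: (j == k).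
move=> <-; rewrite -(pair_bigA _ (fun i b => P (i, b) j * P (i, b) k))/=.
apply: eq_bigr => i _; rewrite big_bool/= /P/= !mxE.
by case: (Q i j) => u v; case: (Q i k) => u' v' /=; rewrite mulNr opprK.
Qed.

End ComplexSpectral.

Section semi_inner_product.
Variables (T : Type) (R : realType).
Local Notation E := (T -> R).
Variables (S : E -> Prop) (m : E -> E -> R).

Definition lincomb_closed (P : E -> Prop) :=
  P (fun=> 0) /\ forall k f g, P f -> P g -> P (fun x => k * f x + g x).

Hypothesis Sl : lincomb_closed S.
Hypothesis mC : forall f g, m f g = m g f.
Hypothesis m_ge0 : forall f, 0 <= m f f.
Hypothesis ml : forall k f g h, S f -> S g -> S h ->
  m (fun x => k * f x + g x) h = k * m f h + m g h.

Lemma lincomb_sum (P : E -> Prop) (I : Type) (r : seq I) (c : I -> R) (F : I -> E) :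
  lincomb_closed P -> (forall i, P (F i)) -> P (fun x => \sum_(i <- r) c i * F i x).
Proof.
move=> [P0 Pl] hF; elim: r => [|i r IH].
  by rewrite (_ : (fun x => _) = fun=> 0)//; apply/funext => x; rewrite big_nil.
rewrite (_ : (fun x => _) = (fun x => c i * F i x + \sum_(i <- r) c i * F i x)).
  exact: Pl.
by apply/funext => x; rewrite big_cons.
Qed.

Lemma inner_fun0 h : S h -> m (fun=> 0) h = 0.
Proof.
move=> hS; have [S0 _] := Sl; have := ml 1 S0 S0 hS.
rewrite (_ : (fun x => _) = fun=> 0); last by apply/funext => x; rewrite mul1r addr0.
lra.
Qed.

Lemma inner_sum (I : Type) (r : seq I) (c : I -> R) (F : I -> E) h :
  (forall i, S (F i)) -> S h ->
  m (fun x => \sum_(i <- r) c i * F i x) h = \sum_(i <- r) c i * m (F i) h.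
Proof.
move=> hF hS; elim: r => [|i r IH].
  rewrite big_nil (_ : (fun x => _) = fun=> 0) ?inner_fun0//.
  by apply/funext => x; rewrite big_nil.
rewrite big_cons -IH (_ : (fun x => _) = (fun x => c i * F i x + \sum_(i <- r) c i * F i x)).
  by rewrite ml//; exact: lincomb_sum.
by apply/funext => x; rewrite big_cons.
Qed.

Lemma inner_null r h : S r -> S h -> m r r = 0 -> m r h = 0.
Proof.
move=> rS hS rr; apply/eqP; apply: contraT => rh.
have H k : 0 <= 2 * k * m r h + m h h.
  have lS : S (fun x => k * r x + h x) by have [_] := Sl; apply.
  have := m_ge0 (fun x => k * r x + h x); rewrite ml//.
  by rewrite !(mC _ (fun x => k * r x + h x)) !ml// rr (mC h r); lra.
have := H (- (m h h + 1) / (2 * m r h)).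
rewrite (_ : 2 * _ * m r h = - (m h h + 1)); last by field.
lra.
Qed.

Section gram_schmidt.
Variable V : E -> Prop.
Hypothesis Vl : lincomb_closed V.
Hypothesis VS : forall f, V f -> S f.

Let residual n (e : nat -> E) f : E := fun x => f x - \sum_(j < n) m f (e j) * e j x.

Let orthonormal n (e : nat -> E) := forall i j, (i < n)%N -> (j < n)%N -> m (e i) (e j) = (i == j)%:R.

Let residual_sub n (e : nat -> E) f :
  residual n e f = (fun x => (- 1) * (\sum_(j < n) m f (e j) * e j x) + f x).
Proof. by apply/funext => x; rewrite /residual mulN1r addrC. Qed.

Let residual_inner n e f h : (forall j, S (e j)) -> S f -> S h ->
  m (residual n e f) h = m f h - \sum_(j < n) m f (e j) * m (e j) h.
Proof.
move=> eS fS hS; rewrite residual_sub ml//; last exact: lincomb_sum.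
by rewrite inner_sum// mulN1r addrC.
Qed.

Let residualS n e f : (forall j, S (e j)) -> S f -> S (residual n e f).
Proof.
move=> eS fS; rewrite residual_sub; have [_ SL] := Sl; apply: SL => //.
exact: lincomb_sum.
Qed.

Let residual_orth n e f i : orthonormal n e -> (forall j, S (e j)) -> S f -> (i < n)%N ->
  m (residual n e f) (e i) = 0.
Proof.
move=> oe eS fS ni; rewrite residual_inner// (bigD1 (Ordinal ni))//= oe// eqxx mulr1.
rewrite big1 ?addr0 ?subrr// => j /eqP ji; rewrite oe//.
by case: eqP => [ij|]; [case: ji; apply: val_inj|rewrite mulr0].
Qed.

Let residual_sqr n e f : orthonormal n e -> (forall j, S (e j)) -> S f ->
  m (residual n e f) (residual n e f) = m f f - \sum_(j < n) m f (e j) ^+ 2.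
Proof.
move=> oe eS fS; have rS := residualS n eS fS.
rewrite {1}residual_inner// (mC f) residual_inner//.
rewrite [X in _ - X]big1 ?subr0; last first.
  by move=> j _; rewrite (mC (e j)) residual_orth ?mulr0.
by congr (_ - _); apply: eq_bigr => j _; rewrite (mC (e j)) expr2.
Qed.

Lemma bessel n e f : orthonormal n e -> (forall j, S (e j)) -> S f ->
  \sum_(j < n) m f (e j) ^+ 2 <= m f f.
Proof. by move=> oe eS fS; rewrite -subr_ge0 -residual_sqr. Qed.

(** A generator whose residual has norm zero is skipped. As m is only
    semi-definite, such a residual need not vanish, so what survives of the
    spanning property is Parseval's identity for the generators. *)
Let gram_schmidt k (phi : nat -> E) : (forall i, V (phi i)) ->
  exists n (e : nat -> E), [/\ forall j, V (e j), orthonormal n e &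
    forall i, (i < k)%N -> m (phi i) (phi i) = \sum_(j < n) m (phi i) (e j) ^+ 2].
Proof.
move=> hphi; elim: k => [|k [n [e [eV oe he]]]].
  by exists 0%N, (fun=> fun=> 0); split => //; case: Vl.
have eS j := VS (eV j); have pS i := VS (hphi i).
pose r := residual n e (phi k); have rS : S r := residualS n eS (pS k).
have rV : V r.
  by rewrite /r residual_sub; have [_ VL] := Vl; apply: VL => //; exact: lincomb_sum.
have [r0|r0] := eqVneq (m r r) 0.
  exists n, e; split => // i; rewrite ltnS leq_eqVlt => /predU1P[->|]; last exact: he.
  by move: r0; rewrite /r residual_sqr// => /eqP; rewrite subr_eq0 => /eqP.
pose s := Num.sqrt (m r r).
have s2 : s ^+ 2 = m r r by rewrite sqr_sqrtr.
have s0 : s != 0 by apply: contra_neq r0 => s0; rewrite -s2 s0 expr0n.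
pose en : E := fun x => s^-1 * r x + 0.
have [S0 SL] := Sl; have [V0 VL] := Vl.
have enV : V en by exact: VL.
have enS := VS enV.
have men f : S f -> m en f = s^-1 * m r f by move=> fS; rewrite ml// inner_fun0// addr0.
pose e' j := if j == n then en else e j.
have e'V j : V (e' j) by rewrite /e'; case: eqP.
have e'S j := VS (e'V j).
have oe' : orthonormal n.+1 e'.
  have ren j : (j < n)%N -> m en (e j) = 0 by move=> jn; rewrite men// residual_orth// mulr0.
  move=> i j; rewrite !ltnS /e' => hi hj.
  have [ni|ni] := eqVneq i n; have [nj|nj] := eqVneq j n.
  - by rewrite ni nj eqxx men// (mC r) men// mulrA -expr2 exprVn s2 mulVf.
  - by rewrite ni eq_sym (negbTE nj) ren// ltn_neqAle nj.
  - by rewrite nj (negbTE ni) mC ren// ltn_neqAle ni.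
  - by rewrite oe// ltn_neqAle ?ni ?nj.
have sumE f : \sum_(j < n.+1) m f (e' j) ^+ 2 = \sum_(j < n) m f (e j) ^+ 2 + m f en ^+ 2.
  rewrite big_ord_recr/= /e' eqxx; congr (_ + _).
  by apply: eq_bigr => j _; rewrite ifF// ltn_eqF.
exists n.+1, e'; split => // i; rewrite ltnS leq_eqVlt => /predU1P[->|ik]; rewrite sumE.
  have pr : m (phi k) r = m r r.
    rewrite [RHS]residual_inner// big1 ?subr0// => j _.
    by rewrite (mC (e j)) residual_orth// mulr0.
  have -> : m (phi k) en ^+ 2 = m r r.
    by rewrite mC men// mC pr exprMn exprVn s2 expr2 mulrA mulVf// mul1r.
  by rewrite residual_sqr// addrC subrK.
apply/eqP; rewrite eq_le; apply/andP; split.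
  by rewrite he// lerDl sqr_ge0.
by rewrite -sumE; exact: bessel.
Qed.

(** Parseval's identity, polarized, in a finitely generated space. *)
Lemma orthonormal_generators (I : Type) (r : seq I) (phi : I -> E) : (forall i, V (phi i)) ->
  (forall v, V v -> exists c : I -> R, v = (fun x => \sum_(i <- r) c i * phi i x)) ->
  exists n (e : nat -> E), [/\ forall j, V (e j), orthonormal n e &
    forall v h, V v -> S h -> m v h = \sum_(j < n) m v (e j) * m (e j) h].
Proof.
move=> hphi gen.
pose phi' k := nth (fun=> 0) [seq phi i | i <- r] k.
have phi'V k : V (phi' k).
  rewrite /phi'; have [kr|kr] := ltnP k (size r); last first.
    by rewrite nth_default ?size_map//; case: Vl.
  case: r kr {gen phi'} => [//|i0 r] kr.
  by rewrite (nth_map i0).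
have [n [e [eV oe he]]] := gram_schmidt (size r) phi'V.
have eS j := VS (eV j).
exists n, e; split => // v h vV hS; have [c ->] := gen v vV.
have pS i := VS (hphi i).
have key k : (k < size r)%N -> m (phi' k) h = \sum_(j < n) m (phi' k) (e j) * m (e j) h.
  move=> kr; have fS := VS (phi'V k); apply/eqP; rewrite -subr_eq0 -residual_inner//.
  by apply/eqP; apply: inner_null => //; [exact: residualS|rewrite residual_sqr// he// subrr].
rewrite inner_sum//.
transitivity (\sum_(i <- r) c i * \sum_(j < n) m (phi i) (e j) * m (e j) h); last first.
  under [RHS]eq_bigr do rewrite inner_sum// mulr_suml.
  rewrite exchange_big/=; apply: eq_bigr => i _; rewrite mulr_sumr.
  by apply: eq_bigr => j _; rewrite mulrA.
have {}key i0 k : (k < size r)%N -> m (phi (nth i0 r k)) h =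
    \sum_(j < n) m (phi (nth i0 r k)) (e j) * m (e j) h.
  by move=> kr; have := key k kr; rewrite /phi' (nth_map i0).
case: r {gen he phi' phi'V} key => [|i0 r] key; first by rewrite !big_nil.
rewrite !(big_nth i0) !big_nat; apply: eq_bigr => k /= kr; congr (_ * _).
exact: key.
Qed.

Section eigenframe.
Variables (a : E -> E -> R) (L : E -> E).
Hypothesis aC : forall v w, V v -> V w -> a v w = a w v.
Hypothesis a_ge0 : forall v, V v -> 0 <= a v v.
Hypothesis aL : forall v w, V v -> V w -> V (L v) /\ m (L v) w = - a v w.

(** Eigenvectors of the form [a] relative to [m].  As [m] is only
    semi-definite, [aL] is what forces [a] to vanish on the null vectors. *)
Lemma eigenframe (I : Type) (r : seq I) (phi : I -> E) : (forall i, V (phi i)) ->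
  (forall v, V v -> exists c : I -> R, v = (fun x => \sum_(i <- r) c i * phi i x)) ->
  exists (J : finType) (psi : J -> E) (lam : J -> R),
  [/\ forall i, V (psi i), forall i, 0 <= lam i,
      forall i v, V v -> a (psi i) v = lam i * m (psi i) v,
      forall v, V v -> m v v = \sum_i m v (psi i) ^+ 2 &
      forall q, S q -> \sum_i m q (psi i) ^+ 2 <= m q q].
Proof.
move=> hphi gen; have [n [e [eV oe he]]] := orthonormal_generators hphi gen.
have eS j := VS (eV j).
have ae v w : V v -> V w -> a v w = \sum_(j < n) m v (e j) * a (e j) w.
  move=> vV wV; have [LwV Lw] := aL wV vV.
  rewrite aC// -[LHS]opprK -Lw mC he//; last exact: VS.
  rewrite -sumrN; apply: eq_bigr => j _; have [_ Lj] := aL wV (eV j).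
  by rewrite (mC (e j)) Lj mulrN opprK aC.
pose A (i j : 'I_n) := a (e i) (e j).
have [J [P [d [hP PP]]]] := ComplexSpectral.symmetric_spectral (fun i j : 'I_n => aC (eV i) (eV j)).
pose psi i : E := fun x => \sum_(j < n) P i j * e j x.
have psiV i : V (psi i) by apply: lincomb_sum.
have psiS i := VS (psiV i).
have mpsi i q : S q -> m (psi i) q = \sum_(j < n) P i j * m q (e j).
  by move=> qS; rewrite inner_sum//; apply: eq_bigr => j _; rewrite (mC q).
have psie i (j : 'I_n) : m (psi i) (e j) = P i j.
  rewrite mpsi// (bigD1 j)//= oe// eqxx mulr1 big1 ?addr0// => k kj.
  by rewrite oe// (inj_eq val_inj) eq_sym (negbTE kj) mulr0.
have apsi i v : V v -> a (psi i) v = d i * m (psi i) v.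
  move=> vV; rewrite ae// mpsi ?mulr_sumr; last exact: VS.
  transitivity (\sum_(j < n) \sum_(l < n) m v (e l) * (P i j * A j l)).
    apply: eq_bigr => j _; rewrite psie aC// (ae v)// mulr_sumr.
    by apply: eq_bigr => l _; rewrite /A mulrCA (aC (eV l)).
  rewrite exchange_big; apply: eq_bigr => l _ /=.
  by rewrite -mulr_sumr hP; ring.
have parseval q : S q -> \sum_i m q (psi i) ^+ 2 = \sum_(j < n) m q (e j) ^+ 2.
  move=> qS; transitivity (\sum_i \sum_(j < n) \sum_(k < n) m q (e j) * m q (e k) * (P i j * P i k)).
    apply: eq_bigr => i _; rewrite mC mpsi// expr2 mulr_suml; apply: eq_bigr => j _.
    by rewrite mulr_sumr; apply: eq_bigr => k _; ring.
  rewrite exchange_big; apply: eq_bigr => j _ /=; rewrite exchange_big/=.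
  rewrite (bigD1 j)//= -mulr_sumr PP eqxx mulr1 big1 ?addr0 ?expr2// => k kj.
  by rewrite -mulr_sumr PP eq_sym (negbTE kj) mulr0.
exists J, psi, (fun i => Num.max (d i) 0); split => //.
- by move=> i; rewrite le_max lexx orbT.
- move=> i v vV; rewrite apsi//; have [d0|d0] := leP 0 (d i).
    by [].
  have := a_ge0 (psiV i); rewrite apsi// nmulr_rge0// => h.
  have h0 : m (psi i) (psi i) = 0 by apply/eqP; rewrite eq_le h m_ge0.
  by rewrite (inner_null (psiS i) (VS vV) h0) !mulr0.
- move=> v vV; have vS := VS vV; rewrite parseval// he//.
  by apply: eq_bigr => j _; rewrite (mC (e j)) expr2.
- by move=> q qS; rewrite parseval//; exact: bessel.
Qed.

End eigenframe.

End gram_schmidt.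

End semi_inner_product.

(** * The finite element space *)

Section finite_element_space.
Variables (R : realType) (d : nat).
Local Notation point := 'rV[R]_d.
Local Notation E := (point -> R).
Local Notation mu := (@lebesgue_measure_rV R d).

Lemma simplex_bounded (P : seq 'M[R]_(d.+1, d)) :
  exists M : R, forall K x i, K \in P -> simplex K x -> `|x ord0 i| <= M.
Proof.
exists (\sum_(K <- P) \sum_j \sum_i `|K j i|) => K x i KP [l [l0 _ l1 ->]].
rewrite mxE; apply: le_trans (ler_norm_sum _ _ _) _.
rewrite (big_rem K)//= ler_wpDr ?sumr_ge0// => [K' _|].
  by do 2 (rewrite sumr_ge0// => ? _).
apply: ler_sum => j _; rewrite normrM (bigD1 i)//= ler_wpDr ?sumr_ge0//.
rewrite ler_piMl// ger0_norm// -l1 (bigD1 j)//= lerDl sumr_ge0//.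
Qed.

Section domain.
Variable Omega : set point.
Hypothesis hOmega : polygonal_domain Omega.

Lemma domain_measurable : measurable Omega.
Proof.
by have [_ _ [P [_ ->]]] := hOmega; apply: open_measurable_rV; exact: open_interior.
Qed.

Lemma domain_finite_measure : (mu Omega < +oo)%E.
Proof.
have [_ _ [P [_ OE]]] := hOmega; have [M hM] := simplex_bounded P.
apply: le_lt_trans (box_finite_measure d M); apply: le_measure.
- by rewrite inE; exact: domain_measurable.
- by rewrite inE; exact: box_measurable.
- by move=> x; rewrite OE => /interior_subset[K KP Kx] i; exact: hM KP Kx.
Qed.

Local Notation S := (square_integrable Omega).
Local Notation m := (L2_inner Omega).
Let mO := domain_measurable.

Lemma square_integrable_mul (f g : E) : S f -> S g ->
  mu.-integrable Omega (EFin \o (fun x => f x * g x)).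
Proof.
move=> [mf if2] [mg ig2].
have ifg : mu.-integrable Omega (EFin \o (fun x => f x ^+ 2 + g x ^+ 2)) by exact: integrable_add.
apply: le_integrable ifg => //.
  by apply/measurable_EFinP; exact: measurable_funM.
move=> x _; rewrite lee_fin [leRHS]ger0_norm ?addr_ge0 ?sqr_ge0// normrM.
rewrite -(normr_id (f x)) -[f x ^+ 2]real_normK ?num_real// -[g x ^+ 2]real_normK ?num_real//.
rewrite normr_id; have := sqr_ge0 (`|f x| - `|g x|).
by have := sqr_ge0 (`|f x|); have := sqr_ge0 (`|g x|); rewrite sqrrB; lra.
Qed.

Lemma square_integrable_lincomb : lincomb_closed S.
Proof.
split.
  split; first exact: measurable_cst.
  rewrite (_ : (fun _ => _) = cst 0%E); first exact: integrable0.
  by apply/funext => x; rewrite expr0n.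
move=> k f g fS gS; have [mf if2] := fS; have [mg ig2] := gS; split.
  by apply: measurable_funD => //; exact: measurable_funM.
rewrite (_ : (fun x => _) = EFin \o (fun x => (k ^+ 2 * f x ^+ 2 + g x ^+ 2) + 2 * k * (f x * g x))); last first.
  by apply/funext => x; rewrite /=; congr EFin; ring.
apply: integrable_add => //; last by apply: integrable_scale => //; exact: square_integrable_mul.
by apply: integrable_add => //; exact: integrable_scale.
Qed.

Lemma L2_inner_sym (f g : E) : m f g = m g f.
Proof. by apply: eq_Rintegral => x _; rewrite mulrC. Qed.

Lemma L2_inner_ge0 (f : E) : 0 <= m f f.
Proof. by apply: Rintegral_ge0 => x _; rewrite -expr2 sqr_ge0. Qed.

Lemma L2_inner_lincomb k (f g h : E) : S f -> S g -> S h ->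
  m (fun x => k * f x + g x) h = k * m f h + m g h.
Proof.
move=> fS gS hS; have ifh := square_integrable_mul fS hS; have igh := square_integrable_mul gS hS.
rewrite /L2_inner -RintegralZl// -RintegralD//; last exact: integrable_scale.
by apply: eq_Rintegral => x _; ring.
Qed.

Section triangulation.
Variable Th : seq 'M[R]_(d.+1, d).
Hypothesis hTh : triangulation Omega Th.
Local Notation V := (fe_space Omega Th).

Lemma fe_lincomb : lincomb_closed V.
Proof.
split.
  split => //; first exact: cst_continuous.
  move=> K _; exists 0, 0 => x _; rewrite big1 ?addr0// => i _.
  by rewrite mxE mul0r.
move=> k f g [cf f0 fK] [cg g0 gK]; split.
- by move=> x; exact: (continuousD (continuousM (@cst_continuous _ _ k x) (cf x)) (cg x)).
- by move=> x Ox; rewrite f0// g0// mulr0 addr0.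
- move=> K KT; have [a [b h]] := fK K KT; have [a' [b' h']] := gK K KT.
  exists (k * a + a'), (k *: b + b') => x Kx; rewrite h// h'//.
  under [in RHS]eq_bigr do rewrite !mxE mulrDl -mulrA.
  by rewrite big_split/= -mulr_sumr; ring.
Qed.

Lemma fe_barycentric (v : E) K (l : 'rV[R]_d.+1) : V v -> K \in Th ->
  (forall i, 0 <= l 0 i) -> \sum_i l 0 i = 1 ->
  v (l *m K) = \sum_i l 0 i * v (row i K).
Proof.
move=> [_ _ vK] KT l0 l1; have [a [b h]] := vK K KT.
have rowE i : v (row i K) = a + \sum_(j < d) b 0 j * K i j.
  rewrite h; first by congr (_ + _); apply: eq_bigr => j _; rewrite mxE.
  exists (delta_mx 0 i); split.
  - by move=> j; rewrite mxE eqxx/=; case: (_ == _).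
  - by move=> j; rewrite inE.
  - by rewrite (bigD1 i)//= mxE !eqxx big1 ?addr0// => j ji; rewrite mxE (negbTE ji) andbF.
  - by rewrite rowE.
rewrite h; last by exists l; split => // i; rewrite inE.
under [RHS]eq_bigr do rewrite rowE mulrDr.
rewrite big_split/= -mulr_suml l1 mul1r; congr (_ + _).
under eq_bigr do rewrite mxE mulr_sumr.
rewrite exchange_big; apply: eq_bigr => i _; rewrite mulr_sumr; apply: eq_bigr => j _; ring.
Qed.

Lemma fe_bounded (v : E) : V v -> exists B : R, forall x, `|v x| <= B.
Proof.
move=> vV; have [_ v0 _] := vV; have [_ _ TE _] := hTh.
exists (\sum_(K <- Th) \sum_i `|v (row i K)|) => x.
have B0 : 0 <= \sum_(K <- Th) \sum_i `|v (row i K)|.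
  by rewrite sumr_ge0// => K _; rewrite sumr_ge0.
have [Ox|Ox] := pselect (Omega x); last by rewrite v0// normr0.
have : closure Omega x by exact: subset_closure.
rewrite TE => -[K KT [l [l0 _ l1 ->]]].
rewrite fe_barycentric//; apply: le_trans (ler_norm_sum _ _ _) _.
rewrite (big_rem K)//= ler_wpDr ?sumr_ge0// => [K' _|]; first by rewrite sumr_ge0.
apply: ler_sum => j _; rewrite normrM ler_piMl// ger0_norm//.
by rewrite -l1 (bigD1 j)//= lerDl sumr_ge0.
Qed.

Lemma fe_square_integrable (v : E) : V v -> S v.
Proof.
move=> vV; have [cv _ _] := vV; have [B hB] := fe_bounded vV.
have mv : measurable_fun Omega v by apply: measurable_funTS; exact: continuous_measurable_rV.
split => //; apply: (measurable_bounded_integrable (f := fun x => v x ^+ 2)) => //.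
- exact: domain_finite_measure.
- by apply: measurable_funX.
- exists (B ^+ 2); split; first exact: num_real.
  move=> y By x _ /=; rewrite normrX (le_trans _ (ltW By))//.
  by rewrite lerXn2r ?nnegrE// (le_trans _ (hB x)).
Qed.

Lemma fe_determined (v : E) : V v -> (forall K i, K \in Th -> v (row i K) = 0) -> forall x, v x = 0.
Proof.
move=> vV h x; have [_ v0 _] := vV; have [_ _ TE _] := hTh.
have [Ox|Ox] := pselect (Omega x); last by rewrite v0.
have : closure Omega x by exact: subset_closure.
rewrite TE => -[K KT [l [l0 _ l1 ->]]].
by rewrite fe_barycentric// big1// => i _; rewrite h// mulr0.
Qed.

Local Notation J := {p : point * E | V p.2}.

(** Elements of V_h are determined by their values at the vertices, and points
    can be added one at a time: either vanishing at the previous ones forces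
    vanishing at the new one, or some function separates it from them and
    corrects the generators found so far. That the coefficients are values is
    what makes them regular in time for the semidiscrete solution. *)
Lemma fe_generators : exists r : seq J, forall v, V v ->
  v = (fun z => \sum_(p <- r) v (sval p).1 * (sval p).2 z).
Proof.
have [V0 VL] := fe_lincomb.
have step (pts : seq point) : exists r : seq J, forall v, V v -> forall x, x \in pts ->
    v x = \sum_(p <- r) v (sval p).1 * (sval p).2 x.
  elim: pts => [|x pts [r hr]]; first by exists [::].
  pose res (v : E) : E := fun z => (-1) * (\sum_(p <- r) v (sval p).1 * (sval p).2 z) + v z.
  have resV v : V v -> V (res v).
    move=> vV; apply: VL => //.
    by apply: (lincomb_sum r (fun p => v (sval p).1) fe_lincomb) => p; exact: svalP p.
  have res0 v : V v -> forall z, z \in pts -> res v z = 0.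
    by move=> vV z zp; rewrite /res -(hr v vV z zp) mulN1r addNr.
  have [H|H] := pselect (forall w, V w -> (forall y, y \in pts -> w y = 0) -> w x = 0).
    exists r => v vV z; rewrite inE => /predU1P[->|zp]; last exact: hr.
    have := H _ (resV v vV) (res0 v vV); rewrite /res mulN1r addrC => /eqP.
    by rewrite subr_eq0 => /eqP.
  have [w /not_implyP[wV /not_implyP[w0 wx]]] : exists w, ~ (V w -> (forall y, y \in pts -> w y = 0) -> w x = 0).
    by apply/existsNP.
  pose phi : E := fun z => (w x)^-1 * w z + 0.
  have phiV : V phi by exact: VL.
  have wx0 : w x != 0 by apply/eqP.
  have phix : phi x = 1 by rewrite /phi mulVf// addr0.
  have phi0 y : y \in pts -> phi y = 0 by move=> yp; rewrite /phi (w0 y)// mulr0 addr0.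
  have corrV (p : J) : V (fun z => - (sval p).2 x * phi z + (sval p).2 z).
    by apply: VL => //; exact: svalP p.
  pose p0 : J := exist _ (x, phi) phiV.
  pose corr (p : J) : J := exist _ ((sval p).1, _) (corrV p).
  exists (p0 :: map corr r) => v vV z hz; rewrite big_cons big_map /=.
  have E1 : \sum_(p <- r) v (sval p).1 * (- (sval p).2 x * phi z + (sval p).2 z) =
      \sum_(p <- r) v (sval p).1 * (sval p).2 z - (\sum_(p <- r) v (sval p).1 * (sval p).2 x) * phi z.
    rewrite mulr_suml -sumrB; apply: eq_bigr => p _; ring.
  rewrite E1; move: hz; rewrite inE => /predU1P[->|zp].
    by rewrite phix mulr1 mulr1 subrr addr0.
  by rewrite phi0// !mulr0 subr0 add0r -hr.
pose pts := flatten [seq [seq row i K | i <- enum 'I_d.+1] | K <- Th].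
have [r hr] := step pts; exists r => v vV; apply/funext => z.
pose res : E := fun z => (-1) * (\sum_(p <- r) v (sval p).1 * (sval p).2 z) + v z.
have resV : V res.
  apply: VL => //.
  by apply: (lincomb_sum r (fun p => v (sval p).1) fe_lincomb) => p; exact: svalP p.
have : res z = 0.
  apply: fe_determined => // K i KT; rewrite /res -hr ?mulN1r ?addNr//.
  by apply/flatten_mapP; exists K => //; apply/mapP; exists i => //; rewrite mem_enum.
by rewrite /res mulN1r addrC => /eqP; rewrite subr_eq0 => /eqP.
Qed.

Lemma dirichlet_sym v w : dirichlet_form Omega Th v w = dirichlet_form Omega Th w v.
Proof. by apply: eq_Rintegral => x _; apply: eq_bigr => i _; rewrite mulrC. Qed.

Lemma dirichlet_ge0 v : 0 <= dirichlet_form Omega Th v v.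
Proof.
by apply: Rintegral_ge0 => x _; rewrite sumr_ge0// => i _; rewrite -expr2 sqr_ge0.
Qed.

End triangulation.

End domain.

End finite_element_space.

Lemma H10_gradient_0 (R : realType) d (Omega : set 'rV[R]_d) (hOmega : polygonal_domain Omega) :
  H10_gradient Omega (fun=> 0) (fun=> 0).
Proof.
have [S0 _] := square_integrable_lincomb hOmega.
have E i : (fun x : 'rV[R]_d => (0 : 'rV[R]_d) 0 i) = fun=> 0.
  by apply/funext => x; rewrite mxE.
have p0 i : partial i (fun=> 0) = (fun=> 0) :> ('rV[R]_d -> R).
  by apply/funext => x; rewrite /partial derive_cst.
have n0 : L2_norm Omega ((fun=> 0) \- (fun=> 0)) = 0.
  rewrite /L2_norm /L2_inner /Rintegral integral0_eq ?sqrtr0// => x _.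
  by rewrite /= subr0 mulr0.
split => //; first by move=> i; rewrite E.
exists (fun _ _ => 0); split.
- move=> k; split.
    by elim=> [|i s IH] x /=; [exact: differentiable_cst|rewrite (_ : foldr _ _ _ = fun=> 0) ?p0; [exact: differentiable_cst|elim: s {IH} => //= j s ->]].
  by exists set0; split => //; exact: compact0.
- by rewrite n0; exact: cvg_cst.
- by move=> i; rewrite p0 E n0; exact: cvg_cst.
Qed.

(** * Caputo derivatives of absolutely continuous functions *)

Section lincomb_integral.
Context dd (X : measurableType dd) (R : realType).
Variables (mu : {measure set X -> \bar R}) (D : set X).
Hypothesis mD : measurable D.

Lemma Rintegral_lincomb (I : Type) (r : seq I) (c : I -> R) (F : I -> X -> R) :
  (forall i, mu.-integrable D (EFin \o F i)) ->
  mu.-integrable D (EFin \o (fun x => \sum_(i <- r) c i * F i x)) /\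
  \int[mu]_(x in D) (\sum_(i <- r) c i * F i x) = \sum_(i <- r) c i * \int[mu]_(x in D) F i x.
Proof.
move=> iF; elim: r => [|i r [IH1 IH2]].
  have -> : (fun x => \sum_(i <- [::]) c i * F i x) = fun=> 0.
    by apply/funext => x; rewrite big_nil.
  split; first exact: integrable0.
  by rewrite big_nil /Rintegral integral0.
have -> : (fun x => \sum_(j <- i :: r) c j * F j x) =
    (fun x => c i * F i x + \sum_(j <- r) c j * F j x).
  by apply/funext => x; rewrite big_cons.
have iS := integrable_scale mD (c i) (iF i).
split; first exact: integrable_add.
by rewrite big_cons RintegralD// RintegralZl// IH2.
Qed.

End lincomb_integral.

Section caputo.
Variables (R : realType) (al T : R).
Local Notation mu := (@lebesgue_measure R).

(** The function phi is absolutely continuous on [0, T] with derivative g. *)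
Definition density (phi g : R -> R) := mu.-integrable `[0, T] (EFin \o g) /\
  forall t, 0 <= t <= T -> phi t = phi 0 + \int[mu]_(s in `[0, t]) g s.

(** Lebesgue's differentiation theorem. *)
Lemma derive_density phi g : density phi g ->
  {ae mu, forall s, 0 < s < T -> derive1 phi s = g s}.
Proof.
move=> [ig phiE]; pose G := g \_ `[0, T].
have iG : mu.-integrable setT (EFin \o G).
  by rewrite -restrict_EFin; apply: (integrable_mkcond _ _).1; [exact: measurable_itv|exact: ig].
have iGy y : mu.-integrable [set` Interval (BLeft 0) (BRight y)] (EFin \o G).
  by apply: integrableS iG.
have := FTC1 iGy (integrable_locally_restrict (measurable_itv _) ig).
apply: filterS; first exact: (ae_filter_ringOfSetsType mu).
move=> s /= + /andP[s0 sT]; rewrite lte_fin => /(_ s0) [dG GE].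
have E : \forall x \near s, phi 0 + \int[mu]_(t in `[0, x]) G t = phi x.
  have : \forall x \near s, x \in `]0, T[.
    by apply: near_in_itvoo; rewrite in_itv/= s0.
  apply: filterS => x; rewrite in_itv/= => /andP[x0 xT].
  rewrite (phiE x); last by rewrite (ltW x0) (ltW xT).
  congr (_ + _); apply: eq_Rintegral => z; rewrite inE/= in_itv/= => /andP[z0 zx].
  by rewrite /G patchE mem_set//= in_itv/= z0 (le_trans zx)// ltW.
rewrite derive1E -(near_eq_derive _ E).
rewrite (@deriveD _ _ _ (cst (phi 0)) (fun x : R => \int[mu]_(t in `[0, x]) G t))//.
rewrite derive_cst add0r.
by rewrite -derive1E GE /G patchE mem_set//= in_itv/= (ltW s0) (ltW sT).
Qed.

(** The classical derivative is known only almost everywhere and is not additive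
    in the function; the density is, after this exchange, linear in it. *)
Lemma caputo_density phi g t : density phi g -> 0 < t <= T ->
  mu.-integrable `]0, t[ (EFin \o caputo_integrand al phi t) ->
  mu.-integrable `]0, t[ (EFin \o (fun s => g s / (t - s) `^ al)) /\
  caputo al phi t = (Gamma (1 - al))^-1 * \int[mu]_(s in `]0, t[) (g s / (t - s) `^ al).
Proof.
move=> dg /andP[t0 tT] ic; have [ig _] := dg.
have gt : mu.-integrable `]0, t[ (EFin \o g).
  by apply: integrableS ig => //; apply: subset_itv; rewrite bnd_simp.
have mg : measurable_fun `]0, t[ (fun s => g s / (t - s) `^ al).
  apply: measurable_funM; first by apply/measurable_EFinP; have /measurable_int := gt.
  apply: measurable_funTS.
  rewrite (_ : (fun s => _) = (fun s : R => (t - s) `^ (- al))); last first.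
    by apply/funext => s; rewrite powRN.
  by apply: (measurableT_comp (measurable_powR _)); exact: measurable_funB.
have mc := measurable_int _ ic.
have E : ae_eq mu `]0, t[%classic (EFin \o caputo_integrand al phi t) (EFin \o (fun s => g s / (t - s) `^ al)).
  have := derive_density dg; apply: filterS; first exact: (ae_filter_ringOfSetsType mu).
  move=> s h; rewrite /= in_itv/= => /andP[s0 st].
  by rewrite /caputo_integrand h// s0 (lt_le_trans st).
have mgE : measurable_fun `]0, t[ (EFin \o (fun s => g s / (t - s) `^ al)).
  exact/measurable_EFinP.
split; last by rewrite /caputo /Rintegral; congr (_ * fine _); exact: ae_eq_integral.
apply/integrableP; split => //.
have /integrableP[_] := ic.
apply: le_lt_trans; rewrite le_eqVlt; apply/orP; left; apply/eqP.
apply: ae_eq_integral => //; [exact: measurableT_comp|exact: measurableT_comp|].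
by apply: ae_eq_abse; exact: ae_eq_sym.
Qed.

Lemma density_lincomb (I : Type) (r : seq I) (c : I -> R) (phi g : I -> R -> R) (f : R -> R) :
  (forall i, density (phi i) (g i)) ->
  0 <= T -> (forall t, 0 <= t <= T -> f t = \sum_(i <- r) c i * phi i t) ->
  density f (fun s => \sum_(i <- r) c i * g i s).
Proof.
move=> dg T0 fE; split.
  have ig i : mu.-integrable `[0, T] (EFin \o g i) by have [] := dg i.
  have mT : measurable (`[0, T]%classic : set (measurableTypeR R)) by [].
  exact: (Rintegral_lincomb mT r c ig).1.
move=> t t0T; rewrite !fE//; last by rewrite lexx.
have /andP[t0 tT] := t0T.
have ig i : mu.-integrable `[0, t] (EFin \o g i).
  by apply: integrableS (dg i).1 => //; apply: subset_itv; rewrite bnd_simp.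
have mt : measurable (`[0, t]%classic : set (measurableTypeR R)) by [].
rewrite (Rintegral_lincomb mt r c ig).2 -big_split/=.
by apply: eq_bigr => i _; rewrite (dg i).2// mulrDr.
Qed.

End caputo.

(** * Error bound for the averaging Crank-Nicolson scheme *)

Lemma sqrt_sum_bound (R : rcfType) (I : finType) (e a b : I -> R) (K A B na nb : R) :
  0 <= K -> 0 <= A -> 0 <= B -> 0 <= na -> 0 <= nb ->
  (forall i, `|e i| <= K * (`|a i| * A + `|b i| * B)) ->
  \sum_i a i ^+ 2 <= na -> \sum_i b i ^+ 2 <= nb ->
  Num.sqrt (\sum_i e i ^+ 2) <= 2 * K * (A * Num.sqrt na + B * Num.sqrt nb).
Proof.
move=> K0 A0 B0 na0 nb0 he ha hb.
have r0 : 0 <= 2 * K * (A * Num.sqrt na + B * Num.sqrt nb).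
  by rewrite !mulr_ge0 ?addr_ge0 ?mulr_ge0 ?sqrtr_ge0.
rewrite -[leRHS]ger0_norm// -sqrtr_sqr ler_wsqrtr//.
have h : \sum_i e i ^+ 2 <= 2 * K ^+ 2 * (A ^+ 2 * na + B ^+ 2 * nb).
  apply: (@le_trans _ _ (\sum_i 2 * K ^+ 2 * (A ^+ 2 * a i ^+ 2 + B ^+ 2 * b i ^+ 2))).
    apply: ler_sum => i _; rewrite -real_normK ?num_real//.
    apply: (@le_trans _ _ ((K * (`|a i| * A + `|b i| * B)) ^+ 2)).
      by rewrite lerXn2r ?nnegrE// mulr_ge0// addr_ge0// mulr_ge0.
    rewrite -[a i ^+ 2]real_normK ?num_real// -[b i ^+ 2]real_normK ?num_real//.
    have h2 : (`|a i| * A + `|b i| * B) ^+ 2 <= 2 * (A ^+ 2 * `|a i| ^+ 2 + B ^+ 2 * `|b i| ^+ 2).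
      by have := sqr_ge0 (`|a i| * A - `|b i| * B); lra.
    rewrite exprMn; apply: (le_trans (ler_wpM2l (sqr_ge0 K) h2)).
    by rewrite mulrA [K ^+ 2 * 2]mulrC.
  rewrite -mulr_sumr ler_wpM2l ?mulr_ge0 ?sqr_ge0// big_split/= -!mulr_sumr.
  by rewrite lerD// ler_wpM2l ?sqr_ge0.
apply: (le_trans h); rewrite exprMn [(2 * K) ^+ 2]exprMn -[X in _ <= X]mulrA -[X in X <= _]mulrA.
have c0 : 0 <= A * Num.sqrt na * (B * Num.sqrt nb) by rewrite !mulr_ge0 ?sqrtr_ge0.
have E : (A * Num.sqrt na + B * Num.sqrt nb) ^+ 2 =
    A ^+ 2 * na + B ^+ 2 * nb + 2 * (A * Num.sqrt na * (B * Num.sqrt nb)).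
  by rewrite sqrrD !exprMn !sqr_sqrtr//; ring.
have q0 : 0 <= A ^+ 2 * na + B ^+ 2 * nb by rewrite addr_ge0// mulr_ge0 ?sqr_ge0.
rewrite E; have K2 := sqr_ge0 K.
have := mulr_ge0 K2 q0; have := mulr_ge0 K2 c0; lra.
Qed.

Theorem theorem3 (R : realType) (d : nat) (alpha T : R)
    (Omega : set 'rV[R]_d) (Ths : set (seq 'M[R]_(d.+1, d)))
    (c : generating_formula) (wt : nat -> R)
    (hd : (0 < d)%N) (halpha : 0 < alpha < 1) (hT : 0 < T)
    (hOmega : polygonal_domain Omega)
    (hThs : forall Th, Ths Th -> triangulation Omega Th)
    (hshape : shape_regular Ths) (hquasi : quasi_uniform Ths)
    (hwt : has_power_series (generating_function alpha c) wt) :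
  exists tau0 C : R, [/\ 0 < tau0, 0 < C &
    forall (Th : seq 'M[R]_(d.+1, d))
      (Ph Rh Dh : ('rV[R]_d -> R) -> 'rV[R]_d -> R)
      (u0 q0 q1 : 'rV[R]_d -> R) (f : R -> 'rV[R]_d -> R)
      (u : R -> 'rV[R]_d -> R) (N : nat) (tau : R)
      (W U : nat -> 'rV[R]_d -> R),
    Ths Th ->
    is_L2_projection Omega Th Ph ->
    is_ritz_projection Omega Th Rh ->
    is_discrete_laplacian Omega Th Dh ->
    u0 = (fun=> 0) ->
    square_integrable Omega q0 -> square_integrable Omega q1 ->
    f = (fun t x => q0 x + t * q1 x) ->
    semidiscrete_solution alpha T Omega Th f (Rh u0) u ->
    (0 < N)%N -> tau = T / N%:R -> tau < tau0 ->
    acn_solution alpha tau N wt Omega Th Dh (fun t => Ph (f t)) (Rh u0) W ->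
    U = (fun n x => W n x + u 0 x) ->
    forall n, (1 <= n <= N)%N ->
      let t := n%:R * tau in
      L2_norm Omega (u t \- U n) <=
      C * (tau ^+ 2 * (t `^ (alpha - 2) * L2_norm Omega q0
                       + t `^ (alpha - 1) * L2_norm Omega q1)
           + tau `^ alpha * L2_norm Omega q0)].
Proof.
have [K K0 hK] := scalar_error halpha hwt.
(* The scalar estimate holds for steps of any size, so the bound 1 on the step
   is arbitrary; the factor 2 comes from squaring sums of two terms. *)
exists 1, (2 * K); split => //; first by rewrite mulr_gt0.
move=> Th Ph Rh Dh u0 q0 q1 f u N tau W U TTh hPh hRh hDh u00 S0 S1 fE.
move=> [uV uac uci uh ueq] N0 tauE tau1 [W0 WV] UE n nN; cbv zeta; set t := n%:R * tau.
have hTh := hThs Th TTh.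
pose V := fe_space Omega Th; pose m := L2_inner Omega; pose S := square_integrable Omega.
pose a := dirichlet_form Omega Th.
have Sl : lincomb_closed S := square_integrable_lincomb hOmega.
have Vl : lincomb_closed V := fe_lincomb Omega Th.
have [_ SL] := Sl; have [V0 VL] := Vl.
have VS (v : 'rV[R]_d -> R) : V v -> S v := fe_square_integrable hOmega hTh (v := v).
have mC v w : m v w = m w v := L2_inner_sym Omega v w.
have ml k v w z : S v -> S w -> S z -> m (fun x => k * v x + w x) z = k * m v z + m w z.
  exact: L2_inner_lincomb.
have aL v w : V v -> V w -> V (Dh v) /\ m (Dh v) w = - a v w.
  by move=> vV wV; have [DV DE] := hDh v vV; split => //; exact: DE.
have [r hr] := fe_generators hTh.
have m0 v : 0 <= m v v by exact: L2_inner_ge0.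
have aC v w : V v -> V w -> a v w = a w v by move=> _ _; exact: dirichlet_sym.
have a0 v : V v -> 0 <= a v v by move=> _; exact: dirichlet_ge0.
have phiV (p : {p : 'rV[R]_d * ('rV[R]_d -> R) | fe_space Omega Th p.2}) : V (sval p).2.
  exact: svalP p.
have gen v : V v -> exists coef : {p : 'rV[R]_d * ('rV[R]_d -> R) | fe_space Omega Th p.2} -> R,
    v = (fun x => \sum_(p <- r) coef p * (sval p).2 x).
  by move=> vV; exists (fun p => v (sval p).1); exact: hr.
have [J [psi [lam [psiV lam0 apsi parseval bessel]]]] :=
  eigenframe Sl mC m0 ml Vl VS aC a0 aL phiV gen.
have psiS i : S (psi i) := VS _ (psiV i).
(* The discrete initial value is the Ritz projection of 0, so it has no energy
   and does not enter the equations tested with eigenvectors. *)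
have [rhV rhE] := hRh _ _ (H10_gradient_0 hOmega).
pose vh := Rh u0.
have vhV : V vh by rewrite /vh u00.
have avh v : V v -> a vh v = 0.
  move=> vV; rewrite /a /vh u00 rhE// /L2_inner_vec /Rintegral integral0_eq// => x _.
  by congr EFin; apply: big1 => i _; rewrite mxE mul0r.
have tau0 : 0 < tau by rewrite tauE divr_gt0// ltr0n.
have NT : N%:R * tau = T by rewrite tauE mulrC divfK// pnatr_eq0 -lt0n.
have tT k : (k <= N)%N -> k%:R * tau <= T by move=> kN; rewrite -NT ler_wpM2r ?(ltW tau0)// ler_nat.
have tge0 k : 0 <= k%:R * tau by rewrite mulr_ge0// ltW.
have /andP[n0 nNN] := nN.
have Wv k : (k <= N)%N -> V (W k).
  by case: k => [|k] kN; [rewrite W0|have [] := WV k.+1 kN].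
have fS s : S (f s).
  rewrite fE (_ : (fun x => _) = (fun x => s * q1 x + q0 x)); last by apply/funext => x; rewrite addrC.
  exact: SL.
have fpsi s i : m (f s) (psi i) = m q0 (psi i) + m q1 (psi i) * s.
  rewrite fE (_ : (fun x => _) = (fun x => s * q1 x + q0 x)); last by apply/funext => x; rewrite addrC.
  by rewrite ml// addrC mulrC.
(* At every point, the solution is a combination of its values at the finitely
   many points attached to the generators; their densities therefore give
   densities gam of the coefficients in the frame. *)
have uac' x : exists gx, density T (u^~ x) gx by have [gx ig Eg] := uac x; exists gx.
have [g dg] := choice uac'.
have dgx x : density T (u^~ x) (fun s => \sum_(p <- r) (sval p).2 x * g (sval p).1 s).
  apply: (density_lincomb (phi := fun p => u^~ (sval p).1)) => //; first exact: ltW.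
  move=> s s0T; rewrite {1}(hr _ (uV s s0T)); apply: eq_bigr => p _; exact: mulrC.
pose G0 := (Gamma (1 - alpha))^-1.
pose D x s := G0 * \int[lebesgue_measure]_(z in `]0, s[) (g x z / (s - z) `^ alpha).
have igx s x : 0 < s <= T -> lebesgue_measure.-integrable `]0, s[
    (EFin \o (fun z => g x z / (s - z) `^ alpha)).
  by move=> s0T; exact: (caputo_density (dg x) s0T (uci x s s0T)).1.
have capE s : 0 < s <= T ->
    (fun x => caputo alpha (u^~ x) s) = (fun x => \sum_(p <- r) D (sval p).1 s * (sval p).2 x).
  move=> s0T; apply/funext => x; rewrite (caputo_density (dgx x) s0T (uci x s s0T)).2.
  have ms : measurable (`]0, s[%classic : set (measurableTypeR R)) by [].
  have ip (p : {p : 'rV[R]_d * ('rV[R]_d -> R) | fe_space Omega Th p.2}) := igx s (sval p).1 s0T.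
  have E := (Rintegral_lincomb ms r (fun p => (sval p).2 x) ip).2.
  transitivity (G0 * \sum_(p <- r) (sval p).2 x * \int[lebesgue_measure]_(z in `]0, s[) (g (sval p).1 z / (s - z) `^ alpha)).
    rewrite -E; congr (_ * _); apply: eq_Rintegral => z _; rewrite mulr_suml.
    by apply: eq_bigr => p _; rewrite mulrA.
  by rewrite mulr_sumr; apply: eq_bigr => p _; rewrite /D mulrCA mulrC.
have pS (p : {p : 'rV[R]_d * ('rV[R]_d -> R) | fe_space Omega Th p.2}) : S (sval p).2.
  exact: VS (svalP p).
pose gam i s := \sum_(p <- r) m (sval p).2 (psi i) * g (sval p).1 s.
have dgam i : density T (fun s => m (u s) (psi i)) (gam i).
  apply: (density_lincomb (phi := fun p => u^~ (sval p).1)) => //; first exact: ltW.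
  move=> s s0T; rewrite {1}(hr _ (uV s s0T)) (inner_sum Sl ml r (fun p => u s (sval p).1) pS (psiS i)).
  by apply: eq_bigr => p _; exact: mulrC.
(* Testing with psi i leaves the scalar problem with parameter lam i and datum
   m q0 (psi i) + m q1 (psi i) * s. *)
have err i : `|m (u t \- U n) (psi i)| <= K * (`|m q0 (psi i)| * tau `^ alpha +
    `|m q1 (psi i)| * (tau ^+ 2 * t `^ (alpha - 1))).
  have u0V s : 0 <= s <= T -> V (u s) by exact: uV.
  have t0T : 0 <= t <= T by rewrite /t tge0 tT.
  have yE s : 0 <= s <= T -> \int[lebesgue_measure]_(z in `[0, s]) gam i z = m (u s) (psi i) - m vh (psi i).
    by move=> s0T; rewrite ((dgam i).2 s s0T) uh -/vh addrC addKr.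
  have lvh : lam i * m vh (psi i) = 0 by rewrite mC -apsi// aC// avh.
  have eE : m (u t \- U n) (psi i) = \int[lebesgue_measure]_(z in `[0, t]) gam i z - m (W n) (psi i).
    have us : S (u t) by apply: VS; exact: u0V.
    have ws : S (W n) by apply: VS; exact: Wv.
    have vs : S vh by exact: VS.
    rewrite yE// UE uh -/vh.
    rewrite (_ : _ \- _ = (fun x => (-1) * ((-1) * (-1) * vh x + W n x) + u t x)).
      by rewrite ml// ?ml//; [ring|exact: SL].
    by apply/funext => x; rewrite /=; ring.
  rewrite eE; apply: (hK T (lam i) (m q0 (psi i)) (m q1 (psi i)) tau (gam i) (fun k => m (W k) (psi i)) N n) => //.
  - by rewrite NT.
  - exact: (dgam i).1.
  - move=> s s0T.
    have ms : measurable (`]0, s[%classic : set (measurableTypeR R)) by [].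
    have := (Rintegral_lincomb ms r (fun p => m (sval p).2 (psi i)) (fun p => igx s (sval p).1 s0T)).1.
    rewrite (_ : (fun z => \sum_(p <- r) _) = (fun z => gam i z / (s - z) `^ alpha))//.
    by apply/funext => z; rewrite /gam mulr_suml; apply: eq_bigr => p _; rewrite mulrA.
  - move=> s s0T; have /andP[s0 sT] := s0T.
    have s0T' : 0 <= s <= T by rewrite ltW.
    have ms : measurable (`]0, s[%classic : set (measurableTypeR R)) by [].
    have := (Rintegral_lincomb ms r (fun p => m (sval p).2 (psi i)) (fun p => igx s (sval p).1 s0T)).2.
    rewrite (_ : (fun z => \sum_(p <- r) _) = (fun z => gam i z / (s - z) `^ alpha)); last first.
      by apply/funext => z; rewrite /gam mulr_suml; apply: eq_bigr => p _; rewrite mulrA.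
    move=> ->; have := ueq s s0T (psi i) (psiV i); rewrite -/m.
    rewrite capE// (inner_sum Sl ml r (fun p => D (sval p).1 s) pS (psiS i)) fpsi => <-.
    have usV := u0V s s0T'.
    have -> : dirichlet_form Omega Th (u s) (psi i) = lam i * m (u s) (psi i).
      by rewrite -[LHS]/(a (u s) (psi i)) aC// apsi// mC.
    rewrite yE// mulrBr lvh subr0; congr (_ + _).
    rewrite mulr_sumr; apply: eq_bigr => p _; by rewrite mulrCA [RHS]mulrC.
  - by rewrite W0; exact: (inner_fun0 Sl ml (psiS i)).
  - move=> k /andP[k0 kN]; have [_ Wk] := WV k (introT andP (conj k0 kN)).
    have kN1 : (k.-1 <= N)%N by rewrite (leq_trans (leq_pred k)).
    have WkV := Wv k kN; have WpV := Wv k.-1 kN1.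
    have [DkV Dk] := aL _ _ WkV (psiV i); have [DpV Dp] := aL _ _ WpV (psiV i).
    have [DhV Dhv] := aL _ _ vhV (psiV i).
    have WS (j : 'I_k.+1) : S (W j) by apply: VS; apply: Wv; rewrite (leq_trans (leq_ord j)).
    have PhS s := hPh _ (fS s).
    pose A x := \sum_(j < k.+1) tau `^ (- alpha) * averaged_weights wt (k - j) * W j x.
    have AS : S A by apply: (lincomb_sum (P := S)).
    have AE : m A (psi i) = discrete_derivative alpha tau wt (fun j => m (W j) (psi i)) k.
      rewrite (inner_sum Sl ml _ _ WS (psiS i)) /discrete_derivative mulr_sumr.
      by apply: eq_bigr => j _; rewrite mulrA.
    have E : (fun x => (- 2^-1) * (1 * Dh (W k) x + Dh (W k.-1) x) + A x) =
        (fun x => 2^-1 * (1 * Ph (f (k%:R * tau)) x + Ph (f (k.-1%:R * tau)) x) + Dh vh x).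
      apply/funext => x; have := Wk x; rewrite -/vh /discrete_derivative mulr_sumr !mul1r => <-.
      by rewrite mulNr [RHS]addrC; congr (_ + _); apply: eq_bigr => j _; rewrite -mulrA.
    have DkS := VS _ DkV; have DpS := VS _ DpV; have DhS := VS _ DhV.
    have PkV := (PhS (k%:R * tau)).1; have PpV := (PhS (k.-1%:R * tau)).1.
    have PkE := (PhS (k%:R * tau)).2 _ (psiV i); have PpE := (PhS (k.-1%:R * tau)).2 _ (psiV i).
    have PkS := VS _ PkV; have PpS := VS _ PpV.
    have sl1 v w : S v -> S w -> S (fun x => 1 * v x + w x) by move=> vS wS; exact: SL.
    have := congr1 (fun v => m v (psi i)) E.
    rewrite !ml//; [|exact: sl1|exact: sl1].
    rewrite AE Dk Dp Dhv avh// /m PkE PpE -/m !fpsi.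
    rewrite (aC (W k))// (aC (W k.-1))// !apsi// !(mC (psi i)) => Eq.
    by rewrite !mul1r subr0 -opprD mulrNN addrC in Eq.
have tS : 0 <= t <= T by rewrite /t tge0 tT.
have eV : V (u t \- U n).
  rewrite UE uh -/vh.
  rewrite (_ : _ \- _ = (fun x => (-1) * ((-1) * (-1) * vh x + W n x) + u t x)).
    by apply: (VL); [apply: VL => //; exact: Wv|exact: uV].
  by apply/funext => x; rewrite /=; ring.
rewrite {1}/L2_norm -/(m _ _) parseval//.
have B0 : 0 <= tau ^+ 2 * t `^ (alpha - 1) by rewrite mulr_ge0 ?powR_ge0// sqr_ge0.
apply: le_trans (sqrt_sum_bound (ltW K0) (powR_ge0 tau alpha) B0 (m0 q0) (m0 q1) err
  (bessel _ S0) (bessel _ S1)) _.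
rewrite ler_wpM2l ?mulr_ge0 ?(ltW K0)// -/(L2_norm Omega q0) -/(L2_norm Omega q1).
rewrite [leRHS]addrC lerD2l -mulrA ler_wpM2l ?sqr_ge0// lerDr.
by apply: mulr_ge0; [exact: powR_ge0|exact: sqrtr_ge0].
Qed.
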